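(* Let $2 \leq p \leq q \le \infty$ and $k \in \mathbb{N}$. Then \[ \mathrm{ac}_k(B_p^m,B_q^m) \lesssim \frac{1}{\frac{1}{2}-\frac{1}{p}+\frac{1}{q}} \cdot \frac{\sqrt{\min\{ p, \log (\frac{2m}{k}) \}}}{k^{1/2+1/p-1/q}}. \] Moreover, given $X\subseteq B_p^m$ and $\boldsymbol{z}\in\mathrm{conv}(X)$, where $\boldsymbol{z}$ is given as a convex combination of at most $m+1$ vectors in $X$, vectors $\boldsymbol{v}_1,\ldots,\boldsymbol{v}_k\in X$ (repetition allowed) for which $\|\boldsymbol{z}-\frac1k\sum_{i=1}^k\boldsymbol{v}_i\|_q \lesssim \frac{1}{\frac{1}{2}-\frac{1}{p}+\frac{1}{q}} \cdot \frac{\sqrt{\min\{ p, \log (\frac{2m}{k}) \}}}{k^{1/2+1/p-1/q}}$ can be found in time $O(\log^2 m) \cdot T(m,m+1) \leq O(m^{1+\omega}\log^2(m))$.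
   Context: $m$ is a positive integer; $B_p^m := \{ \boldsymbol{x} \in \mathbb{R}^m \mid \|\boldsymbol{x}\|_p \leq 1\}$; $1/\infty=0$ and $1/0=+\infty$ (so the bound is vacuous for $p=2,q=\infty$). $A\lesssim B$ means $A\le C\cdot B$ for a universal constant $C>0$. For symmetric convex bodies $P,Q\subseteq\mathbb{R}^m$, with $\|\boldsymbol{x}\|_Q=\min\{s\ge 0\mid \boldsymbol{x}\in sQ\}$, \[ \mathrm{ac}_k(P,Q) := \sup_{X \subseteq P,\ \boldsymbol{z} \in \mathrm{conv}(X)}\ \inf_{\boldsymbol{v}_1,\ldots,\boldsymbol{v}_k \in X} \Big\|\boldsymbol{z}-\frac{1}{k}\sum_{i=1}^k \boldsymbol{v}_i\Big\|_Q , \] where the $\boldsymbol{v}_i$ may be taken with repetition. $T(m,n)$: for $\boldsymbol{A}\in\mathbb{R}^{m\times n}$ with rows $\boldsymbol{A}_1,\dots,\boldsymbol{A}_m$ and $\boldsymbol{x}_0\in[-1,1]^n$, $\mathcal{D}(\boldsymbol{A},\boldsymbol{x}_0)$ denotes the (Lovett–Meka) distribution on $[-1,1]^n$ with the following properties, where $C_1,C_2>0$ are fixed, small enough universal constants. (A) For all $\boldsymbol{x}\sim\mathcal{D}(\boldsymbol{A},\boldsymbol{x}_0)$, $|\{j\in[n]: x_j\in\{\pm1\}\}|\ge n/2$. (B) For all $\boldsymbol{x}\sim\mathcal{D}(\boldsymbol{A},\boldsymbol{x}_0)$, $\|\boldsymbol{A}(\boldsymbol{x}-\boldsymbol{x}_0)\|_\infty\le\Delta$,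 where $\Delta\ge0$ is any parameter satisfying $\sum_{i=1}^m\exp(-C_1\Delta^2/\|\boldsymbol{A}_i\|_2^2)\le C_2 n$. (C) $\mathbb{E}[\boldsymbol{x}]=\boldsymbol{x}_0$. (D) $\boldsymbol{x}-\boldsymbol{x}_0$ is $O(1)$-subgaussian; in particular $\|\langle\boldsymbol{A}_i,\boldsymbol{x}-\boldsymbol{x}_0\rangle\|_{\psi_2}\lesssim\|\boldsymbol{A}_i\|_2$ for all $i$, where $\|Y\|_{\psi_2}=\inf\{s>0:\mathbb{E}[\exp(Y^2/s^2)]\le2\}$. $T(m,n)$ is the best running time to generate a sample from this distribution; it is assumed to be non-decreasing in $m$ and $n$ with $T(m,n)\ge mn$, and it is known that $T(m,n)\le O(n^{1+\omega}+n^2m)$, where $\omega$ is the exponent of matrix multiplication.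
   Formalization: log(2m/k) is read as max(log 2, log(2m/k)), since the bound fails at k=2m (e.g. m=1, k=2) and is undefined for k>2m; log² m is read as log² max(m,2); ''found'' means with probability at least 1/2, the v_i being output as multiplicities. *)

(* Defs.v *)
From HB Require Import structures.
From mathcomp Require Export all_boot all_order all_algebra.
From mathcomp Require Export all_classical all_reals all_analysis.

Set Implicit Arguments.
Unset Strict Implicit.
Unset Printing Implicit Defensive.

Import Order.TTheory GRing.Theory Num.Theory.
Import numFieldNormedType.Exports.

Local Open Scope classical_set_scope.
Local Open Scope ring_scope.

Section ApproximateCaratheodory.
Variables (R : realType) (m : nat).
Implicit Types (P Q X : set 'cV[R]_m) (x z : 'cV[R]_m) (p q : \bar R).

Definition lpnorm p x : R :=
  match p with
  | r%:E => (\sum_i `|x i ord0| `^ r) `^ r^-1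
  | +oo%E => \big[Num.max/0]_i `|x i ord0|
  | -oo%E => 0
  end.

Definition lpball p : set 'cV[R]_m := [set x | lpnorm p x <= 1].

Definition convex_comb n (lam : 'I_n -> R) (v : 'I_n -> 'cV[R]_m) z :=
  [/\ forall j, 0 <= lam j, \sum_j lam j = 1 & z = \sum_j lam j *: v j].

Definition conv X : set 'cV[R]_m :=
  [set z | exists n (lam : 'I_n -> R) (v : 'I_n -> 'cV[R]_m),
     (forall j, X (v j)) /\ convex_comb lam v z].

(* The infimum is attained when Q is a symmetric convex body. *)
Definition gauge Q x : \bar R :=
  ereal_inf [set s%:E | s in [set s : R | 0 <= s /\ exists2 y, Q y & x = s *: y]].

Definition ac (k : nat) P Q : \bar R :=
  ereal_sup [set ereal_inf [set gauge Q (Xz.2 - k%:R^-1 *: \sum_i v i)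
                           | v in [set v : 'I_k -> 'cV[R]_m | forall i, Xz.1 (v i)]]
            | Xz in [set Xz : set 'cV[R]_m * 'cV[R]_m
                    | Xz.1 `<=` P /\ conv Xz.1 Xz.2]].

End ApproximateCaratheodory.

(* The logarithm is read as max (log 2) (log (2m/k)).  This is log (2m/k) for
   k <= m; for k >= 2m the unmodified expression is nonpositive.  The inverses
   of extended reals satisfy 1/oo = 0 and 1/0 = +oo. *)
Definition ac_bound (R : realType) (m k : nat) (p q : \bar R) : \bar R :=
  (((2^-1)%:E - p^-1 + q^-1)^-1 *
   (Num.sqrt (fine (Order.min p
       (Num.max (ln 2) (ln (2 * m%:R / k%:R)))%:E))
    / k%:R `^ (2^-1 + fine p^-1 - fine q^-1))%:E)%E.

Section LovettMeka.
Variable R : realType.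

Definition psi2norm d (T : measurableType d) (P : probability T R) (Y : T -> R)
  : \bar R :=
  ereal_inf [set s%:E | s in [set s : R | 0 < s /\
    ('E_P[fun x => expR ((Y x / s) ^+ 2)%R] <= 2%:E)%E]].

Definition in_cube n (x : n.-tuple R) := [forall j, `|tnth x j| <= 1].

Definition sampler :=
  forall m n, 'M[R]_(m, n) -> n.-tuple R -> probability (n.-tuple R) R.

(* Zero rows are left out of the budget of property B, following
   exp(-c/0) = 0: the corresponding constraint is void. *)
Definition row_budget m n (C1 C2 : R) (A : 'M[R]_(m, n)) (Delta : R) :=
  \sum_(i | row i A != 0)
    expR (- (C1 * Delta ^+ 2 / \sum_j A i j ^+ 2)) <= C2 * n%:R.

Definition lovett_meka (C1 C2 C3 : R) (D : sampler) :=
  forall m n (A : 'M[R]_(m, n)) (x0 : n.-tuple R),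
    (0 < m)%N -> (0 < n)%N -> in_cube x0 ->
    let P := D m n A x0 in
    [/\ {ae P, forall x : n.-tuple R, in_cube x},
        {ae P, forall x : n.-tuple R,
           (n <= 2 * #|[pred j | (`|tnth x j| == 1)%R]|)%N},
        forall Delta : R, 0 <= Delta -> row_budget C1 C2 A Delta ->
          {ae P, forall x : n.-tuple R, forall i,
             `|\sum_j A i j * (tnth x j - tnth x0 j)| <= Delta},
        forall j, ('E_P[fun x : n.-tuple R => tnth x j] = (tnth x0 j)%:E)%E
      & forall theta : 'I_n -> R,
          (psi2norm P (fun x : n.-tuple R => \sum_j theta j * (tnth x j - tnth x0 j))%R
           <= (C3 * Num.sqrt (\sum_j theta j ^+ 2))%:E)%E ].

End LovettMeka.

Definition sampling_time (T : nat -> nat -> nat) :=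
  (forall m1 m2 n1 n2, m1 <= m2 -> n1 <= n2 -> T m1 n1 <= T m2 n2)%N /\
  (forall m n, m * n <= T m n)%N.

(* While programs over a real RAM.  The memory consists of named arrays of
   natural numbers and named arrays of reals.  Reals are exact; truncation of a
   nonnegative real to a natural number is a primitive.  The only constants are
   natural numbers, and the only source of randomness is the sampler. *)
Inductive nexp :=
  | NConst of nat
  | NLoad of nat & nexp
  | NAdd of nexp & nexp
  | NSub of nexp & nexp
  | NMul of nexp & nexp
  | NTrunc of rexp
with rexp :=
  | RNat of nexp
  | RLoad of nat & nexp
  | RAdd of rexp & rexp
  | RSub of rexp & rexp
  | RMul of rexp & rexp
  | RDiv of rexp & rexp.

Inductive bexp :=
  | BNLe of nexp & nexp
  | BRLe of rexp & rexp
  | BNot of bexp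
  | BAnd of bexp & bexp.

(* [Sample d a x m n] draws from the distribution of the m x n matrix stored
   row by row in real array a, started at the point stored in real array x, and
   writes the result to real array d. *)
Inductive cmd :=
  | NStore of nat & nexp & nexp
  | RStore of nat & nexp & rexp
  | If of bexp & seq cmd & seq cmd
  | While of bexp & seq cmd
  | Sample of nat & nat & nat & nexp & nexp.

Section Semantics.
Variables (R : realType) (D : sampler R) (T : nat -> nat -> nat).

Record state := State {
  nmem : nat -> nat -> nat;
  rmem : nat -> nat -> R }.

Definition update U (f : nat -> nat -> U) a i u : nat -> nat -> U :=
  fun b j => if (b == a) && (j == i) then u else f b j.

Fixpoint neval (s : state) (e : nexp) : nat :=
  match e with
  | NConst c => c
  | NLoad a i => nmem s a (neval s i)
  | NAdd e1 e2 => (neval s e1 + neval s e2)%N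
  | NSub e1 e2 => (neval s e1 - neval s e2)%N
  | NMul e1 e2 => (neval s e1 * neval s e2)%N
  | NTrunc e1 => Num.truncn (reval s e1)
  end
with reval (s : state) (e : rexp) : R :=
  match e with
  | RNat e1 => (neval s e1)%:R
  | RLoad a i => rmem s a (neval s i)
  | RAdd e1 e2 => reval s e1 + reval s e2
  | RSub e1 e2 => reval s e1 - reval s e2
  | RMul e1 e2 => reval s e1 * reval s e2
  | RDiv e1 e2 => reval s e1 / reval s e2
  end.

Fixpoint beval (s : state) (b : bexp) : bool :=
  match b with
  | BNLe e1 e2 => (neval s e1 <= neval s e2)%N
  | BRLe e1 e2 => reval s e1 <= reval s e2
  | BNot b1 => ~~ beval s b1
  | BAnd b1 b2 => beval s b1 && beval s b2
  end.

Definition load_mx (s : state) a m n : 'M[R]_(m, n) :=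
  \matrix_(i, j) rmem s a (i * n + j)%N.

Definition load_tuple (s : state) a n : n.-tuple R :=
  [tuple rmem s a (val j) | j < n].

Definition store_tuple (s : state) a n (x : n.-tuple R) : state :=
  State (nmem s)
    (fun b j => if (b == a) && (j < n)%N then nth 0 x j else rmem s b j).

(* [success fuel b K s post] is the probability that the command list K, run
   from s, halts within time b in a state satisfying post.  An assignment or a
   test costs 1 (expressions have size bounded by the program text); a sample
   of dimensions m and n costs T m n, and is a failure when the sampler is not
   defined at its arguments.  Each step costs at least 1, so fuel = b is enough.
   Successive samples are independent: each integral is taken with respect to
   the distribution determined by the current state.  Integrals of nonnegative
   functions are suprema over simple functions below the integrand, so in the
   absence of measurability the value is a lower bound for the probability. *)
Fixpoint success (fuel b : nat) (K : seq cmd) (s : state) (post : state -> Prop)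
    {struct fuel} : \bar R :=
  match K with
  | [::] => (`[< post s >]%:R)%:E
  | c :: K' =>
    if fuel is f.+1 then
      if (0 < b)%N then
        match c with
        | NStore a i e =>
            success f b.-1 K'
              (State (update (nmem s) a (neval s i) (neval s e)) (rmem s)) post
        | RStore a i e =>
            success f b.-1 K'
              (State (nmem s) (update (rmem s) a (neval s i) (reval s e))) post
        | If t K1 K2 =>
            success f b.-1 ((if beval s t then K1 else K2) ++ K') s post
        | While t K1 =>
            success f b.-1 (if beval s t then K1 ++ c :: K' else K') s post
        | Sample d a x em en =>
            let m := neval s em in
            let n := neval s en in
            let x0 := load_tuple s x n in
            if [&& 0 < m, 0 < n, T m n <= b & in_cube x0]%N then
              (\int[D (load_mx s a m n) x0]_y
                 success f (b - T m n) K' (store_tuple s d y) post)%E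
            else 0%E
        end
      else 0%E
    else 0%E
  end.

Definition success_within (b : nat) (prog : seq cmd) (s : state)
    (post : state -> Prop) : \bar R := success b b prog s post.

Definition input_state m n k (p q : \bar R) (v : 'I_n -> 'cV[R]_m)
    (lam : 'I_n -> R) : state :=
  State
    (fun a i => if a == 0%N then nth 0%N [:: m; n; k] i else 0%N)
    (fun a i => match a with
       | 0%N => if insub (i %/ n)%N is Some r then
                  if insub (i %% n)%N is Some j then v j r ord0 else 0
                else 0
       | 1%N => if insub i is Some j then lam j else 0
       | 2%N => nth 0 [:: fine p^-1; fine q^-1] i
       | _ => 0
       end).

(* The output vectors are given by their multiplicities in nat array 1: a list
   of k vectors cannot be written in time independent of k. *)
Definition output_vectors m n (v : 'I_n -> 'cV[R]_m) (s : state)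
  : seq 'cV[R]_m :=
  flatten [seq nseq (nmem s 1 (val j)) (v j) | j <- enum 'I_n].

End Semantics.

Section MatrixMultiplicationExponent.
Variable R : realType.

(* Straight-line programs over R; arguments are positions in the list
   consisting of the inputs followed by the results computed so far.  Allowing
   divisions does not change the exponent. *)
Inductive slp_instr :=
  | SConst of R
  | SAdd of nat & nat
  | SSub of nat & nat
  | SMul of nat & nat.

Definition slp_step (vals : seq R) (c : slp_instr) : seq R :=
  rcons vals
    match c with
    | SConst a => a
    | SAdd i j => vals`_i + vals`_j
    | SSub i j => vals`_i - vals`_j
    | SMul i j => vals`_i * vals`_j
    end.

Definition mx_entries n (A : 'M[R]_n) : seq R :=
  codom (fun ij : 'I_n * 'I_n => A ij.1 ij.2).

Definition computes_mulmx n (prog : seq slp_instr) :=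
  exists out : 'I_n -> 'I_n -> nat, forall A B : 'M[R]_n, forall i j,
    (foldl slp_step (mx_entries A ++ mx_entries B) prog)`_(out i j)
    = (A *m B) i j.

Definition omega : R :=
  inf [set tau | exists C : R, forall n, (0 < n)%N ->
    exists2 prog, computes_mulmx n prog & (size prog)%:R <= C * n%:R `^ tau].

End MatrixMultiplicationExponent.

(* log^2 m, with log m read as log 2 for m = 1. *)
Definition log2sq (R : realType) (m : nat) : R := (ln (maxn m 2)%:R) ^+ 2.

(* Main.v *)
(* Start from multiplicities a_j with sum 2^L k that approximate the convex
   combination, rounding the cumulative sums of the coefficients, and halve the
   total L times.  To halve, pair up the vectors of odd multiplicity and shift
   one unit inside each pair; the signs of the shifts come from repeated partial
   colourings of the differences v - v'.  With h pairs left, r the minimum of p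
   and max (2, log (2m/h)), and W of order sqrt r * h^(1/2-1/p), one partial
   colouring has sup norm O(W) and l_r norm O(W h^(1/r)); interpolation gives
   l_q norm O(sqrt r * h^(1/2-1/p+1/q)).  Since h decreases geometrically, these
   errors telescope against a potential of the form
   h^(al/2) + h^(1/2), which loses only a factor 1/al with al = 1/2-1/p+1/q.

   For existence, the partial colouring is the difference of two points of
   {-1,1}^h in the same cell of a rounded image (entropy method).  For the
   algorithm it is a Lovett-Meka sample; the error bound only holds in
   expectation, so the potential bounds the expected total error and Markov's
   inequality is applied once, at the end.  The last part needs omega >= 2, which
   holds because the n^2 entries of a product are distinct polynomials. *)
Require Import Defs.
From mathcomp Require Import ring lra zify measurable_realfun.

Set Implicit Arguments.
Unset Strict Implicit.
Unset Printing Implicit Defensive.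

Import Order.TTheory GRing.Theory Num.Theory.
Import numFieldNormedType.Exports.

Local Open Scope classical_set_scope.
Local Open Scope ring_scope.

(** * Powers and l_p norms *)

(** The number m of rows enters a colouring round through the factor (m/h)^(1-r/p), and this
    dictates the order r: for r = p the exponent vanishes, for r >= log(2m/h) the factor is at most
    e^r, which an r-th root makes harmless. One moment sum then feeds the cell counting, the budget
    of property B and the subgaussian moments of property D. The order r is taken at h, whereas the
    rate has its order at k. Below k the logarithm can grow by log(k/h); giving up half of the
    exponent al pays for this, since al >= 1/4 when p > 4 and r <= 4 otherwise. Above k the power
    1/2 takes over, small enough for the errors of the levels 2^l k to sum geometrically. A success
    probability is a nested integral of a function not known to be measurable, so the expectation of
    the final error is never formed. What is carried backwards through the program is that success
    has probability at least 1 - (current error + potential)/E, that is, Markov's inequality in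
    advance; a sample only integrates a measurable majorant of its own error. For p = 2 and q = oo
    the bound is infinite but the running time is not; the run is then analysed with q replaced by
    p. *)

Section RealInequalities.
Variable R : realType.
Implicit Types a u s t x y : R.

(** In logarithms this is ln (u/a) <= u/a. It turns exponential moments into r-th moments, and its
    price a^a is the source of the factor sqrt r in the rate. *)
Lemma powR_le_expR a u : 0 < a -> 0 <= u -> u `^ a <= a `^ a * expR u.
Proof.
move=> a0; rewrite le_eqVlt => /predU1P[<-|u0].
  by rewrite powR0 ?gt_eqF// mulr_ge0 ?powR_ge0 ?expR_ge0.
rewrite -[leLHS]lnK ?posrE ?powR_gt0// -[a `^ a]lnK ?posrE ?powR_gt0//.
rewrite -expRD ler_expR !ln_powR.
have : a * ln (u / a) <= a * (u / a).
  by rewrite ler_pM2l// ltW// ln_sublinear// divr_gt0.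
rewrite ln_div ?posrE// mulrBr [a * (u / a)]mulrC divfK ?gt_eqF//.
lra.
Qed.

(** Bernoulli's inequality for real exponents: Young's inequality for the product of t and 1 with
    the conjugate exponents s and s/(s-1), multiplied by s. *)
Lemma le1Dx_powR s t : 1 <= s -> 0 <= t -> 1 + s * (t - 1) <= t `^ s.
Proof.
move=> s1 t0; have s0 : 0 < s by lra.
have [->|s1'] := eqVneq s 1; first by rewrite powRr1//; lra.
have s1_gt0 : 0 < s - 1 by rewrite lt_neqAle subr_ge0 s1 andbT eq_sym subr_eq0.
have := @conjugate_powR R t 1 s (s / (s - 1)) t0 ler01 s0 (divr_gt0 s0 s1_gt0).
rewrite invf_div mulr1 powR1 => /(_ _).
have -> : s^-1 + (s - 1) / s = 1 by field; rewrite gt_eqF.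
move=> /(_ erefl); rewrite -(ler_pM2l s0) mulrDr.
have -> : s * (t `^ s / s) = t `^ s by field; rewrite gt_eqF.
have -> : s * (1 * ((s - 1) / s)) = s - 1 by field; rewrite gt_eqF.
lra.
Qed.

(** The tangent of t^s at the mean [M] lies below the function; averaged against [w] it gives
    exactly M^s, because the linear term cancels. *)
Lemma powR_jensen (I : finType) (w x : I -> R) s :
    1 <= s -> (forall i, 0 <= w i) -> \sum_i w i = 1 -> (forall i, 0 <= x i) ->
  (\sum_i w i * x i) `^ s <= \sum_i w i * x i `^ s.
Proof.
move=> s1 w0 w1 x0; set M := \sum_i w i * x i.
have : 0 <= M by apply: sumr_ge0 => i _; exact: mulr_ge0.
rewrite le_eqVlt => /predU1P[<-|M0].
  rewrite powR0; last by lra.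
  by apply: sumr_ge0 => i _; rewrite mulr_ge0 ?powR_ge0.
have xE i : x i `^ s = M `^ s * (x i / M) `^ s.
  by rewrite -powRM ?(ltW M0) ?divr_ge0 ?(ltW M0)// mulrC divfK// gt_eqF.
rewrite (eq_bigr (fun i => M `^ s * (w i * (x i / M) `^ s))); last first.
  by move=> i _; rewrite xE mulrCA.
rewrite -mulr_sumr ler_peMr ?powR_ge0//.
apply: (@le_trans _ _ (\sum_i w i * (1 + s * (x i / M - 1)))); last first.
  by apply: ler_sum => i _; rewrite ler_wpM2l// le1Dx_powR// divr_ge0// ltW.
rewrite (eq_bigr (fun i => (1 - s) * w i + s / M * (w i * x i))); last first.
  by move=> i _; field; rewrite gt_eqF.
by rewrite big_split/= -!mulr_sumr w1 -/M divfK ?gt_eqF//; lra.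
Qed.

(** Jensen with equal weights. It serves as Hölder's inequality, between l_r and l_p on the m
    coordinates and between squares and r-th powers on the h columns. *)
Lemma powR_sum_le (I : finType) (x : I -> R) s :
    1 <= s -> (forall i, 0 <= x i) ->
  (\sum_i x i) `^ s <= #|I|%:R `^ (s - 1) * \sum_i x i `^ s.
Proof.
move=> s1 x0; have [I0|I0] := posnP #|I|.
  rewrite !big1 ?mulr0 ?powR0//; first by lra.
  - by move=> i; have := fintype0 i.
  - by move=> i; have := fintype0 i.
have n0 : 0 < (#|I|%:R : R) by rewrite ltr0n.
have := @powR_jensen I (fun=> #|I|%:R^-1) x s s1 _ _ x0.
rewrite sumr_const -[X in X = 1]mulr_natr mulVf ?gt_eqF// => /(_ _ erefl).
have in0 : 0 <= (#|I|%:R^-1 : R) by rewrite invr_ge0 ltW.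
rewrite -!mulr_sumr => /(_ (fun=> in0)).
rewrite powRM ?sumr_ge0// -(ler_pM2l (powR_gt0 s n0)) !mulrA.
rewrite -powRM ?(ltW n0)// divff ?gt_eqF// powR1 mul1r.
by rewrite -(@powR_inv1 _ #|I|%:R) ?(ltW n0)// -powRD ?(gt_eqF n0)/= ?implybT.
Qed.

Lemma ler_powR2r s x y : 0 <= s -> 0 <= x -> x <= y -> x `^ s <= y `^ s.
Proof.
move=> s0 x0 xy; apply: ge0_ler_powR => //; rewrite nnegrE//.
exact: le_trans xy.
Qed.

Lemma powRK s x : s != 0 -> 0 <= x -> (x `^ s) `^ s^-1 = x.
Proof. by move=> s0 x0; rewrite -powRrM divff// powRr1. Qed.

Lemma powRVK s x : s != 0 -> 0 <= x -> (x `^ s^-1) `^ s = x.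
Proof. by move=> s0 x0; rewrite -powRrM mulVf// powRr1. Qed.

End RealInequalities.

Section Lpnorm.
Variables (R : realType) (m : nat).
Implicit Types (x y : 'cV[R]_m) (p q : \bar R).

Lemma lpnorm_ge0 p x : 0 <= lpnorm p x.
Proof.
case: p => [r| |] //=; first exact: powR_ge0.
by apply: bigmax_ge_id.
Qed.

Lemma lpnormZ p (c : R) x : (0 < p)%E -> lpnorm p (c *: x) = `|c| * lpnorm p x.
Proof.
case: p => [r| |] //= p0.
  rewrite lte_fin in p0.
  rewrite (eq_bigr (fun i => `|c| `^ r * `|x i ord0| `^ r)); last first.
    by move=> i _; rewrite !mxE normrM powRM.
  rewrite -mulr_sumr powRM ?powR_ge0//; last first.
    by apply: sumr_ge0 => i _; exact: powR_ge0.
  by rewrite powRK ?gt_eqF.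
under eq_bigr do rewrite mxE normrM.
by elim/big_rec2: _ => [|i u v _ ->]; rewrite ?mulr0// maxr_pMr.
Qed.

Lemma lpnorm0 p : (0 < p)%E -> lpnorm p (0 : 'cV[R]_m) = 0.
Proof. by move=> p0; rewrite -(scale0r 0) lpnormZ// normr0 mul0r. Qed.

Lemma lpnormN p x : (0 < p)%E -> lpnorm p (- x) = lpnorm p x.
Proof. by move=> p0; rewrite -scaleN1r lpnormZ// normrN1 mul1r. Qed.

Lemma lpnorm_eq0 p x : (0 < p)%E -> lpnorm p x = 0 -> x = 0.
Proof.
case: p => [r| |] //= p0 => [/powR_eq0_eq0/psumr_eq0P x0|x0].
  apply/matrixP => i j; rewrite ord1 mxE; apply/eqP.
  by rewrite -normr_eq0; apply/eqP/(@powR_eq0_eq0 _ _ r)/x0 => // k _; exact: powR_ge0.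
apply/matrixP => i j; rewrite ord1 mxE; apply/eqP.
by rewrite -normr_le0 -x0; exact: le_bigmax.
Qed.

Lemma lpnorm_le1P (r : R) x : 0 < r ->
  reflect (\sum_i `|x i ord0| `^ r <= 1) (lpnorm r%:E x <= 1).
Proof.
move=> r0 /=; have S0 : 0 <= \sum_i `|x i ord0| `^ r.
  by apply: sumr_ge0 => i _; exact: powR_ge0.
apply: (iffP idP) => h; last by rewrite -[leRHS](congr1 (fun f => f r^-1) (@powR1 R)) ler_powR2r// invr_ge0 ltW.
rewrite -(@powRVK _ r _ _ S0) ?gt_eqF//.
by rewrite -[leRHS](congr1 (fun f => f r) (@powR1 R)) ler_powR2r ?(ltW r0) ?powR_ge0.
Qed.

(** For finite p this is, coordinate by coordinate, Jensen on the two-point set [bool]. Minkowski's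
    inequality follows from it by normalising both vectors. *)
Lemma lpnorm_convex p x y (a b : R) : (1 <= p)%E -> 0 <= a -> 0 <= b -> a + b = 1 ->
  lpnorm p x <= 1 -> lpnorm p y <= 1 -> lpnorm p (a *: x + b *: y) <= 1.
Proof.
case: p => [r| |//]; last first.
  move=> _ a0 b0 ab1 /bigmax_leP[_ hx] /bigmax_leP[_ hy].
  apply/bigmax_leP; split=> // i _; rewrite !mxE (le_trans (ler_normD _ _))//.
  rewrite !normrM (ger0_norm a0) (ger0_norm b0) -ab1 lerD//.
    by rewrite ler_piMr// hx.
  by rewrite ler_piMr// hy.
rewrite lee_fin => r1 a0 b0 ab1; have r0 : 0 < r by lra.
move=> /(lpnorm_le1P x r0) hx /(lpnorm_le1P y r0) hy; apply/(lpnorm_le1P _ r0).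
apply: (@le_trans _ _ (\sum_i (a * `|x i ord0| `^ r + b * `|y i ord0| `^ r))).
  apply: ler_sum => i _; rewrite !mxE.
  apply: (@le_trans _ _ ((a * `|x i ord0| + b * `|y i ord0|) `^ r)).
    apply: ler_powR2r => //; first lra.
    by rewrite (le_trans (ler_normD _ _))// !normrM (ger0_norm a0) (ger0_norm b0).
  have := @powR_jensen R bool (fun t => if t then a else b)
    (fun t => if t then `|x i ord0| else `|y i ord0|) r r1.
  by rewrite !big_bool/=; apply => // -[].
rewrite big_split/= -!mulr_sumr -ab1 lerD//; by rewrite ler_piMr.
Qed.

Lemma ler_lpnormD p x y : (1 <= p)%E -> lpnorm p (x + y) <= lpnorm p x + lpnorm p y.
Proof.
move=> p1; have p0 : (0 < p)%E by apply: lt_le_trans p1.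
have := lpnorm_ge0 p x; rewrite le_eqVlt => /predU1P[x0|x0].
  by rewrite (lpnorm_eq0 p0 (esym x0)) add0r lpnorm0// add0r.
have := lpnorm_ge0 p y; rewrite le_eqVlt => /predU1P[y0|y0].
  by rewrite (lpnorm_eq0 p0 (esym y0)) addr0 lpnorm0// addr0.
set a := lpnorm p x in x0 *; set b := lpnorm p y in y0 *.
have ab0 : 0 < a + b by exact: addr_gt0.
have -> : x + y = (a + b) *: ((a / (a + b)) *: (a^-1 *: x) + (b / (a + b)) *: (b^-1 *: y)).
  rewrite scalerDr !scalerA.
  have -> : (a + b) * (a / (a + b)) / a = 1 by field; rewrite !gt_eqF.
  have -> : (a + b) * (b / (a + b)) / b = 1 by field; rewrite !gt_eqF.
  by rewrite !scale1r.
rewrite lpnormZ// gtr0_norm// ler_piMr ?(ltW ab0)//.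
apply: lpnorm_convex => //.
- by rewrite divr_ge0 ?ltW.
- by rewrite divr_ge0 ?ltW.
- by rewrite -mulrDl divff// gt_eqF.
- by rewrite lpnormZ// gtr0_norm ?invr_gt0// mulVf ?gt_eqF.
- by rewrite lpnormZ// gtr0_norm ?invr_gt0// mulVf ?gt_eqF.
Qed.

Lemma ler_lpnorm_sum p (I : Type) (r : seq I) (F : I -> 'cV[R]_m) : (1 <= p)%E ->
  lpnorm p (\sum_(i <- r) F i) <= \sum_(i <- r) lpnorm p (F i).
Proof.
move=> p1; have p0 : (0 < p)%E by apply: lt_le_trans p1.
elim/big_rec2: _ => [|i u v _ uv]; first by rewrite lpnorm0.
by rewrite (le_trans (ler_lpnormD _ _ _))// lerD2l.
Qed.

Lemma le_lpnorm_coord p x i : (0 < p)%E -> `|x i ord0| <= lpnorm p x.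
Proof.
case: p => [r| |] //=; last by move=> _; exact: le_bigmax.
rewrite lte_fin => r0.
rewrite -[leLHS](@powRK _ r) ?gt_eqF//.
apply: ler_powR2r; rewrite ?invr_ge0 ?(ltW r0) ?powR_ge0//.
by rewrite (bigD1 i)//= lerDl sumr_ge0// => k _; exact: powR_ge0.
Qed.

Lemma lpnorm_le1W p q x : (0 < p)%E -> (p <= q)%E ->
  lpnorm p x <= 1 -> lpnorm q x <= 1.
Proof.
move=> p0 pq x1; have xi i : `|x i ord0| <= 1.
  exact: le_trans (le_lpnorm_coord x i p0) x1.
case: q pq => [s| |] //= pq; last by apply/bigmax_leP; split.
case: p p0 x1 pq => [r||] p0 x1 pq; [|by rewrite leye_eq in pq|by rewrite ltNge leNye in p0].
rewrite lte_fin in p0; rewrite lee_fin in pq; rename p0 into r0, pq into rs.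
have s0 : 0 < s by lra.
apply/(lpnorm_le1P x s0); move/(lpnorm_le1P x r0): x1.
apply: le_trans; apply: ler_sum => i _.
have [->|xi0] := eqVneq (`|x i ord0|) 0; first by rewrite !powR0 ?gt_eqF.
by rewrite ger_powR// xi andbT normr_gt0 -normr_eq0.
Qed.

End Lpnorm.

(** * The moment order and the estimates of one colouring round *)

Section MomentOrder.
Variables (R : realType) (m : nat).
Hypothesis m_gt0 : (0 < m)%N.
Implicit Types (p q : \bar R) (r x : R).

Lemma fine_inve_itv p : (2%:E <= p)%E -> 0 <= fine p^-1%E <= 2^-1.
Proof.
case: p => [r| |] //; last by rewrite invey /= => _; lra.
rewrite lee_fin fine_invr => r2.
by rewrite invr_ge0 lef_pV2 ?posrE; lra.
Qed.

Lemma le_fine_inve p q : (2%:E <= p)%E -> (p <= q)%E -> fine q^-1%E <= fine p^-1%E.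
Proof.
move=> p2 pq; have q2 := le_trans p2 pq.
have := fine_inve_itv p2; have := fine_inve_itv q2.
case: q pq q2 => [s| |] //; last by rewrite invey /=; lra.
case: p p2 => [r| |] //; rewrite !lee_fin !fine_invr => r2 rs s2 _ _.
by rewrite lef_pV2 ?posrE; lra.
Qed.

(* [x] is the number of columns that remain to be coloured. *)
Definition moment_order p x : R :=
  fine (Order.min p (Num.max 2 (ln (2 * m%:R / x)))%:E).

Lemma moment_orderE p x : (2%:E <= p)%E ->
  ((moment_order p x)%:E = Order.min p (Num.max 2 (ln (2 * m%:R / x)))%:E)%E.
Proof.
move=> p2; rewrite /moment_order fineK//.
by case: p p2 => [s| |//] p2; rewrite ?minye// -EFin_min.
Qed.

Lemma moment_order_le p x : (2%:E <= p)%E -> ((moment_order p x)%:E <= p)%E.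
Proof. by move=> p2; rewrite moment_orderE// ge_min lexx. Qed.

Lemma moment_order_ge2 p x : (2%:E <= p)%E -> 2 <= moment_order p x.
Proof.
by move=> p2; rewrite -lee_fin moment_orderE// le_min p2 lee_fin le_max lexx.
Qed.

(** Hölder's inequality between l_r and l_p, from [powR_sum_le] with exponent p/r applied to the
    r-th powers. For p = oo the bound on single coordinates is enough. *)
Lemma sum_powR_le p r c (x : 'cV[R]_m) : 0 < r -> (r%:E <= p)%E -> 0 <= c ->
  lpnorm p x <= c ->
  \sum_i `|x i ord0| `^ r <= c `^ r * m%:R `^ (1 - r * fine p^-1%E).
Proof.
move=> r0; case: p => [s| |//] rs c0 xc; last first.
  rewrite invey mulr0 subr0 powRr1//.
  rewrite (le_trans (ler_sum _ (G := fun=> c `^ r) _))//; last first.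
    by rewrite sumr_const card_ord mulr_natr.
  move=> i _; apply: ler_powR2r; rewrite ?(ltW r0)//.
  by apply: le_trans (le_lpnorm_coord _ _ _) xc.
rewrite lee_fin in rs; have s0 : 0 < s by lra.
rewrite fine_invr.
have sr1 : 1 <= s / r by rewrite ler_pdivlMr// mul1r.
have S0 : 0 <= \sum_i `|x i ord0| `^ r by apply: sumr_ge0 => i _; exact: powR_ge0.
have := @powR_sum_le R 'I_m (fun i => `|x i ord0| `^ r) (s / r) sr1 (fun i => powR_ge0 _ _).
rewrite card_ord => H.
have {H} := @ler_powR2r R (r / s) _ _ (divr_ge0 (ltW r0) (ltW s0)) (powR_ge0 _ _) H.
rewrite -{1}[r / s]invf_div powRK ?gt_eqF ?divr_gt0// => /le_trans; apply.
rewrite powRM ?powR_ge0//; last by apply: sumr_ge0 => i _; exact: powR_ge0.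
rewrite mulrC -powRrM.
have -> : (s / r - 1) * (r / s) = 1 - r / s by field; rewrite !gt_eqF.
rewrite ler_wpM2r ?powR_ge0//.
rewrite (eq_bigr (fun i => `|x i ord0| `^ s)); last first.
  by move=> i _; rewrite -powRrM; congr powR; field; rewrite gt_eqF.
rewrite [r / s]mulrC powRrM; apply: ler_powR2r (ltW r0) (powR_ge0 _ _) xc.
Qed.

(** Both branches of the minimum defining r work. If r = p the exponent is 0. Otherwise r >= ln
    (2m/x) and the exponent lies in [0,1]: a ratio above 1 contributes at most m/x <= e^r, a ratio
    below 1 at most 1. *)
Lemma powR_ratio_le p x : (2%:E <= p)%E -> 0 < x ->
  (m%:R / x) `^ (1 - moment_order p x * fine p^-1%E) <= expR (moment_order p x).
Proof.
move=> p2 x0; have mR0 : 0 < (m%:R : R) by rewrite ltr0n.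
have r2 := moment_order_ge2 x p2; have rp := moment_order_le x p2.
set r := moment_order p x in r2 rp *.
have r0 : 0 < r by lra.
have mx0 : 0 < m%:R / x by exact: divr_gt0.
rewrite -[leLHS]lnK ?posrE ?powR_gt0// ler_expR ln_powR.
have P0 := fine_inve_itv p2.
have rP1 : r * fine p^-1%E <= 1.
  clear -rp r0; clearbody r; case: p rp => [s| |//] rs; last by rewrite invey mulr0.
  by rewrite lee_fin in rs; rewrite fine_invr ler_pdivrMr ?mul1r//; lra.
have : r = fine p /\ p = r%:E \/ ln (2 * m%:R / x) <= r.
  have := moment_orderE x p2; rewrite -/r.
  case: (leP p) => [_ <-|_ [->]]; first by left.
  by right; rewrite le_max lexx orbT.
move=> [[_ pE]|lr].
  have -> : fine p^-1%E = r^-1 by rewrite [in LHS]pE fine_invr.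
  by rewrite divff ?gt_eqF// subrr mul0r ltW.
have : ln (m%:R / x) <= r.
  apply: le_trans lr; rewrite ler_ln ?posrE//; last by rewrite -mulrA mulr_gt0.
  by rewrite -mulrA ler_pMl//; lra.
have [l0 lr'|l0 _] := leP 0 (ln (m%:R / x)).
  have : r * fine p^-1%E * ln (m%:R / x) >= 0 by rewrite !mulr_ge0//; lra.
  lra.
have : (1 - r * fine p^-1%E) * ln (m%:R / x) <= 0 by rewrite mulr_ge0_le0 //; lra.
lra.
Qed.

(** Inside a row, [powR_sum_le] replaces the r-th power of the Euclidean norm by h^(r/2-1) times the
    sum of the r-th powers; summed by columns, each column costs 2^r m^(1-r/p). Writing m = h (m/h)
    and absorbing the ratio in e^r leaves a bound where m survives only through r. *)
Lemma sum_row_moments p h (d : 'I_h -> 'cV[R]_m) : (2%:E <= p)%E -> (0 < h)%N ->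
    (forall j, lpnorm p (d j) <= 2) ->
  \sum_i (\sum_j d j i ord0 ^+ 2) `^ (moment_order p h%:R / 2)
  <= (2 * expR 1 * h%:R `^ (2^-1 - fine p^-1%E)) `^ moment_order p h%:R * h%:R.
Proof.
move=> p2 h0 d2; have := moment_order_ge2 h%:R p2.
have := moment_order_le h%:R p2; have := powR_ratio_le p2.
set r := moment_order p h%:R => ratio_le rp r2.
have r0 : 0 < r by lra.
have mR0 : 0 < (m%:R : R) by rewrite ltr0n.
have hR0 : 0 < (h%:R : R) by rewrite ltr0n.
have sqE j i : (d j i ord0 ^+ 2) `^ (r / 2) = `|d j i ord0| `^ r.
  rewrite -real_normK ?num_real// -powR_mulrn// -powRrM.
  by congr powR; field.
apply: (@le_trans _ _ (\sum_i h%:R `^ (r / 2 - 1) * \sum_j `|d j i ord0| `^ r)).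
  apply: ler_sum => i _; rewrite -(eq_bigr _ (fun j _ => sqE j i)).
  rewrite -[in h%:R](card_ord h); apply: powR_sum_le; first lra.
  by move=> j; exact: sqr_ge0.
rewrite -mulr_sumr exchange_big/=.
apply: (@le_trans _ _ (h%:R `^ (r / 2 - 1) *
    \sum_(j < h) (2 `^ r * m%:R `^ (1 - r * fine p^-1%E)))).
  rewrite ler_wpM2l ?powR_ge0// ler_sum// => j _.
  exact: sum_powR_le.
rewrite sumr_const card_ord -[(_ * _) *+ h]mulr_natr.
have -> : m%:R `^ (1 - r * fine p^-1%E)
    = h%:R `^ (1 - r * fine p^-1%E) * (m%:R / h%:R) `^ (1 - r * fine p^-1%E).
  by rewrite -powRM ?divr_ge0 ?ler0n// [h%:R * _]mulrC divfK// gt_eqF.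
have := ratio_le _ hR0; rewrite -/r.
set a := (m%:R / _) `^ _; move=> ae.
rewrite powRM ?mulr_ge0 ?powR_ge0 ?expR_ge0// powRM ?expR_ge0//.
rewrite -expRM mul1r -[(h%:R `^ _) `^ r]powRrM.
have -> : (2^-1 - fine p^-1%E) * r = (r / 2 - 1) + (1 - r * fine p^-1%E) by lra.
rewrite [in leRHS]powRD ?(gt_eqF hR0) ?implybT//.
set b := h%:R `^ (r / 2 - 1); set c := h%:R `^ (1 - _).
have : 0 <= b * c * 2 `^ r * h%:R by rewrite !mulr_ge0 ?powR_ge0.
by move=> /ler_wpM2l /(_ _ _ ae); lra.
Qed.

(** Since |Y_i|/W <= 1, the q-th powers are below the r-th powers, so the l_q norm is at most W (h
    t)^(1/q), with t the normalised r-th moment. Replacing t^(1/q) by 1 + t makes the bound affine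
    in the moments, so that it can be integrated term by term. *)
Lemma lpnorm_interp q r h W (Y : 'cV[R]_m) : 1 <= r -> (r%:E <= q)%E -> (0 < h)%N ->
    0 < W -> (forall i, `|Y i ord0| <= W) ->
  lpnorm q Y <= W * h%:R `^ (fine q^-1%E) *
    (1 + h%:R^-1 * \sum_i (`|Y i ord0| / W) `^ r).
Proof.
move=> r1 rq h0 W0 YW; have r0 : 0 < r by lra.
have hR0 : 0 < (h%:R : R) by rewrite ltr0n.
set t := h%:R^-1 * _; have t0 : 0 <= t.
  by rewrite mulr_ge0 ?invr_ge0 ?(ltW hR0) ?sumr_ge0// => i _; exact: powR_ge0.
case: q rq => [s| |//] rq; last first.
  rewrite invey powRr0 mulr1; apply: (@le_trans _ _ W).
    by apply/bigmax_leP; split; first exact: ltW.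
  by rewrite ler_peMr ?(ltW W0)//; lra.
rewrite lee_fin in rq; have s0 : 0 < s by lra.
rewrite fine_invr /=.
apply: (@le_trans _ _ ((W `^ s * (h%:R * t)) `^ s^-1)).
  apply: ler_powR2r; rewrite ?invr_ge0 ?(ltW s0)//.
    by apply: sumr_ge0 => i _; exact: powR_ge0.
  rewrite mulVKf ?gt_eqF// mulr_sumr; apply: ler_sum => i _.
  have -> : `|Y i ord0| `^ s = W `^ s * (`|Y i ord0| / W) `^ s.
    by rewrite -powRM ?divr_ge0 ?(ltW W0)// mulrC divfK// gt_eqF.
  rewrite ler_wpM2l ?powR_ge0//.
  have [->|yW0] := eqVneq (`|Y i ord0| / W) 0; first by rewrite !powR0 ?gt_eqF.
  rewrite ger_powR// lt0r yW0/= divr_ge0 ?(ltW W0)//=.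
  by rewrite ler_pdivrMr// mul1r.
rewrite (powRM _ (powR_ge0 W s) (mulr_ge0 (ltW hR0) t0)) powRK ?gt_eqF ?(ltW W0)//.
rewrite (powRM _ (ltW hR0) t0) -mulrA ler_pM2l// ler_wpM2l ?powR_ge0//.
have [t1|t1] := leP 1 t.
  apply: (@le_trans _ _ t); last lra.
  by rewrite ler1_powR// invf_le1//; lra.
apply: (@le_trans _ _ (1 `^ s^-1)); last by rewrite powR1; lra.
by apply: ler_powR2r; rewrite ?invr_ge0 ?(ltW s0)// ltW.
Qed.

End MomentOrder.

(** * The rate of the theorem and the potential *)

Section Rate.
Variables (R : realType) (m k : nat) (p q : \bar R).
Hypotheses (m_gt0 : (0 < m)%N) (k_gt0 : (0 < k)%N).
Hypotheses (p_ge2 : (2%:E <= p)%E) (le_pq : (p <= q)%E).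

Let kR_gt0 : 0 < (k%:R : R). Proof. by rewrite ltr0n. Qed.
Let mR_gt0 : 0 < (m%:R : R). Proof. by rewrite ltr0n. Qed.

Definition rate_exponent : R := 2^-1 - fine p^-1%E + fine q^-1%E.
Local Notation al := rate_exponent.

(** The order in the statement, with lower cut-off ln 2; [moment_order] has the cut-off 2 because
    the moment estimates use r >= 2. *)
Definition rate_order : R :=
  fine (Order.min p (Num.max (ln 2) (ln (2 * m%:R / k%:R)))%:E).

Definition rate_scale : R := Num.sqrt rate_order * k%:R `^ al.

Lemma rate_exponent_itv : 0 <= al <= 2^-1.
Proof.
rewrite /al; have := fine_inve_itv p_ge2; have := fine_inve_itv (le_trans p_ge2 le_pq).
have := le_fine_inve p_ge2 le_pq; lra.
Qed.

Lemma ln2_ge : 2^-1 <= ln 2 :> R.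
Proof.
have := @le_ln1Dx R (- 2^-1); rewrite ltrN2 invf_lt1 ?ltr1n// => /(_ isT).
have -> : 1 + - 2^-1 = 2^-1 :> R by field.
by rewrite lnV ?posrE// lerN2.
Qed.

Lemma rate_orderE :
  (rate_order%:E = Order.min p (Num.max (ln 2) (ln (2 * m%:R / k%:R)))%:E)%E.
Proof.
rewrite /rate_order fineK//.
by case: p p_ge2 => [s| |//] s2; rewrite ?minye// -EFin_min.
Qed.

Lemma rate_order_ge : 2^-1 <= rate_order.
Proof.
rewrite -lee_fin rate_orderE le_min; apply/andP; split.
  by apply: le_trans p_ge2; rewrite lee_fin; lra.
by rewrite lee_fin le_max ln2_ge.
Qed.

Lemma sqrt_rate_order_ge : 3^-1 <= Num.sqrt rate_order.
Proof.
rewrite -[leLHS]sqr_sqrtr ?invr_ge0// expr2.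
have -> : Num.sqrt (3^-1 : R) * Num.sqrt 3^-1 = Num.sqrt (3^-1 ^+ 2).
  by rewrite -sqrtrM ?invr_ge0// expr2.
by apply: ler_wsqrtr; apply: le_trans rate_order_ge; lra.
Qed.

Lemma rate_scale_ge : 3^-1 <= rate_scale.
Proof.
have a0 := rate_exponent_itv.
rewrite /rate_scale -[leLHS]mulr1 ler_pM ?invr_ge0 ?sqrt_rate_order_ge//.
rewrite -[leLHS](powRr0 k%:R) ler_powR ?ler1n//; lra.
Qed.

Lemma moment_order_le_rate (h c : R) : 1 <= c ->
  Num.max 2 (ln (2 * m%:R / h)) <= c * Num.max (ln 2) (ln (2 * m%:R / k%:R)) ->
  moment_order m p h <= c * rate_order.
Proof.
move=> c1 hc; have ro0 : 0 <= rate_order by have := rate_order_ge; lra.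
have moE := moment_orderE m h p_ge2; have roE := rate_orderE.
have [pa|ap] := leP p (Num.max (ln 2) (ln (2 * m%:R / k%:R)))%:E.
  rewrite min_l// in roE; apply: (@le_trans _ _ rate_order).
    by rewrite -lee_fin roE moE ge_min lexx.
  by rewrite ler_peMl.
rewrite min_r ?(ltW ap)// in roE; case: roE => ->.
apply: le_trans hc; by rewrite -lee_fin moE ge_min lexx orbT.
Qed.

Lemma powR_le_mean (x a : R) : 0 <= a <= 2^-1 -> 0 < x ->
  x `^ a <= x `^ (a / 2) + x `^ 2^-1.
Proof.
move=> a12 x0; have [x1|x1] := leP 1 x.
  by rewrite -[leLHS]add0r lerD ?powR_ge0// ler_powR//; lra.
by rewrite -[leLHS]addr0 lerD ?powR_ge0// ger_powR ?x0 ?(ltW x1)//; lra.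
Qed.

(** Compares the order at h with the order at k. For p <= 4 the former is at most 4, and the root of
    the latter is at least 1/3. For p > 4 the logarithm exceeds the one at k by at most ln (k/h),
    and x^al with x = h/k compensates this at the price of half of its exponent. *)
Lemma sqrt_moment_order_le h : (0 < h)%N ->
  Num.sqrt (moment_order m p h%:R) * h%:R `^ al <=
  6 * rate_scale * ((h%:R / k%:R) `^ (al / 2) + (h%:R / k%:R) `^ 2^-1).
Proof.
move=> h0; have hR0 : 0 < (h%:R : R) by rewrite ltr0n.
set x := h%:R / k%:R; have x0 : 0 < x by exact: divr_gt0.
have hE : h%:R `^ al = k%:R `^ al * x `^ al.
  by rewrite -powRM ?(ltW kR_gt0) ?(ltW x0)// mulrC divfK// gt_eqF.
have a12 := rate_exponent_itv; have xa := powR_le_mean a12 x0.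
have sr3 := sqrt_rate_order_ge; have ro2 := rate_order_ge.
set y := _ + _ in xa *.
rewrite hE /rate_scale -mulrA.
suff H : Num.sqrt (moment_order m p h%:R) * x `^ al <= 6 * Num.sqrt rate_order * y.
  rewrite mulrCA [leRHS](_ : _ = k%:R `^ al * (6 * Num.sqrt rate_order * y)).
    by rewrite ler_pM2l// powR_gt0.
  by ring.
have [p4|p4] := leP p 4%:E.
  apply: ler_pM; rewrite ?sqrtr_ge0 ?powR_ge0//.
  apply: (@le_trans _ _ (Num.sqrt (2 ^+ 2))); last first.
    by rewrite sqrtr_sqr ger0_norm//; lra.
  apply: ler_wsqrtr; rewrite -lee_fin (le_trans (moment_order_le _ _ p_ge2))//.
  by apply: le_trans p4 _; rewrite lee_fin; lra.
have a4 : 4^-1 <= al.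
  rewrite /al; have := fine_inve_itv (le_trans p_ge2 le_pq).
  have : fine p^-1%E <= 4^-1; last by lra.
  case: p p4 => [s| |//]; last by rewrite invey /= => _; lra.
  by rewrite lte_fin fine_invr => s4; rewrite lef_pV2 ?posrE; lra.
pose a : R := Num.max (ln 2) (ln (2 * m%:R / k%:R)).
have aln2 : 2^-1 <= a by rewrite le_max ln2_ge.
have lna : ln (2 * m%:R / k%:R) <= a by rewrite le_max lexx orbT.
(* Up to the constant 4, [B] is the factor by which the order at h can exceed the one at k: 1 for h
   >= k, and 1 + ln (k/h) below. *)
pose B := 1 + Num.max 0 (ln x^-1).
have B1 : 1 <= B by rewrite lerDl le_max lexx.
have moB : moment_order m p h%:R <= 4 * B * rate_order.
  apply: moment_order_le_rate; first lra.
  rewrite -/a ge_max; apply/andP; split.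
    by have := ler_pM (ler0n _ 1) _ B1 aln2; rewrite invr_ge0 ler0n => /(_ isT); lra.
  have -> : 2 * m%:R / h%:R = (2 * m%:R / k%:R) * x^-1.
    by rewrite /x; field; rewrite !gt_eqF.
  rewrite lnM ?posrE ?invr_gt0 ?divr_gt0 ?mulr_gt0//.
  have : ln x^-1 <= B - 1 by rewrite /B addrAC subrr add0r le_max lexx orbT.
  have : 0 <= (B - 1) * (a - 2^-1) by rewrite mulr_ge0; lra.
  nra.
apply: (@le_trans _ _ (2 * Num.sqrt B * Num.sqrt rate_order * x `^ al)).
  rewrite ler_wpM2r ?powR_ge0// (le_trans (ler_wsqrtr moB))//.
  rewrite !sqrtrM ?mulr_ge0//; try lra.
  have -> : 4 = 2 ^+ 2 :> R by ring.
  by rewrite sqrtr_sqr ger0_norm.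
rewrite [leLHS](_ : _ = 2 * Num.sqrt rate_order * (Num.sqrt B * x `^ al)); last ring.
rewrite [leRHS](_ : _ = 2 * Num.sqrt rate_order * (3 * y)); last ring.
apply: ler_wpM2l; first by rewrite mulr_ge0 ?sqrtr_ge0.
have [x1|x1] := leP 1 x.
  have -> : B = 1.
    rewrite /B max_l ?addr0// ln_le0// invf_le1//.
  by rewrite sqrtr1 mul1r; have := powR_ge0 x al; lra.
have xi1 : 1 <= x^-1 by rewrite invf_ge1 // ltW.
(* Here al >= 1/4 enters: ln (1/x) <= x^(-al) / al <= 4 x^(-al). *)
have BE : B <= (3 * x^-1 `^ (al / 2)) ^+ 2.
  rewrite exprMn -[(x^-1 `^ _) ^+ 2]powR_mulrn ?powR_ge0// -powRrM divfK// /B max_r ?ln_ge0//.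
  have l1 : al * ln x^-1 <= x^-1 `^ al.
    by rewrite -ln_powR ltW// ln_sublinear// powR_gt0 ?invr_gt0.
  have : 1 <= x^-1 `^ al by rewrite -(powRr0 x^-1) ler_powR//; lra.
  have : 0 <= (al - 4^-1) * ln x^-1 by rewrite mulr_ge0 ?ln_ge0//; lra.
  lra.
have sB : Num.sqrt B <= 3 * x^-1 `^ (al / 2).
  rewrite (le_trans (ler_wsqrtr BE))// sqrtr_sqr ger0_norm//.
  by rewrite mulr_ge0 ?powR_ge0.
apply: (@le_trans _ _ (3 * x^-1 `^ (al / 2) * x `^ al)).
  by rewrite ler_wpM2r ?powR_ge0.
have -> : x `^ al = x `^ (al / 2) * x `^ (al / 2).
  by rewrite -powRD ?(gt_eqF x0) ?implybT//; congr powR; field.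
rewrite -mulrA [x^-1 `^ _ * _]mulrA -powRM ?invr_ge0 ?(ltW x0)//.
rewrite mulVf ?gt_eqF// powR1 mul1r ler_pM2l//.
by rewrite /y lerDl powR_ge0.
Qed.

(** 64/al is the inverse of the share al/64 that both powers lose when x shrinks by 7/8: this is
    [powR_shrink] with b = al/2 for the slow power, and b = 1/2 loses at least as much. It is
    applied to 6 times the constant of a round, the 6 being that of [sqrt_moment_order_le]. *)
Definition colouring_potential (c x : R) : R :=
  64 * c / al * rate_scale * ((x / k%:R) `^ (al / 2) + (x / k%:R) `^ 2^-1).

Lemma colouring_potential_mono c x y : 0 < al -> 0 <= c -> 0 <= x -> x <= y ->
  colouring_potential c x <= colouring_potential c y.
Proof.
move=> a0 c0 x0 xy; apply: ler_wpM2l.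
  by rewrite !mulr_ge0 ?invr_ge0 ?(ltW a0) ?sqrtr_ge0 ?powR_ge0.
have xy' : x / k%:R <= y / k%:R by rewrite ler_pM2r ?invr_gt0.
have x0' : 0 <= x / k%:R by rewrite divr_ge0 ?(ltW kR_gt0).
by rewrite lerD// ler_powR2r//; lra.
Qed.

Lemma colouring_potential_ge0 c x : 0 <= al -> 0 <= c -> 0 <= colouring_potential c x.
Proof.
by move=> a0 c0; rewrite !mulr_ge0 ?addr_ge0 ?invr_ge0 ?a0 ?sqrtr_ge0 ?powR_ge0.
Qed.

(** As ln (8/7) >= 1/8, the power (7/8)^b is at most 1/(1 + b/8), hence at most 1 - b/32. The ratio
    7/8 is what a partial colouring of more than h/8 of the pairs leaves. *)
Lemma powR_shrink (b x : R) : 0 <= b <= 1 -> 0 <= x ->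
  b / 32 * x `^ b + (7 / 8 * x) `^ b <= x `^ b.
Proof.
move=> /andP[b0 b1] x0; rewrite powRM ?divr_ge0//.
rewrite -mulrDl ler_piMl ?powR_ge0//.
have -> : (7 / 8 : R) `^ b = expR (- (b * ln (8 / 7))).
  rewrite -[LHS]lnK ?posrE ?powR_gt0 ?divr_gt0// ln_powR -mulrN -lnV ?posrE ?divr_gt0//.
  by rewrite invf_div.
have l8 : 8^-1 <= ln (8 / 7 : R).
  have := @le_ln1Dx R (- 8^-1); rewrite ltrN2 invf_lt1 ?ltr1n// => /(_ isT).
  have -> : 1 + - 8^-1 = (8 / 7)^-1 :> R by field.
  by rewrite lnV ?posrE ?divr_gt0// lerN2.
rewrite expRN.
have e1 : 1 + b / 8 <= expR (b * ln (8 / 7)).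
  by apply: le_trans (expR_ge1Dx _); rewrite lerD2l ler_wpM2l.
have : (expR (b * ln (8 / 7)))^-1 <= (1 + b / 8)^-1.
  by rewrite lef_pV2 ?posrE ?expR_gt0//; lra.
suff : (1 + b / 8)^-1 <= 1 - b / 32 by lra.
have b8 : 0 < 1 + b / 8 by lra.
rewrite -[leLHS]mul1r ler_pdivrMr//; nra.
Qed.

(* One round of partial colouring pays for itself out of the potential. *)
Lemma colouring_potential_step c h x : 0 < al -> 0 <= c -> (0 < h)%N ->
    0 <= x -> x <= 7 / 8 * h%:R ->
  c * (Num.sqrt (moment_order m p h%:R) * h%:R `^ al) + colouring_potential (6 * c) x
  <= colouring_potential (6 * c) h%:R.
Proof.
move=> a0 c0 h0 x0 xh.
apply: (@le_trans _ _ (c * (6 * rate_scale *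
    ((h%:R / k%:R) `^ (al / 2) + (h%:R / k%:R) `^ 2^-1)) +
    colouring_potential (6 * c) (7 / 8 * h%:R))).
  apply: lerD; first by rewrite ler_wpM2l// sqrt_moment_order_le.
  by apply: colouring_potential_mono => //; lra.
rewrite /colouring_potential -[7 / 8 * h%:R / k%:R]mulrA; set y := h%:R / k%:R.
have y0 : 0 <= y by rewrite divr_ge0 ?ler0n.
have a12 := rate_exponent_itv.
have h1 := @powR_shrink (al / 2) y _ y0; have h2 := @powR_shrink 2^-1 y _ y0.
set A := y `^ (al / 2) in h1 *; set A' := _ `^ (al / 2) in h1 *.
set B := y `^ 2^-1 in h2 *; set B' := _ `^ 2^-1 in h2 *.
have {h1} h1 : al / 2 / 32 * A + A' <= A by apply: h1; lra.
have {h2} h2 : 2^-1 / 32 * B + B' <= B by apply: h2; lra.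
have B0 : 0 <= B := powR_ge0 _ _.
have h3 : al / 64 * (A + B) + (A' + B') <= A + B by nra.
have s0 : 0 <= 64 * (6 * c) / al * rate_scale.
  by rewrite !mulr_ge0 ?invr_ge0 ?(ltW a0) ?sqrtr_ge0 ?powR_ge0.
have := ler_wpM2l s0 h3; rewrite mulrDr.
rewrite (_ : 64 * (6 * c) / al * rate_scale * (al / 64 * (A + B)) =
  c * (6 * rate_scale * (A + B)))//.
by field; rewrite gt_eqF.
Qed.

(** Both powers of 2^l are at most (3/2)^l, as sqrt 2 <= 3/2; dividing by 2^l leaves the ratio 3/4,
    so the errors of the levels form a geometric series. *)
Lemma colouring_potential_level c l : 0 < al -> 0 <= c ->
  colouring_potential c (2 ^ l * k)%N%:R / (2 ^ l * k)%N%:R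
  <= 128 * c / al * (rate_scale / k%:R) * (3 / 4) ^+ l.
Proof.
move=> a0 c0; have a12 := rate_exponent_itv; rewrite /colouring_potential.
rewrite natrM mulfK ?gt_eqF//.
have t0 : 0 < (2 ^ l)%N%:R :> R by rewrite ltr0n expn_gt0.
have t1 : 1 <= (2 ^ l)%N%:R :> R by rewrite ler1n expn_gt0.
have s0 : 0 <= 64 * c / al * rate_scale.
  by rewrite !mulr_ge0 ?invr_ge0 ?(ltW a0) ?sqrtr_ge0 ?powR_ge0.
have hy : (2 ^ l)%N%:R `^ 2^-1 <= (3 / 2) ^+ l * 1 :> R.
  rewrite powR12_sqrt ?(ltW t0)// mulr1 -[leRHS]ger0_norm; last first.
    by rewrite exprn_ge0//; lra.
  rewrite -sqrtr_sqr ler_wsqrtr// -exprM mulnC exprM natrX lerXn2r ?nnegrE//; lra.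
have hx : (2 ^ l)%N%:R `^ (al / 2) <= (3 / 2) ^+ l * 1 :> R.
  apply: le_trans hy; apply: ler_powR => //; lra.
have : (2 ^ l)%N%:R `^ (al / 2) + (2 ^ l)%N%:R `^ 2^-1 <= 2 * (3 / 2) ^+ l :> R by lra.
move=> /(ler_wpM2l s0) H.
rewrite ler_pdivrMr ?mulr_gt0//; apply: le_trans H _.
rewrite le_eqVlt; apply/orP; left; apply/eqP.
have -> : (3 / 2 : R) ^+ l = (3 / 4) ^+ l * (2 ^ l)%N%:R.
  by rewrite natrX -exprMn; congr (_ ^+ l); field.
by field; rewrite !gt_eqF.
Qed.

Lemma ac_boundE : 0 < al -> ac_bound m k p q = (rate_scale / k%:R / al)%:E.
Proof.
move=> a0; have p1 := fine_inve_itv p_ge2; have q2 := le_trans p_ge2 le_pq.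
rewrite /ac_bound -/rate_order.
have pf : p^-1%E = (fine p^-1%E)%:E.
  case: p p_ge2 => [s| |//] s2; last by rewrite invey.
  by rewrite inver ifF//; apply/negbTE; rewrite gt_eqF//; rewrite lee_fin in s2; lra.
have qf : q^-1%E = (fine q^-1%E)%:E.
  case: q q2 => [s| |//] s2; last by rewrite invey.
  by rewrite inver ifF//; apply/negbTE; rewrite gt_eqF//; rewrite lee_fin in s2; lra.
rewrite {1}pf {1}qf -EFinN -!EFinD -/al inver gt_eqF// -EFinM; congr (_%:E).
rewrite /rate_scale.
have -> : 2^-1 + fine p^-1%E - fine q^-1%E = 1 - al by rewrite /al; lra.
rewrite powRB ?(gt_eqF kR_gt0) ?implybT// powRr1 ?(ltW kR_gt0)//.
by field; rewrite !gt_eqF// powR_gt0.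
Qed.

Lemma ac_bound_pinfty : al = 0 -> ac_bound m k p q = +oo%E.
Proof.
move=> a0; have q2 := le_trans p_ge2 le_pq.
rewrite /ac_bound -/rate_order.
have pf : p^-1%E = (fine p^-1%E)%:E.
  case: p p_ge2 => [s| |//] s2; last by rewrite invey.
  by rewrite inver ifF//; apply/negbTE; rewrite gt_eqF//; rewrite lee_fin in s2; lra.
have qf : q^-1%E = (fine q^-1%E)%:E.
  case: q q2 => [s| |//] s2; last by rewrite invey.
  by rewrite inver ifF//; apply/negbTE; rewrite gt_eqF//; rewrite lee_fin in s2; lra.
rewrite {1}pf {1}qf -EFinN -!EFinD -/al inver a0 eqxx gt0_mulye// lte_fin.
by rewrite divr_gt0 ?powR_gt0// (lt_le_trans _ sqrt_rate_order_ge)// invr_gt0.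
Qed.

End Rate.

(** * Pairs of distant sign vectors in a common cell *)

Section CubeAverages.
Variables (R : realType) (h : nat).
Local Notation cube := {ffun 'I_h -> bool}.
Implicit Types (x y : cube).

Definition hamming x y := #|[pred j | x j != y j]|.

(** Chernoff's bound: a point y of the ball has t^(8 dist) >= t^h, and the generating function of 8
    dist factors over the coordinates into 1 + t^8. The value t = 4/5 makes (1 + t^8)/t <= 3/2. *)
Lemma card_hamming_ball x :
  #|[pred y | (8 * hamming x y <= h)%N]|%:R <= (3 / 2 : R) ^+ h.
Proof.
pose t : R := 4 / 5.
have t0 : 0 < t by rewrite divr_gt0.
apply: (@le_trans _ _ (\sum_y t ^+ (8 * hamming x y) / t ^+ h)).
  rewrite -sum1_card natr_sum big_mkcond/=; apply: ler_sum => y _.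
  case: ifP => [yx|_]; last by rewrite divr_ge0 ?exprn_ge0 ?(ltW t0).
  rewrite ler_pdivlMr ?exprn_gt0// mul1r ler_wiXn2l ?(ltW t0)//.
  by rewrite /t; lra.
rewrite -mulr_suml ler_pdivrMr ?exprn_gt0//.
pose f j (b : bool) : R := if x j != b then t ^+ 8 else 1.
rewrite (eq_bigr (fun y => \prod_j f j (y j))); last first.
  move=> y _; rewrite exprM /hamming -sum1_card -prodrXr big_mkcond/=.
  by apply: eq_bigr => j _; rewrite /f inE expr1.
rewrite -(bigA_distr_bigA f) (eq_bigr (fun=> 1 + t ^+ 8)).
  rewrite prodr_const card_ord -exprMn lerXn2r ?nnegrE ?mulr_ge0 ?addr_ge0 ?exprn_ge0 ?(ltW t0)//.
  by rewrite /t !exprS expr0; lra.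
by move=> j _; rewrite big_bool /f; case: (x j); rewrite //= addrC.
Qed.

Lemma markov_cube (f : cube -> R) a : (forall x, 0 <= f x) -> 0 < a ->
  \sum_x f x <= 2 ^+ h * a ->
  16 * #|[pred x | 16 * a < f x]|%:R <= 2 ^+ h :> R.
Proof.
move=> f0 a0 fa; rewrite -(ler_pM2r a0); apply: le_trans fa.
rewrite -sum1_card natr_sum mulr_sumr mulr_suml big_mkcond/=; apply: ler_sum => x _.
by case: ifP => // /ltW; rewrite mulr1.
Qed.

(* A sub-probability on the cells with code lengths [cell_cost]; it replaces the
   entropy of the rounded values. *)
Definition cell_weight (e : R) n : R := if n is 0 then 1 - e else e * 2^-1 ^+ n.

Lemma cell_weight_ge0 e n : 0 <= e <= 1 -> 0 <= cell_weight e n.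
Proof.
move=> /andP[e0 e1]; case: n => [|n] /=; first by rewrite subr_ge0.
by rewrite mulr_ge0 ?exprn_ge0.
Qed.

Lemma sum_cell_weight e N : 0 <= e -> \sum_(n < N.+1) cell_weight e n <= 1.
Proof.
move=> e0; have -> : \sum_(n < N.+1) cell_weight e n = 1 - e * 2^-1 ^+ N.
  elim: N => [|N IH]; first by rewrite big_ord1/= expr0 mulr1.
  by rewrite big_ord_recr/= IH exprS; lra.
by rewrite lerBlDr lerDl mulr_ge0 ?exprn_ge0.
Qed.

(** An upper bound for the negative logarithm of [cell_weight]: exact for n > 0 and e > 0, while n =
    0 uses -ln (1 - e) <= 2e on [0, 1/2]. *)
Definition cell_cost (e : R) n : R := if n is 0 then 2 * e else ln e^-1 + n%:R * ln 2.

Lemma ln2_le1 : ln 2 <= 1 :> R.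
Proof. by have := @le_ln1Dx R 1; apply; lra. Qed.

Lemma cell_weight_ge e n : 0 <= e <= 2^-1 -> (0 < e) || (n == 0%N) ->
  expR (- cell_cost e n) <= cell_weight e n.
Proof.
move=> /andP[e0 e1]; case: n => [_|n] /=.
  rewrite expRN -[leRHS]invrK lef_pV2 ?posrE ?expR_gt0 ?invr_gt0//; last by lra.
  apply: le_trans (expR_ge1Dx _).
  have e2 : 0 < 1 - e by lra.
  rewrite -[leLHS]mul1r ler_pdivrMr//; nra.
rewrite orbF => e_gt0.
rewrite opprD expRD expRN lnK ?posrE ?invr_gt0// invrK ler_pM2l//.
by rewrite -mulrN mulrC expRM expRN lnK ?posrE// powR_mulrn.
Qed.

(** A weighted pigeonhole. The product of the [w i] is a sub-probability on the cells, and every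
    good point lies in a cell of weight at least [a]. If all cells held at most [b] good points, the
    weights summed over the good points would be at most [b]. *)
Lemma exists_large_cell (I : finType) (s : I -> cube -> nat) (w : I -> nat -> R)
    (G : pred cube) (a b : R) :
    (forall i n, 0 <= w i n) -> (forall i N, \sum_(n < N.+1) w i n <= 1) ->
    0 <= b ->
    (forall x, G x -> a <= \prod_i w i (s i x)) -> b < #|G|%:R * a ->
  exists x, G x /\ b < #|[pred y | G y && [forall i, s i y == s i x]]|%:R.
Proof.
move=> w0 w1 b0 Ga bG; apply/not_existsP => noc.
(* Cutting off at the largest value makes the set of cells finite. *)
pose N := \max_x \max_i s i x.
have sN i x : (s i x < N.+1)%N.
  rewrite ltnS (leq_trans _ (leq_bigmax x))//; exact: leq_bigmax.
pose c x : {ffun I -> 'I_N.+1} := [ffun i => inord (s i x)].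
have cE x i : c x i = s i x :> nat by rewrite ffunE inordK.
pose W (u : {ffun I -> 'I_N.+1}) := \prod_i w i (u i).
have W1 : \sum_u W u <= 1.
  rewrite -(bigA_distr_bigA (fun i (n : 'I_N.+1) => w i n)).
  by apply: prodr_ile1 => i _; rewrite w1 andbT sumr_ge0.
have W0 u : 0 <= W u by apply: prodr_ge0.
have : #|G|%:R * a <= b.
  apply: (@le_trans _ _ (\sum_(x | G x) W (c x))).
    rewrite -sum1_card natr_sum mulr_suml; apply: ler_sum => x Gx.
    rewrite mul1r (le_trans (Ga x Gx))//.
    by rewrite le_eqVlt; apply/orP; left; apply/eqP/eq_bigr => i _; rewrite cE.
  rewrite (partition_big c predT)//=.
  apply: (@le_trans _ _ (\sum_u W u * b)); last by rewrite -mulr_suml ler_piMl.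
  apply: ler_sum => u _.
  rewrite (eq_bigr (fun=> W u)); last by move=> x /andP[_ /eqP ->].
  rewrite sumr_const -[_ *+ _]mulr_natr ler_wpM2l//.
  have [/eqP->//|/pred0Pn[x /andP[Gx /eqP cx]]] := boolP (#|[pred x | G x & c x == u]| == 0)%N.
  rewrite leNgt; apply/negP => bu; apply: (noc x); split=> //.
  apply: lt_le_trans bu _; rewrite ler_nat; apply: subset_leq_card.
  apply/fintype.subsetP => y /andP[Gy /eqP cy]; rewrite inE Gy/=.
  by apply/forallP => i; rewrite -!cE cy cx.
by rewrite leNgt bG.
Qed.

Lemma ln_inv_le e : 0 <= e -> ln e^-1 <= e^-1 :> R.
Proof.
rewrite le_eqVlt => /predU1P[<-|e0]; first by rewrite invr0 ln0.
by rewrite ltW// ln_sublinear// invr_gt0.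
Qed.

(** The two moment hypotheses have different roles: a nonzero value has frequency at most b^2, which
    tames the term ln (1/e) through b^2 ln (1/b) <= b, and the mean pays for n ln 2. For b > 1/2 the
    weight is frozen at e = 1/2 and every term is O(b). *)
Lemma sum_cell_cost (s : cube -> nat) b : 0 <= b ->
    \sum_x (s x != 0)%N%:R <= 2 ^+ h * b ^+ 2 ->
    \sum_x (s x)%:R <= 2 ^+ h * b ->
  \sum_x cell_cost (Num.min 2^-1 b) (s x) <= 2 ^+ h * (5 * b).
Proof.
move=> b0 sb2 sb; set e := Num.min _ _.
have e0 : 0 <= e by rewrite le_min b0 andbT invr_ge0.
have e12 : e <= 2^-1 by rewrite ge_min lexx.
have l0 : 0 <= ln e^-1.
  move: e0; rewrite le_eqVlt => /predU1P[<-|e0]; first by rewrite invr0 ln0.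
  by rewrite ln_ge0// invf_ge1//; lra.
apply: (@le_trans _ _ (\sum_x (2 * e + (s x != 0)%N%:R * ln e^-1 + (s x)%:R))).
  apply: ler_sum => x _; case: (s x) => [|n] /=; first by lra.
  rewrite mul1r; have := ler_wpM2l (ler0n R n.+1) ln2_le1; lra.
rewrite !big_split/= sumr_const card_ffun card_bool card_ord -mulr_suml.
rewrite -[(2 * e) *+ _]mulr_natr natrX.
have c0 : 0 <= 2 ^+ h :> R by rewrite exprn_ge0.
have [b12|b12] := leP b 2^-1.
  have eb : e = b by rewrite /e min_r.
  have := ler_wpM2r l0 sb2; rewrite eb.
  have : b ^+ 2 * ln b^-1 <= b.
    apply: le_trans (ler_wpM2l (exprn_ge0 _ b0) (ln_inv_le b0)) _.
    have [->|bN0] := eqVneq b 0; first by rewrite expr0n mul0r.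
    by rewrite expr2 mulfK.
  move=> /(ler_wpM2l c0); have := mulr_ge0 c0 b0; lra.
have eb : e = 2^-1 by rewrite /e min_l// ltW.
rewrite eb invrK.
have : \sum_x (s x != 0)%N%:R <= 2 ^+ h :> R.
  rewrite -natrX -[X in (X ^ _)%N]card_bool -[X in (_ ^ X)%N](card_ord h) -card_ffun.
  rewrite -sum1_card natr_sum; apply: ler_sum => x _; by rewrite ler_nat leq_b1.
have s0 : 0 <= \sum_x (s x != 0)%N%:R :> R by apply: sumr_ge0 => x _; exact: ler0n.
move=> s2; have := ler_wpM2l s0 ln2_le1.
have : 2 ^+ h * 2^-1 <= 2 ^+ h * b by rewrite ler_wpM2l// ltW.
lra.
Qed.

(** The average total cost is at most 5 h/1600 = h/320, so all but 1/16 of the points cost at most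
    h/20, and all but 1/16 satisfy the bound on [g]. Each remaining point lies in a cell of weight
    at least e^(-h/20), so some cell holds more than (3/2)^h of them, too many for a Hamming ball of
    radius h/8. *)
Lemma cube_pigeonhole (I : finType) (s : I -> cube -> nat) (b : I -> R)
    (g : cube -> R) c :
    (0 < h)%N -> (forall i, 0 <= b i) ->
    (forall i, \sum_x (s i x != 0)%N%:R <= 2 ^+ h * b i ^+ 2) ->
    (forall i, \sum_x (s i x)%:R <= 2 ^+ h * b i) ->
    \sum_i b i <= h%:R / 1600 ->
    (forall x, 0 <= g x) -> 0 < c -> \sum_x g x <= 2 ^+ h * c ->
  exists x y, [/\ forall i, s i x = s i y, g x <= 16 * c, g y <= 16 * c &
                  (h < 8 * hamming x y)%N].
Proof.
move=> h0 b0 sb2 sb bh g0 c0 gc; have hR0 : 0 < h%:R :> R by rewrite ltr0n.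
pose e i := Num.min 2^-1 (b i).
have e0 i : 0 <= e i by rewrite le_min b0 andbT invr_ge0.
have e12 i : e i <= 2^-1 by rewrite ge_min lexx.
have p0 : 0 < 2 ^+ h :> R by rewrite exprn_gt0.
pose f x := \sum_i cell_cost (e i) (s i x).
have f0 x : 0 <= f x.
  apply: sumr_ge0 => i _; case: (s i x) => [|n] /=; first by rewrite mulr_ge0.
  apply: addr_ge0; last by rewrite mulr_ge0 ?ln_ge0//; lra.
  have := e0 i; rewrite le_eqVlt => /predU1P[<-|ei]; first by rewrite invr0 ln0.
  by rewrite ln_ge0// invf_ge1//; have := e12 i; lra.
have fh : \sum_x f x <= 2 ^+ h * (h%:R / 320).
  rewrite exchange_big/=; apply: (@le_trans _ _ (\sum_i 2 ^+ h * (5 * b i))).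
    by apply: ler_sum => i _; exact: sum_cell_cost.
  by rewrite -!mulr_sumr ler_pM2l//; lra.
pose G := [pred x | (f x <= 16 * (h%:R / 320)) && (g x <= 16 * c)].
have cG : 7 / 8 * 2 ^+ h <= #|G|%:R :> R.
  have h320 : 0 < h%:R / 320 :> R by rewrite divr_gt0 ?ltr0n.
  have := markov_cube f0 h320 fh; have := markov_cube g0 c0 gc.
  have : 2 ^+ h <= #|G|%:R + #|[pred x | 16 * (h%:R / 320) < f x]|%:R
      + #|[pred x | 16 * c < g x]|%:R :> R.
    rewrite -natrX -[X in (X ^ _)%N]card_bool -[X in (_ ^ X)%N](card_ord h) -card_ffun.
    rewrite -!natrD ler_nat -[leqLHS](cardC G) -addnA leq_add2l.
    rewrite -cardUI (leq_trans _ (leq_addr _ _))// subset_leq_card//.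
    by apply/fintype.subsetP => x; rewrite !inE/= !leNgt -negb_or negbK.
  lra.
have [x [Gx cx]] : exists x, G x /\
    (3 / 2) ^+ h < #|[pred y | G y && [forall i, s i y == s i x]]|%:R :> R.
  apply: (@exists_large_cell I s (fun i => cell_weight (e i)) G (expR (- (h%:R / 20)))).
  - by move=> i n; apply: cell_weight_ge0; have := e0 i; have := e12 i; lra.
  - by move=> i N; exact: sum_cell_weight.
  - by rewrite exprn_ge0// divr_ge0.
  - move=> x /andP[fx _]; apply: (@le_trans _ _ (expR (- f x))).
      by rewrite ler_expR lerN2; lra.
    rewrite /f -sumrN expR_sum; apply: ler_prod => i _; rewrite expR_ge0/=.
    apply: cell_weight_ge; first by rewrite e0 e12.
    have := e0 i; rewrite le_eqVlt => /predU1P[ei|->//].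
    have bi : b i = 0.
      by move: ei; rewrite /e; case: (leP 2^-1 (b i)) => // _ h2; lra.
    have := sb2 i; rewrite bi expr0n mulr0 => s0.
    have {}s0 : \sum_x (s i x != 0)%N%:R = 0 :> R.
      by apply/eqP; rewrite eq_le s0 sumr_ge0.
    have := psumr_eq0P (fun y _ => ler0n R (s i y != 0)%N) s0 (erefl true).
    move=> /(_ x); case: (s i x) => [_|n /= n0]; first by rewrite eqxx orbT.
    by have := oner_neq0 R; rewrite -[X in _ != X]n0 eqxx.
  - have -> : expR (- (h%:R / 20)) = expR (- 20^-1) ^+ h :> R.
      by rewrite -expRM_natl; congr expR; lra.
    apply: (@lt_le_trans _ _ (7 / 8 * 2 ^+ h * (19 / 20) ^+ h)); last first.
      apply: ler_pM => //; rewrite ?mulr_ge0 ?exprn_ge0//.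
      rewrite lerXn2r ?nnegrE ?expR_ge0//.
      by apply: le_trans (expR_ge1Dx _); lra.
    rewrite -mulrA -exprMn.
    (* The count is (7/8) (19/15)^h (3/2)^h, and (7/8)(19/15) > 1. *)
    have -> : 2 * (19 / 20) = 19 / 15 * (3 / 2) :> R by lra.
    rewrite [in ltRHS]exprMn mulrA ltr_pMl ?exprn_gt0//.
    have : 1 <= (19 / 15) ^+ h.-1 :> R by rewrite exprn_ege1//; lra.
    by rewrite -[in X in _ -> X](prednK h0) [in X in _ -> X]exprS; lra.
have [y] : exists y, (y \in [pred y | G y && [forall i, s i y == s i x]]) &&
    (h < 8 * hamming x y)%N.
  apply/not_existsP => noy; move: cx; apply/negP; rewrite -leNgt.
  apply: le_trans (card_hamming_ball x); rewrite ler_nat.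
  apply: subset_leq_card; apply/fintype.subsetP => y yC; rewrite inE leqNgt.
  by apply/negP => hy; apply: (noy y); rewrite yC.
rewrite inE => /andP[/andP[Gy /forallP sy] hy].
move: Gx Gy => /andP[_ gx] /andP[_ gy].
by exists x, y; split=> // i; rewrite (eqP (sy i)).
Qed.

End CubeAverages.

(** * Partial colouring *)

Section PartialColouring.
Variable R : realType.
Implicit Types (a t s W : R).

Definition sign (b : bool) : R := if b then 1 else -1.

(** A crude subgaussian bound: for 0 <= a <= 1/2 the two exponentials are at most 1/(1-a) and
    1/(1+a); for larger a it follows from a <= 2 a^2. *)
Lemma cosh_le a : expR a + expR (- a) <= 2 * expR (2 * a ^+ 2).
Proof.
wlog a0 : a / 0 <= a => [H|].
  have [/H//|/ltW a0] := leP 0 a.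
  by have := H (- a); rewrite opprK sqrrN oppr_ge0 addrC; apply.
have [a12|a12] := leP a 2^-1; last first.
  have : expR (- a) <= expR a by rewrite ler_expR; lra.
  have : expR a <= expR (2 * a ^+ 2) by rewrite ler_expR; nra.
  lra.
have e1 : expR a <= (1 - a)^-1.
  rewrite -[expR a]invrK -expRN lef_pV2 ?posrE ?expR_gt0//; last lra.
  by have := expR_ge1Dx (- a); lra.
have e2 : expR (- a) <= (1 + a)^-1.
  by rewrite expRN lef_pV2 ?posrE ?expR_gt0 ?expR_ge1Dx//; lra.
have e3 : 1 + 2 * a ^+ 2 <= expR (2 * a ^+ 2) by exact: expR_ge1Dx.
have : (1 - a)^-1 + (1 + a)^-1 <= 2 * (1 + 2 * a ^+ 2); last lra.
have a1 : 0 < 1 - a by lra.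
have a2 : 0 < 1 + a by lra.
have -> : (1 - a)^-1 + (1 + a)^-1 = 2 / (1 - a ^+ 2).
  field; apply/and3P; split; rewrite gt_eqF//; nra.
have a4 : a ^+ 2 <= 4^-1 by nra.
have a20 : 0 <= a ^+ 2 by exact: sqr_ge0.
rewrite ler_pdivrMr; last by lra.
have : 0 <= a ^+ 2 * (4^-1 - a ^+ 2) by rewrite mulr_ge0//; lra.
lra.
Qed.

Section Moments.
Variables (h : nat) (c : 'I_h -> R).
Local Notation cube := {ffun 'I_h -> bool}.

Definition signed_sum (x : cube) := \sum_j sign (x j) * c j.

Lemma sum_expR_signed t :
  \sum_x expR (t * signed_sum x) <= 2 ^+ h * expR (2 * t ^+ 2 * \sum_j c j ^+ 2).
Proof.
rewrite (eq_bigr (fun x : cube => \prod_j expR (t * (sign (x j) * c j)))); last first.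
  by move=> x _; rewrite /signed_sum mulr_sumr expR_sum.
rewrite -(bigA_distr_bigA (fun j b => expR (t * (sign b * c j)))).
rewrite mulr_sumr expR_sum.
have -> : 2 ^+ h = \prod_(j < h) 2 :> R by rewrite prodr_const card_ord.
rewrite -big_split/=; apply: ler_prod => j _.
rewrite big_bool /sign /= addr_ge0 ?expR_ge0//=.
have := cosh_le (t * c j); rewrite mul1r mulN1r mulrN exprMn mulrA.
by [].
Qed.

(** Khintchine's inequality from the exponential moment at t = sqrt s / b, with b the Euclidean norm
    of [c]: by [powR_le_expR], |y|^s <= (sqrt s b)^s e^(t|y|), and the exponential moment e^(2s)
    yields the constant e^2. *)
Lemma sum_powR_signed s : 0 < s ->
  \sum_x `|signed_sum x| `^ s
  <= 2 ^+ h * (2 * (expR 2 * Num.sqrt s) `^ s * (\sum_j c j ^+ 2) `^ (s / 2)).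
Proof.
move=> s0; set b2 := \sum_j c j ^+ 2.
have b20 : 0 <= b2 by rewrite sumr_ge0// => j _; exact: sqr_ge0.
have [b2E|b2N0] := eqVneq b2 0.
  rewrite big1 ?mulr_ge0 ?exprn_ge0 ?powR_ge0// => x _.
  rewrite /signed_sum big1 ?normr0 ?powR0 ?gt_eqF// => j _.
  have /(_ j isT)/eqP := psumr_eq0P (fun j _ => sqr_ge0 (c j)) b2E.
  by rewrite sqrf_eq0 => /eqP ->; rewrite mulr0.
have b2_gt0 : 0 < b2 by rewrite lt0r b2N0.
pose b := Num.sqrt b2; have b0 : 0 < b by rewrite sqrtr_gt0.
have sq0 : 0 < Num.sqrt s by rewrite sqrtr_gt0.
have b2E : b ^+ 2 = b2 by rewrite sqr_sqrtr.
have sqE : Num.sqrt s ^+ 2 = s by rewrite sqr_sqrtr// ltW.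
pose t := Num.sqrt s / b; have t0 : 0 < t by exact: divr_gt0.
apply: (@le_trans _ _ (\sum_x (Num.sqrt s * b) `^ s *
    (expR (t * signed_sum x) + expR (- t * signed_sum x)))).
  apply: ler_sum => x _; set y := signed_sum x.
  have -> : `|y| `^ s = (b / Num.sqrt s) `^ s * (t * `|y|) `^ s.
    rewrite -powRM ?divr_ge0 ?mulr_ge0 ?invr_ge0 ?(ltW b0)//.
    by congr powR; rewrite /t; field; rewrite !gt_eqF.
  have H := powR_le_expR s0 (mulr_ge0 (ltW t0) (normr_ge0 y)).
  apply: le_trans (ler_wpM2l (powR_ge0 (b / Num.sqrt s) s) H) _.
  rewrite mulrA -powRM ?divr_ge0 ?(ltW b0) ?(ltW s0)//.
  have -> : b / Num.sqrt s * s = Num.sqrt s * b.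
    by rewrite -[X in _ * X = _]sqE; field; rewrite gt_eqF.
  rewrite ler_wpM2l ?powR_ge0//.
  have [y0|y0] := leP 0 y; first by rewrite ger0_norm// lerDl expR_ge0.
  by rewrite ltr0_norm// mulrN mulNr lerDr expR_ge0.
rewrite -mulr_sumr big_split/=.
have := sum_expR_signed t; have := sum_expR_signed (- t); rewrite sqrrN -/b2.
have -> : 2 * t ^+ 2 * b2 = 2 * s.
  by rewrite /t expr_div_n sqE b2E; field.
move=> H1 H2; apply: le_trans (ler_wpM2l (powR_ge0 (Num.sqrt s * b) s) (lerD H2 H1)) _.
rewrite !powRM ?expR_ge0 ?(ltW b0) ?(ltW sq0)//.
have -> : b `^ s = b2 `^ (s / 2).
  by rewrite -b2E -powR_mulrn ?(ltW b0)// -powRrM; congr powR; field.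
rewrite -expRM.
set A := _ `^ _; set B := _ `^ _; set C := expR _; set E := 2 ^+ h.
by rewrite le_eqVlt; apply/orP; left; apply/eqP; ring.
Qed.

End Moments.

Lemma truncn_neq0_le_powR a s : 0 <= s ->
  (Num.truncn a != 0%N)%N%:R <= `|a| `^ s.
Proof.
move=> s0; case: eqP => [_|/eqP]; first exact: powR_ge0.
rewrite -lt0n truncn_gt0 => a1; rewrite -[leLHS](congr1 (fun f => f s) (@powR1 R)).
by apply: ler_powR2r; rewrite // (le_trans a1) ?ler_norm.
Qed.

Lemma truncn_le_powR a s : 1 <= s -> (Num.truncn a)%:R <= `|a| `^ s.
Proof.
move=> s1; have [a1|a1] := leP 1 a; last first.
  have -> : Num.truncn a = 0%N by apply/truncn0Pn; rewrite -ltNge.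
  exact: powR_ge0.
have a0 : 0 <= a by lra.
rewrite ger0_norm// (le_trans _ (le1r_powR a1 s1))//.
by rewrite truncn_le.
Qed.

(** Negative numbers truncate to 0, so a cell records the truncations of both a/W and -a/W. The cell
    of zero is the longest, an interval of length 2W. *)
Lemma truncn_eq_dist a b W : 0 < W ->
  Num.truncn (a / W) = Num.truncn (b / W) ->
  Num.truncn (- (a / W)) = Num.truncn (- (b / W)) -> `|a - b| <= 2 * W.
Proof.
move=> W0; set u := a / W; set v := b / W => uv1 uv2.
have -> : a - b = (u - v) * W by rewrite mulrBl /u /v !divfK ?gt_eqF.
rewrite normrM (gtr0_norm W0) ler_pM2r//.
have hu := truncnS_gt u; have hv := truncnS_gt v.
have hu' := truncnS_gt (- u); have hv' := truncnS_gt (- v).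
rewrite -uv1 in hv; rewrite -uv2 in hv'; rewrite -!natr1 in hu hv hu' hv'.
rewrite ler_norml; case: (posnP (Num.truncn u)) => [u0|].
  case: (posnP (Num.truncn (- u))) => [u0'|].
    rewrite u0 in hu hv; rewrite u0' in hu' hv'.
    by apply/andP; split; lra.
  rewrite truncn_gt0 => u1; have := u1; rewrite -truncn_gt0 uv2 truncn_gt0 => v1.
  have tu : (Num.truncn (- u))%:R <= - u by rewrite truncn_le; lra.
  have tv : (Num.truncn (- u))%:R <= - v by rewrite uv2 truncn_le; lra.
  by apply/andP; split; lra.
rewrite truncn_gt0 => u1; have := u1; rewrite -truncn_gt0 uv1 truncn_gt0 => v1.
have tu : (Num.truncn u)%:R <= u by rewrite truncn_le; lra.
have tv : (Num.truncn u)%:R <= v by rewrite uv1 truncn_le; lra.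
by apply/andP; split; lra.
Qed.

(* The threshold [W] is at the same time the sup-norm bound and the scale of
   the l_r-norm bound, where r is the moment order. *)
Definition colouring_threshold m p (c : R) h : R :=
  c * Num.sqrt (moment_order m p h%:R) * h%:R `^ (2^-1 - fine p^-1%E).

Lemma colouring_threshold_gt0 m p c h : (2%:E <= p)%E -> 0 < c -> (0 < h)%N ->
  0 < colouring_threshold m p c h.
Proof.
move=> p2 c0 h0; have r2 := moment_order_ge2 m h%:R p2.
by rewrite !mulr_gt0 ?powR_gt0 ?ltr0n// sqrtr_gt0; lra.
Qed.

(** [sum_row_moments] gives (2 e a / c)^r h, and r >= 2 turns the power r of a number at most 1 into
    a square. The parameter [a] is 2 e^2 in the entropy method, C1^(-1/2) for the budget of property
    B and 2 C3 for the moments of property D. *)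
Lemma sum_row_moments_threshold m p c (a : R) h (d : 'I_h -> 'cV[R]_m) : (0 < m)%N ->
    (2%:E <= p)%E -> 0 < c -> (0 < h)%N -> (forall j, lpnorm p (d j) <= 2) ->
    0 < a -> 2 * expR 1 * a <= c ->
  let r := moment_order m p h%:R in
  \sum_i (a * Num.sqrt r) `^ r * (\sum_j d j i ord0 ^+ 2) `^ (r / 2)
     / colouring_threshold m p c h `^ r
  <= (2 * expR 1 * a / c) ^+ 2 * h%:R.
Proof.
move=> m0 p2 c0 h0 d2 a0 ac /=; set r := moment_order m p h%:R.
have r2 : 2 <= r := moment_order_ge2 m _ p2.
have hR0 : 0 < h%:R :> R by rewrite ltr0n.
have e0 := @expR_gt0 R 1.
have sr0 : 0 < Num.sqrt r by rewrite sqrtr_gt0; lra.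
have H := sum_row_moments m0 p2 h0 d2; rewrite -/r in H.
have W0 := colouring_threshold_gt0 m p2 c0 h0.
rewrite -mulr_suml -mulr_sumr.
rewrite ler_pdivrMr ?powR_gt0//.
apply: le_trans (ler_wpM2l (powR_ge0 _ _) H) _.
rewrite /colouring_threshold -/r; set B := h%:R `^ _.
have B0 : 0 < B by exact: powR_gt0.
rewrite mulrA -powRM ?mulr_ge0 ?(ltW sr0) ?(ltW e0) ?(ltW B0) ?(ltW a0)//.
have -> : a * Num.sqrt r * (2 * expR 1 * B)
    = (2 * expR 1 * a / c) * (c * Num.sqrt r * B) by field; rewrite gt_eqF.
have q0 : 0 < 2 * expR 1 * a / c by rewrite divr_gt0 ?mulr_gt0.
rewrite powRM ?(ltW q0)//; last by rewrite !mulr_ge0 ?(ltW c0) ?(ltW sr0) ?(ltW B0).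
set q := 2 * expR 1 * a / c in q0 *; set X := (c * _ * _) `^ r.
have qq : q `^ r <= q ^+ 2.
  rewrite -powR_mulrn ?(ltW q0)// ger_powR// q0/=.
  by rewrite ler_pdivrMr// mul1r.
have := ler_wpM2r (mulr_ge0 (powR_ge0 _ r : 0 <= X) (ler0n R h)) qq.
lra.
Qed.

Lemma threshold_rate m p q (c : R) h : (0 < h)%N ->
  colouring_threshold m p c h * h%:R `^ fine q^-1%E =
  c * (Num.sqrt (moment_order m p h%:R) * h%:R `^ rate_exponent p q).
Proof.
move=> h0; have hR0 : 0 < h%:R :> R by rewrite ltr0n.
rewrite /colouring_threshold -!mulrA -powRD ?(gt_eqF hR0) ?implybT//.
Qed.

Lemma powR_mid_le (W r u a b : R) : 0 < W -> 0 <= r -> `|u| <= (`|a| + `|b|) / 2 ->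
  (`|u| / W) `^ r <= (`|a| / W) `^ r + (`|b| / W) `^ r.
Proof.
move=> W0 r0 uab.
have mono (v : R) : `|u| <= `|v| -> (`|u| / W) `^ r <= (`|v| / W) `^ r.
  by move=> uv; apply: ler_powR2r; rewrite ?divr_ge0 ?(ltW W0)// ler_pM2r ?invr_gt0.
have a0 := powR_ge0 (`|a| / W) r; have b0 := powR_ge0 (`|b| / W) r.
have [ab|ab] := leP `|a| `|b|.
  have /mono : `|u| <= `|b| by lra.
  by lra.
have /mono : `|u| <= `|a| by lra.
by lra.
Qed.

Lemma sign_diff (a b : bool) (c : R) :
  (if a != b then sign a * c else 0) = (sign a * c - sign b * c) / 2.
Proof. by rewrite /sign; case: a; case: b => /=; lra. Qed.

(** Half the difference of two sign vectors is the partial colouring on the coordinates where they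
    differ. The common cell bounds its sup norm by W, the two moments bound its r-th moment by h,
    and the last factor of [lpnorm_interp] is then at most 2. *)
Lemma cell_difference_norm m q (r W : R) h (d : 'I_h -> 'cV[R]_m) (x y : {ffun 'I_h -> bool}) :
    let Y (x : {ffun 'I_h -> bool}) i := signed_sum (fun j => d j i ord0) x in
    1 <= r -> (r%:E <= q)%E -> (0 < h)%N -> 0 < W ->
    (forall i, `|Y x i - Y y i| <= 2 * W) ->
    \sum_i (`|Y x i| / W) `^ r + \sum_i (`|Y y i| / W) `^ r <= h%:R ->
  lpnorm q (\sum_(j | x j != y j) sign (x j) *: d j) <= W * h%:R `^ fine q^-1%E * 2.
Proof.
move=> Y r1 rq h0 W0 YW Yh; have r0 : 0 <= r by lra.
have hR0 : 0 < h%:R :> R by rewrite ltr0n.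
set u := \sum_(j | _) _.
have uE i : u i ord0 = (Y x i - Y y i) / 2.
  rewrite /u summxE /Y /signed_sum -sumrB mulr_suml big_mkcond/=.
  by apply: eq_bigr => j _; rewrite !mxE -sign_diff.
have uN i : `|u i ord0| = `|Y x i - Y y i| / 2.
  by rewrite uE normrM [`|2^-1|]ger0_norm.
have uW i : `|u i ord0| <= W by rewrite uN; have := YW i; lra.
apply: le_trans (lpnorm_interp r1 rq h0 W0 uW) _.
rewrite ler_wpM2l//; first by rewrite mulr_ge0 ?powR_ge0 ?(ltW W0).
have : h%:R^-1 * \sum_i (`|u i ord0| / W) `^ r <= 1.
  rewrite mulrC ler_pdivrMr// mul1r; apply: le_trans Yh.
  rewrite -big_split/=; apply: ler_sum => i _; apply: powR_mid_le => //.
  by rewrite uN ler_wpM2r// ler_normB.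
lra.
Qed.

(** Twice c = 400 e^3, the 2 being that of [cell_difference_norm]. This c makes 2 e a / c = 1/100
    for a = 2 e^2, which fits the cell costs into the budget h/1600. *)
Definition partial_const : R := 800 * expR 3.

Lemma partial_colouring m p q h (d : 'I_h -> 'cV[R]_m) : (0 < m)%N ->
    (2%:E <= p)%E -> (p <= q)%E -> (0 < h)%N -> (forall j, lpnorm p (d j) <= 2) ->
  exists (S : {set 'I_h}) (e : 'I_h -> bool), (h < 8 * #|S|)%N /\
    lpnorm q (\sum_(j in S) sign (e j) *: d j) <=
    partial_const * (Num.sqrt (moment_order m p h%:R) * h%:R `^ rate_exponent p q).
Proof.
have budget_le (t : R) : 0 < t -> 16 * (t / 1600) + 16 * (t / 1600) <= t by lra.
move=> m0 p2 pq h0 d2; have hR0 : 0 < h%:R :> R by rewrite ltr0n.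
have [c cE] : exists c : R, c = 400 * expR 3 by exists (400 * expR 3).
have c0 : 0 < c by rewrite cE mulr_gt0 ?expR_gt0 ?ltr0n.
set r := moment_order m p h%:R.
have r2 : 2 <= r := moment_order_ge2 m _ p2.
have r0 : 0 < r by lra.
have rq : (r%:E <= q)%E by apply: le_trans pq; exact: moment_order_le.
pose W := colouring_threshold m p c h.
have W0 : 0 < W by exact: colouring_threshold_gt0.
pose Y i := signed_sum (fun j => d j i ord0).
pose b2 i := \sum_j d j i ord0 ^+ 2.
have e20 := expR_gt0 (2 : R).
pose a : R := 2 * expR 2.
have a0 : 0 < a by rewrite mulr_gt0.
have sr0 : 0 < Num.sqrt r by rewrite sqrtr_gt0.
(* This number bounds the average of (|Y i|/W)^r, and its square that of the 2r-th power; a = 2 e^2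
   in place of e^2 absorbs the sqrt 2 of sqrt (2r). *)
pose b i := 2 * ((a * Num.sqrt r) `^ r * b2 i `^ (r / 2) / W `^ r).
have b0 i : 0 <= b i by rewrite !mulr_ge0 ?invr_ge0 ?powR_ge0.
have bh : \sum_i b i <= h%:R / 3200.
  rewrite -mulr_sumr; have := @sum_row_moments_threshold m p c a h d m0 p2 c0 h0 d2 a0.
  have ec : 2 * expR 1 * a = c / 100.
    have : expR 3 = expR 1 * expR 2 :> R by rewrite -expRD; congr expR; lra.
    by rewrite /a cE => ->; field.
  rewrite ec ler_pdivrMr ?ltr0n// => /(_ _)/=.
  have -> : c / 100 / c = 100^-1 by field; rewrite gt_eqF.
  have c1 : c <= c * 100 by rewrite ler_peMr ?(ltW c0)// ler1n.
  move=> /(_ c1); rewrite -/r -/W => H.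
  rewrite [X in 2 * X](_ : _ = \sum_i (a * Num.sqrt r) `^ r * b2 i `^ (r / 2) / W `^ r)//.
  move: H hR0; clear; lra.
have Yr i s : 0 < s -> \sum_x (`|Y i x| / W) `^ s
    <= 2 ^+ h * (2 * (expR 2 * Num.sqrt s) `^ s * (b2 i) `^ (s / 2)) / W `^ s.
  move=> s0; rewrite ler_pdivlMr ?powR_gt0// mulr_suml.
  apply: le_trans (sum_powR_signed (fun j => d j i ord0) s0).
  by apply: ler_sum => x _; rewrite -powRM ?divr_ge0 ?(ltW W0)// divfK ?gt_eqF.
have Yr1 i : \sum_x (`|Y i x| / W) `^ r <= 2 ^+ h * b i.
  apply: le_trans (Yr i r r0) _.
  rewrite /b -!mulrA ler_pM2l ?exprn_gt0// ler_pM2l// ler_wpM2r//.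
    by rewrite mulr_ge0 ?invr_ge0 ?powR_ge0.
  apply: ler_powR2r; rewrite ?mulr_ge0 ?(ltW r0) ?(ltW sr0) ?(ltW e20)//.
  by rewrite mulrA ler_pM2r// /a; move: e20; clear; lra.
have Yr2 i : \sum_x (`|Y i x| / W) `^ (2 * r) <= 2 ^+ h * b i ^+ 2.
  have rr0 : 0 < 2 * r by rewrite mulr_gt0.
  apply: le_trans (Yr i _ rr0) _.
  have pow2 x : 0 <= x -> x `^ (2 * r) = (x `^ r) ^+ 2.
    by move=> x0; rewrite mulrC powRrM powR_mulrn ?powR_ge0.
  have -> : 2 * r / 2 = r / 2 * 2 by field.
  rewrite [b2 i `^ _]powRrM powR_mulrn ?powR_ge0//.
  rewrite (pow2 W (ltW W0)) pow2 ?mulr_ge0 ?sqrtr_ge0 ?(ltW e20)//.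
  set A := _ `^ r; set B := b2 i `^ _; set C := W `^ r.
  have C0 : 0 < C by exact: powR_gt0.
  have AA : A <= (a * Num.sqrt r) `^ r.
    apply: ler_powR2r; rewrite ?mulr_ge0 ?sqrtr_ge0 ?(ltW r0) ?(ltW e20)//.
    rewrite /a [leRHS](_ : _ = expR 2 * (2 * Num.sqrt r)); last by ring.
    rewrite ler_pM2l//; have -> : 2 * Num.sqrt r = Num.sqrt (2 ^+ 2) * Num.sqrt r :> R.
      by rewrite sqrtr_sqr ger0_norm.
    by rewrite -sqrtrM ?exprn_ge0// ler_wsqrtr//; move: r0; clear; lra.
  rewrite -mulrA ler_pM2l ?exprn_gt0// ler_pdivrMr ?exprn_gt0//.
  rewrite /b -/B -/C.
  have -> : (2 * ((a * Num.sqrt r) `^ r * B / C)) ^+ 2 * C ^+ 2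
     = 4 * ((a * Num.sqrt r) `^ r) ^+ 2 * B ^+ 2 by field; rewrite gt_eqF.
  apply: ler_wpM2r; first exact: sqr_ge0.
  have A0 : 0 <= A := powR_ge0 _ _.
  have : A ^+ 2 <= ((a * Num.sqrt r) `^ r) ^+ 2 by rewrite lerXn2r ?nnegrE ?powR_ge0.
  have := sqr_ge0 A; clear; lra.
(* Two truncations per row, one for each sign. The 2r-th moment bounds the frequency of nonzero
   values, the r-th moment the mean. *)
pose s (ib : 'I_m * bool) x := Num.truncn (sign ib.2 * (Y ib.1 x / W)).
have sY ib x : `|sign ib.2 * (Y ib.1 x / W)| = `|Y ib.1 x| / W.
  rewrite normrM normf_div (gtr0_norm W0).
  by case: ib.2; rewrite /= ?normr1 ?normrN1 mul1r.
pose g x := \sum_i (`|Y i x| / W) `^ r.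
have h16 : 0 < h%:R / 1600 :> R by rewrite divr_gt0 ?ltr0n.
have [x [y [sxy gx gy hxy]]] :
    exists x y, [/\ forall i, s i x = s i y, g x <= 16 * (h%:R / 1600), g y <= 16 * (h%:R / 1600) &
                  (h < 8 * hamming x y)%N].
  apply: (@cube_pigeonhole R h _ s (fun ib => b ib.1)) => //.
  - move=> ib; apply: le_trans (Yr2 ib.1); apply: ler_sum => x _.
    by rewrite -sY; apply: truncn_neq0_le_powR; move: r2; clear; lra.
  - move=> ib; apply: le_trans (Yr1 ib.1); apply: ler_sum => x _.
    by rewrite -sY; apply: truncn_le_powR; move: r2; clear; lra.
  - rewrite -(pair_big predT predT (fun i _ => b i))/= exchange_big big_bool/=; move: bh; clear; lra.
  - by move=> x; apply: sumr_ge0 => i _; exact: powR_ge0.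
  - rewrite /g exchange_big/= (le_trans (ler_sum _ (fun i _ => Yr1 i)))//.
    by rewrite -mulr_sumr ler_pM2l ?exprn_gt0//; move: bh hR0; clear; lra.
exists (finset (fun j => x j != y j)), x; split.
  by move: hxy; rewrite /hamming cardsE.
have -> : partial_const = c * 2 by rewrite /partial_const cE mulrAC -natrM.
rewrite [leRHS]mulrAC -threshold_rate// big_mkcond/=.
under eq_bigr do rewrite inE.
rewrite -big_mkcond/=; apply: (@cell_difference_norm m q r) => //.
- by apply: le_trans r2; rewrite ler1n.
- move=> i; apply: truncn_eq_dist => //.
    by have := sxy (i, true); rewrite /s /= !mul1r.
  by have := sxy (i, false); rewrite /s /= !mulN1r.
- exact: le_trans (lerD gx gy) (budget_le _ hR0).
Qed.

End PartialColouring.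

(** * Existence *)

Section Rounding.
Variables (R : realType) (n : nat).
Implicit Types (x : 'I_n -> R).

Definition partial_sum x (j : nat) : R := \sum_(i < n | (i < j)%N) x i.

(* Rounding the cumulative sums, not the terms, keeps the total. *)
Definition cumulative_round x (j : 'I_n) : nat :=
  Num.truncn (partial_sum x j.+1) - Num.truncn (partial_sum x j).

Lemma partial_sumS x (j : 'I_n) : partial_sum x j.+1 = partial_sum x j + x j.
Proof.
rewrite /partial_sum (bigD1 j) ?ltnSn//= addrC; congr (_ + _).
apply: eq_bigl => i; rewrite ltnS leq_eqVlt -val_eqE.
by case: ltngtP.
Qed.

Lemma partial_sum0 x : partial_sum x 0 = 0.
Proof. by rewrite /partial_sum big_pred0. Qed.

Lemma partial_sumT x : partial_sum x n = \sum_i x i.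
Proof. by apply: eq_bigl => i; rewrite ltn_ord. Qed.

Section Nonnegative.
Variable x : 'I_n -> R.
Hypothesis x_ge0 : forall i, 0 <= x i.

Lemma partial_sum_ge0 j : 0 <= partial_sum x j.
Proof. exact: sumr_ge0. Qed.

Lemma truncn_partial_sumS (j : 'I_n) :
  (Num.truncn (partial_sum x j) <= Num.truncn (partial_sum x j.+1))%N.
Proof. by apply: le_truncn; rewrite partial_sumS lerDl. Qed.

Lemma sum_cumulative_round N : \sum_i x i = N%:R -> (\sum_i cumulative_round x i = N)%N.
Proof.
move=> xN; pose f j := Num.truncn (partial_sum x j).
have f0 : f 0%N = 0%N by rewrite /f partial_sum0 truncn0.
have fn : f n = N by rewrite /f partial_sumT xN natrK.
have H k : (k <= n)%N -> (\sum_(i < n | (i < k)%N) cumulative_round x i = f k)%N.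
  elim: k => [_|k IH kn]; first by rewrite big_pred0.
  rewrite (bigD1 (Ordinal kn))//=.
  rewrite (eq_bigl (fun i : 'I_n => (i < k)%N)); last first.
    by move=> i; rewrite ltnS leq_eqVlt -val_eqE/=; case: ltngtP.
  rewrite IH ?(ltnW kn)// /cumulative_round /= subnK//.
  exact: (truncn_partial_sumS (Ordinal kn)).
by rewrite -fn -H//; apply: eq_bigl => i; rewrite ltn_ord.
Qed.

Lemma cumulative_round_dist j : `|(cumulative_round x j)%:R - x j| <= 1.
Proof.
rewrite /cumulative_round natrB ?truncn_partial_sumS//.
have /andP[a1 a2] := truncn_itv (partial_sum_ge0 j).
have /andP[b1 b2] := truncn_itv (partial_sum_ge0 j.+1).
rewrite -!natr1 in a2 b2; rewrite partial_sumS in b1 b2.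
rewrite partial_sumS in b1 b2 *; move: b1 b2 a1 a2.
set u := (Num.truncn (_ + _))%:R; set v := (Num.truncn _)%:R => b1 b2 a1 a2.
by rewrite ler_norml; apply/andP; split; lra.
Qed.

End Nonnegative.
End Rounding.

Lemma remainder_lt (a b s n : nat) :
  (s < 8 * b -> s < n.+1 -> a + b = s -> a < n)%N.
Proof. lia. Qed.

Lemma remainder_le (R : realType) (a b s : nat) : (s < 8 * b)%N -> (a + b = s)%N ->
  a%:R <= 7 / 8 * s%:R :> R.
Proof.
move=> sb ab; have : (8 * a <= 7 * s)%N by lia.
by rewrite -(ler_nat R) !natrM; lra.
Qed.

(** * From partial colourings to multiplicities of total k *)

Section Existence.
Variables (R : realType) (m k : nat) (p q : \bar R).
Hypotheses (m_gt0 : (0 < m)%N) (k_gt0 : (0 < k)%N).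
Hypotheses (p_ge2 : (2%:E <= p)%E) (le_pq : (p <= q)%E).
Local Notation al := (rate_exponent p q).
Hypothesis al_gt0 : 0 < al.
Variable c : R.
Hypothesis c_ge0 : 0 <= c.
Hypothesis partial_colouring : forall h (d : 'I_h -> 'cV[R]_m), (0 < h)%N ->
    (forall j, lpnorm p (d j) <= 2) ->
  exists (S : {set 'I_h}) (e : 'I_h -> bool), (h < 8 * #|S|)%N /\
    lpnorm q (\sum_(j in S) sign R (e j) *: d j)
    <= c * (Num.sqrt (moment_order m p h%:R) * h%:R `^ al).
Local Notation pot := (colouring_potential m k p q (6 * c)).

Let q1 : (1 <= q)%E.
Proof. by apply: le_trans (le_trans p_ge2 le_pq); rewrite lee_fin ler1n. Qed.
Let q0 : (0 < q)%E.
Proof. by apply: lt_le_trans q1. Qed.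
Let p0 : (0 < p)%E.
Proof. by apply: lt_le_trans p_ge2; rewrite lte_fin. Qed.
Let p1 : (1 <= p)%E.
Proof. by apply: le_trans p_ge2; rewrite lee_fin ler1n. Qed.

Let c6_ge0 : 0 <= 6 * c.
Proof. exact: mulr_ge0. Qed.

(** Induction on the size of [S]: a partial colouring fixes the signs on T', at most 7/8 of [S] is
    left to the induction hypothesis, and [colouring_potential_step] adds up the two errors. *)
Lemma full_colouring N (d : 'I_N -> 'cV[R]_m) (S : {set 'I_N}) :
    (forall j, lpnorm p (d j) <= 2) ->
  exists e : 'I_N -> bool,
    lpnorm q (\sum_(j in S) sign R (e j) *: d j) <= pot #|S|%:R.
Proof.
move=> d2; have [n Sn] := ubnP #|S|; elim: n S Sn => // n IH S Sn.
have pot0 x : 0 <= pot x.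
  by apply: colouring_potential_ge0; rewrite // ltW.
have [S0|S0] := posnP #|S|.
  exists (fun=> true); rewrite (eqP (_ : S == finset.set0)) -?cards_eq0 ?S0//.
  by rewrite big_set0 lpnorm0.
have [T [e1 [hT de1]]] := @partial_colouring #|S| (fun j => d (enum_val j)) S0 (fun j => d2 _).
pose T' := [set enum_val j | j in T]%SET.
have TS : T' \subset S.
  by apply/fintype.subsetP => _ /imsetP[j _ ->]; exact: enum_valP.
have cT : #|T'| = #|T| by apply: card_imset; exact: enum_val_inj.
have cST : (#|S :\: T'| + #|T| = #|S|)%N.
  by rewrite -cT -[RHS](cardsID T') (finset.setIidPr TS) addnC.
have [|e2 de2] := IH (S :\: T')%SET; first exact: remainder_lt hT Sn cST.
have [x0 x0S] : exists x, x \in S by apply/card_gt0P.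
exists (fun j => if j \in T' then e1 (enum_rank_in x0S j) else e2 j).
rewrite (big_setID T')/= (finset.setIidPr TS).
apply: le_trans (ler_lpnormD _ _ q1) _.
have -> : \sum_(i in T') sign R (if i \in T' then e1 (enum_rank_in x0S i) else e2 i) *: d i
   = \sum_(j in T) sign R (e1 j) *: d (enum_val j).
  rewrite big_imset/=; last by move=> ? ? _ _; exact: enum_val_inj.
  by apply: eq_bigr => j jT; rewrite imset_f// enum_valK_in.
rewrite [X in _ + lpnorm q X](eq_bigr (fun i => sign R (e2 i) *: d i)); last first.
  by move=> i; rewrite inE => /andP[/negbTE -> _].
apply: le_trans (lerD de1 de2) _.
exact: colouring_potential_step m_gt0 k_gt0 p_ge2 le_pq _ _ _ al_gt0 c_ge0 S0 (ler0n _ _) (remainder_le R hT cST).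
Qed.

(** The ends of a pair receive opposite signs, which keeps the total multiplicity; the differences
    inside the pairs have l_p norm at most 2. *)
Lemma balanced_colouring n (v : 'I_n -> 'cV[R]_m) (S : {set 'I_n}) :
    (forall j, lpnorm p (v j) <= 1) -> ~~ odd #|S| ->
  exists e : 'I_n -> bool, \sum_(j in S) sign R (e j) = 0 /\
    lpnorm q (\sum_(j in S) sign R (e j) *: v j) <= pot #|S|%:R.
Proof.
move=> v1 S_even; pose h := #|S|./2.
have hE : (#|S| = h + h)%N by rewrite /h addnn even_halfK.
have [S0|S0] := posnP #|S|.
  have -> : S = finset.set0 by apply/eqP; rewrite -cards_eq0 S0.
  exists (fun=> true); rewrite !big_set0 lpnorm0//; split=> //.
  by apply: colouring_potential_ge0; rewrite // ltW.
have [x0 x0S] : exists x, x \in S by apply/card_gt0P.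
pose f (i : 'I_h) : 'I_n := enum_val (cast_ord (esym hE) (lshift h i)).
pose g (i : 'I_h) : 'I_n := enum_val (cast_ord (esym hE) (rshift h i)).
have sumE (V : zmodType) (F : 'I_n -> V) :
    \sum_(j in S) F j = \sum_i (F (f i) + F (g i)).
  rewrite big_enum_val/= (reindex (cast_ord (esym hE)))/=; last first.
    by exists (cast_ord hE) => i _; rewrite ?cast_ordK ?cast_ordKV.
  by rewrite big_split_ord/= big_split.
have [|e de] := @full_colouring h (fun i => v (f i) - v (g i)) finset.setT.
  move=> j; apply: le_trans (ler_lpnormD _ _ p1) _; rewrite lpnormN//.
  by have := v1 (f j); have := v1 (g j); lra.
pose e' j := match fintype.split (cast_ord hE (enum_rank_in x0S j)) with
  | inl i => e i | inr i => ~~ e i end.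
have ef i : e' (f i) = e i.
  by rewrite /e' /f enum_valK_in cast_ordKV -/(unsplit (inl i)) unsplitK.
have eg i : e' (g i) = ~~ e i.
  by rewrite /e' /g enum_valK_in cast_ordKV -/(unsplit (inr i)) unsplitK.
have signN b : sign R (~~ b) = - sign R b by case: b; rewrite /sign ?opprK.
exists e'; split.
  by rewrite sumE big1// => i _; rewrite ef eg signN subrr.
rewrite sumE (eq_bigr (fun i => sign R (e i) *: (v (f i) - v (g i)))); last first.
  by move=> i _; rewrite ef eg signN scaleNr scalerBr.
rewrite (eq_bigl (fun i => i \in finset.setT)); last by move=> i; rewrite inE.
apply: le_trans de _.
apply: colouring_potential_mono; rewrite //.
by rewrite cardsT card_ord ler_nat hE leq_addr.
Qed.

(** With signs e on the odd entries, 2 b_j = a_j + e_j. The normalised combination therefore moves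
    exactly by the signed sum divided by 2^(l+1) k. *)
Lemma halve_weights n (v : 'I_n -> 'cV[R]_m) l (a : 'I_n -> nat) :
    (forall j, lpnorm p (v j) <= 1) -> (\sum_j a j = 2 ^ l.+1 * k)%N ->
  exists b : 'I_n -> nat, (\sum_j b j = 2 ^ l * k)%N /\
    lpnorm q ((2 ^ l.+1 * k)%N%:R^-1 *: (\sum_j (a j)%:R *: v j)
              - (2 ^ l * k)%N%:R^-1 *: (\sum_j (b j)%:R *: v j))
    <= pot (2 ^ l.+1 * k)%N%:R / (2 ^ l.+1 * k)%N%:R.
Proof.
move=> v1 aE; pose S : {set 'I_n} := finset (fun j => odd (a j)).
have S_odd : odd #|S| = odd (\sum_j a j).
  rewrite -sum1_card big_mkcond/=; elim/big_rec2: _ => // j x y _ xy.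
  by rewrite [LHS]oddD [RHS]oddD xy inE; case: (odd (a j)).
have S_even : ~~ odd #|S| by rewrite S_odd aE expnS -mulnA oddM.
have S_le : (#|S| <= 2 ^ l.+1 * k)%N.
  rewrite -aE -sum1_card big_mkcond/=; apply: leq_sum => j _.
  by rewrite inE; case: (a j) => // i; case: ifP.
have [e [e0 de]] := balanced_colouring v1 S_even.
pose b j := if odd (a j) && e j then (a j)./2.+1 else (a j)./2.
have bE j : 2 * (b j)%:R = (a j)%:R + (if j \in S then sign R (e j) else 0) :> R.
  have -> : (a j)%:R = (odd (a j))%:R + 2 * (a j)./2%:R :> R.
    by rewrite -[in LHS](odd_double_half (a j)) natrD -muln2 natrM [2 * _]mulrC.
  rewrite inE /b; case: (odd (a j)) => /=; last by rewrite addr0 add0r.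
  by case: (e j); rewrite /sign -?natr1; lra.
have tl0 : 0 < (2 ^ l * k)%N%:R :> R by rewrite ltr0n muln_gt0 expn_gt0.
have tE : (2 ^ l.+1 * k)%N%:R = 2 * (2 ^ l * k)%N%:R :> R.
  by rewrite expnS -mulnA natrM.
exists b; split.
  apply/eqP; rewrite -(eqr_nat R) -(inj_eq (mulfI (_ : 2 != 0 :> R)))//.
  rewrite -tE -aE !natr_sum mulr_sumr; apply/eqP.
  rewrite (eq_bigr _ (fun j _ => bE j)) big_split/= -big_mkcond/= e0 addr0.
  by [].
have -> : (2 ^ l.+1 * k)%N%:R^-1 *: (\sum_j (a j)%:R *: v j)
              - (2 ^ l * k)%N%:R^-1 *: (\sum_j (b j)%:R *: v j)
    = - ((2 ^ l.+1 * k)%N%:R^-1 *: \sum_(j in S) sign R (e j) *: v j).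
  rewrite tE -[RHS]scalerN.
  have -> : (2 ^ l * k)%N%:R^-1 = (2 * (2 ^ l * k)%N%:R)^-1 * 2 :> R.
    by rewrite invfM mulrAC mulVf ?pnatr_eq0// mul1r.
  rewrite -[(_ * 2) *: _]scalerA -scalerBr; congr (_ *: _).
  rewrite scaler_sumr -sumrB -sumrN big_mkcond/= [RHS]big_mkcond/=.
  apply: eq_bigr => j _; rewrite scalerA bE scalerDl opprD addrA subrr add0r.
  by case: ifP => _; rewrite ?scale0r ?oppr0.
rewrite lpnormN// lpnormZ// ger0_norm ?invr_ge0// mulrC ler_wpM2r ?invr_ge0//.
apply: le_trans de _; apply: colouring_potential_mono; rewrite //.
by rewrite ler_nat.
Qed.

Local Notation level_const := (128 * (6 * c)).
Local Notation B0 := (level_const / al * (rate_scale m k p q / k%:R)).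

(** The factor 3 (1 - (3/4)^l) is the sum of (3/4)^i for i from 1 to l, the errors of the levels. *)
Lemma round_weights n (v : 'I_n -> 'cV[R]_m) l (a : 'I_n -> nat) :
    (forall j, lpnorm p (v j) <= 1) -> (\sum_j a j = 2 ^ l * k)%N ->
  exists b : 'I_n -> nat, (\sum_j b j = k)%N /\
    lpnorm q ((2 ^ l * k)%N%:R^-1 *: (\sum_j (a j)%:R *: v j)
              - k%:R^-1 *: (\sum_j (b j)%:R *: v j))
    <= 3 * B0 * (1 - (3 / 4) ^+ l).
Proof.
move=> v1; elim: l a => [|l IH] a aE.
  exists a; rewrite aE mul1n; split=> //.
  by rewrite expr0 !subrr mulr0 lpnorm0.
have [b [bE ab]] := halve_weights v1 aE.
have [b' [b'E bb']] := IH b bE; exists b'; split=> //.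
rewrite -[X in X - _](subrK ((2 ^ l * k)%N%:R^-1 *: (\sum_j (b j)%:R *: v j))) -addrA.
apply: le_trans (ler_lpnormD _ _ q1) _; apply: le_trans (lerD ab bb') _.
have := @colouring_potential_level R m k p q k_gt0 p_ge2 le_pq (6 * c) l.+1 al_gt0.
move=> /(_ c6_ge0); rewrite !exprS; lra.
Qed.

Lemma cumulative_round_error n N (lam : 'I_n -> R) (v : 'I_n -> 'cV[R]_m) z : (0 < N)%N ->
    (forall j, lpnorm p (v j) <= 1) -> convex_comb lam v z ->
  lpnorm q (z - N%:R^-1 *:
    \sum_j (cumulative_round (fun j => N%:R * lam j) j)%:R *: v j) <= n%:R / N%:R.
Proof.
move=> N0 v1 [lam0 lam1 ->]; have NR0 : 0 < N%:R :> R by rewrite ltr0n.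
rewrite scaler_sumr -sumrB; apply: le_trans (ler_lpnorm_sum _ _ q1) _.
rewrite -[X in X%:R / _](card_ord n) mulr_natl -sumr_const; apply: ler_sum => j _.
rewrite scalerA -scalerBl lpnormZ//.
have -> : lam j = N%:R^-1 * (N%:R * lam j) by rewrite mulKf ?gt_eqF.
rewrite -mulrBr normrM gtr0_norm ?invr_gt0// -mulrA ler_piMr ?invr_ge0//.
rewrite mulr_ile1 ?lpnorm_ge0//; last exact: lpnorm_le1W p0 le_pq (v1 j).
rewrite distrC; apply: (@cumulative_round_dist R n (fun j => N%:R * lam j)).
by move=> i; rewrite mulr_ge0.
Qed.

Lemma sum_cumulative_round_conv n N (lam : 'I_n -> R) : (forall j, 0 <= lam j) ->
  \sum_j lam j = 1 -> (\sum_j cumulative_round (fun j => (N%:R * lam j)%R) j = N)%N.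
Proof.
move=> lam0 lam1; apply: sum_cumulative_round; last by rewrite -mulr_sumr lam1 mulr1.
by move=> i; rewrite mulr_ge0.
Qed.

(** Absorbs the initial rounding error, of order 1/k, into the rate; it rests on [rate_scale] >= 1/3
    and 1/al >= 2. *)
Lemma inv_le_rate : k%:R^-1 <= 2 * (rate_scale m k p q / k%:R / al).
Proof.
have s3 := rate_scale_ge m k_gt0 p_ge2 le_pq.
have /andP[_ a2] := rate_exponent_itv p_ge2 le_pq.
have ia : 2 <= al^-1 by rewrite -[leLHS]invrK lef_pV2 ?posrE ?invr_gt0.
rewrite mulrAC mulrA ler_peMl ?invr_ge0//.
have := ler_pM _ _ s3 ia; rewrite invr_ge0 !ler0n => /(_ isT isT); lra.
Qed.

Lemma approx_convex_comb n (lam : 'I_n -> R) (v : 'I_n -> 'cV[R]_m) z :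
    (forall j, lpnorm p (v j) <= 1) -> convex_comb lam v z ->
  exists b : 'I_n -> nat, (\sum_j b j = k)%N /\
    lpnorm q (z - k%:R^-1 *: (\sum_j (b j)%:R *: v j))
    <= (3 * level_const + 2) * (rate_scale m k p q / k%:R / al).
Proof.
move=> v1 zE; have [lam0 lam1 _] := zE.
(* The number of levels is free for existence: as 2^n >= n, n of them bring the rounding error n/N
   below 1/k for a combination of any length. *)
pose N := (2 ^ n * k)%N; have N0 : (0 < N)%N by rewrite muln_gt0 expn_gt0.
have kR0 : 0 < k%:R :> R by rewrite ltr0n.
pose a := cumulative_round (fun j => N%:R * lam j).
have aE : (\sum_j a j = 2 ^ n * k)%N by exact: sum_cumulative_round_conv.
have [b [bE ab]] := round_weights v1 aE.
exists b; split=> //.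
rewrite -[z](subrK (N%:R^-1 *: (\sum_j (a j)%:R *: v j))) -addrA.
apply: le_trans (ler_lpnormD _ _ q1) _.
apply: le_trans (lerD (cumulative_round_error N0 v1 zE) ab) _.
have nN : n%:R / N%:R <= k%:R^-1 :> R.
  rewrite ler_pdivrMr ?ltr0n// /N natrM mulrC mulfK ?gt_eqF// ler_nat.
  by rewrite ltnW// ltn_expl.
have := inv_le_rate.
have B0_ge0 : 0 <= 3 * B0.
  by rewrite !mulr_ge0 ?invr_ge0 ?(ltW al_gt0) ?sqrtr_ge0 ?powR_ge0.
have : 3 * B0 * (1 - (3 / 4) ^+ n) <= 3 * B0.
  by rewrite ler_piMr// gerBl exprn_ge0// divr_ge0.
have -> : 3 * B0 = 3 * level_const * (rate_scale m k p q / k%:R / al).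
  by field; rewrite !gt_eqF.
lra.
Qed.

End Existence.

Lemma le_gauge (R : realType) m (Q : set 'cV[R]_m) (x y : 'cV[R]_m) s :
  0 <= s -> Q y -> x = s *: y -> (gauge Q x <= s%:E)%E.
Proof. by move=> s0 Qy xE; apply: ereal_inf_lbound; exists s => //; split=> //; exists y. Qed.

Lemma gauge_lpball (R : realType) m q (x : 'cV[R]_m) c : (0 < q)%E -> 0 < c ->
  lpnorm q x <= c -> (gauge (lpball q) x <= c%:E)%E.
Proof.
move=> q0 c0 xc; apply: (@le_gauge _ _ _ _ (c^-1 *: x)).
- exact: ltW.
- by rewrite /lpball/= lpnormZ// gtr0_norm ?invr_gt0// mulrC ler_pdivrMr// mul1r.
- by rewrite scalerA divff ?gt_eqF// scale1r.
Qed.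

Lemma list_of_multiplicities (R : realType) m n k (v : 'I_n -> 'cV[R]_m) (b : 'I_n -> nat) :
  (\sum_j b j = k)%N -> exists f : 'I_k -> 'I_n,
    \sum_i v (f i) = \sum_j (b j)%:R *: v j.
Proof.
move=> bk; pose s := flatten [seq nseq (b j) j | j <- enum 'I_n].
have ss : size s = k.
  rewrite size_flatten /shape -map_comp sumnE big_map -bk big_enum/=.
  by apply: eq_bigr => j _; rewrite /= size_nseq.
exists (fun i => tnth (in_tuple s) (cast_ord (esym ss) i)).
rewrite -(reindex (cast_ord (esym ss)) (P := predT) (F := fun i => v (tnth (in_tuple s) i)))/=; last first.
  by exists (cast_ord ss) => i _; rewrite ?cast_ordK ?cast_ordKV.
rewrite -(big_tuple _ _ (in_tuple s) predT v)/= big_flatten/= big_map big_enum/=.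
apply: eq_bigr => j _; elim: (b j) => [|c IH]; first by rewrite big_nil scale0r.
by rewrite /= big_cons IH -natr1 scalerDl scale1r addrC.
Qed.

Theorem ac_le (R : realType) : exists2 C : R, 0 < C &
  forall (m k : nat) (p q : \bar R),
    (0 < m)%N -> (0 < k)%N -> (2%:E <= p)%E -> (p <= q)%E ->
    (ac k (@lpball R m p) (@lpball R m q) <= C%:E * ac_bound m k p q)%E.
Proof.
have c0 : 0 <= partial_const R by exact: mulr_ge0 (ler0n _ _) (expR_ge0 _).
have partial := @partial_colouring R.
move: (partial_const R) c0 partial => c c0 partial.
pose C := 3 * (128 * (6 * c)) + 2.
have C0 : 0 < C by rewrite ltr_wpDl ?mulr_ge0.
exists C => // m k p q m0 k0 p2 pq.
have q0 : (0 < q)%E by apply: lt_le_trans (le_trans p2 pq); rewrite lte_fin.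
have /andP[a0 _] := rate_exponent_itv p2 pq.
move: a0; rewrite le_eqVlt => /predU1P[/esym a0|a0].
  by rewrite ac_bound_pinfty// gt0_muley ?lte_fin// leey.
rewrite ac_boundE// -EFinM.
apply: ge_ereal_sup => _ [[X z] /= [XP [n [lam [v [vX zE]]]]] <-].
have v1 j : lpnorm p (v j) <= 1 by exact: XP.
have [b [bk bz]] := approx_convex_comb m0 k0 p2 pq a0 c0
  (fun h d h0 d2 => partial m p q h d m0 p2 pq h0 d2) v1 zE.
have [f fE] := list_of_multiplicities v bk.
apply: le_trans (ereal_inf_lbound _) _; first by exists (v \o f) => //= i; exact: vX.
apply: gauge_lpball => //=; last by rewrite fE.
rewrite mulr_gt0// divr_gt0// divr_gt0 ?ltr0n//.
by apply: lt_le_trans (rate_scale_ge m k0 p2 pq); rewrite invr_gt0.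
Qed.

(** * The exponent of matrix multiplication *)

Section MatrixMultiplication.
Variable R : realType.
Local Notation run := (foldl (@slp_step R)).
Implicit Types (vals : seq R) (prog : seq (slp_instr R)).

Lemma run_prefix prog vals : exists2 w, run vals prog = vals ++ w & size w = size prog.
Proof.
elim: prog vals => [|c prog IH] vals; first by exists [::]; rewrite ?cats0.
have [w wE ws] := IH (slp_step vals c).
exists (last 0 (slp_step vals c) :: w); last by rewrite /= ws.
by rewrite /= wE /slp_step last_rcons cat_rcons.
Qed.

Lemma size_run prog vals : size (run vals prog) = (size vals + size prog)%N.
Proof. by have [w -> <-] := run_prefix prog vals; rewrite size_cat. Qed.

Lemma nth_run prog vals i : (i < size vals)%N -> (run vals prog)`_i = vals`_i.
Proof. by have [w -> _] := run_prefix prog vals => ?; rewrite nth_cat ifT. Qed.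

Lemma slp_dot_product N (s : seq (nat * nat)) :
    (forall u, u \in s -> u.1 < N /\ u.2 < N)%N ->
  exists prog, size prog = (1 + 2 * size s)%N /\ forall vals, size vals = N ->
    (run vals prog)`_(N + 2 * size s) = \sum_(u <- s) vals`_(u.1) * vals`_(u.2).
Proof.
elim/last_ind: s => [|s u IH] sN.
  exists [:: SConst 0]; split=> // vals <-.
  by rewrite /= /slp_step addn0 nth_rcons ltnn eqxx big_nil.
have [|prog [sp H]] := IH; first by move=> w ws; apply: sN; rewrite mem_rcons inE ws orbT.
have [u1 u2] : (u.1 < N /\ u.2 < N)%N by apply: sN; rewrite mem_rcons inE eqxx.
exists (prog ++ [:: SMul R u.1 u.2; SAdd R (N + 2 * size s) (N + 2 * size s).+1]).
split; first by rewrite size_cat sp size_rcons/=; lia.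
move=> vals vN; rewrite foldl_cat; set w := run vals prog.
have ws : size w = (N + 2 * size s).+1 by rewrite size_run vN sp; lia.
rewrite /= /slp_step size_rcons.
have -> : (N + 2 * (size s).+1)%N = size (rcons w (w`_u.1 * w`_u.2)).
  by rewrite size_rcons ws; lia.
rewrite nth_rcons ltnn eqxx !nth_rcons ws ltnSn ltnn eqxx.
by rewrite -cats1 big_cat big_seq1/= /w H// !nth_run ?vN.
Qed.

Lemma slp_dot_products (I : eqType) N n (ts : seq I) (F : I -> seq (nat * nat)) :
    (forall t u, u \in F t -> u.1 < N /\ u.2 < N)%N -> (forall t, size (F t) = n) ->
  exists prog out, size prog = (size ts * (1 + 2 * n))%N /\
    forall t, t \in ts -> (out t < N + size prog)%N /\
      forall vals, size vals = N ->
        (run vals prog)`_(out t) = \sum_(u <- F t) vals`_(u.1) * vals`_(u.2).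
Proof.
move=> FN Fn; elim: ts => [|t ts [prog [out [sp H]]]].
  by exists [::], (fun=> 0%N).
have [|dp [sd Hd]] := @slp_dot_product (N + size prog) (F t).
  by move=> u /FN[u1 u2]; split; rewrite ltn_addr.
exists (prog ++ dp), (fun t' => if t' == t then N + size prog + 2 * n else out t')%N.
split; first by rewrite size_cat sp sd Fn/=; lia.
move=> t'; rewrite inE; case: eqVneq => [-> _|tt' /= t's].
  split; first by rewrite size_cat sd Fn; lia.
  move=> vals vN; rewrite foldl_cat -(Fn t) Hd ?size_run ?vN//.
  by apply: eq_big_seq => u /FN[u1 u2]; rewrite !nth_run// vN.
have [lt_out Hout] := H t' t's; split; first by rewrite size_cat; lia.
by move=> vals vN; rewrite foldl_cat nth_run ?size_run ?vN// Hout.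
Qed.

Lemma size_mx_entries n (A : 'M[R]_n) : size (mx_entries A) = (n * n)%N.
Proof. by rewrite size_codom card_prod card_ord. Qed.

Lemma nth_mx_entries n (A : 'M[R]_n) (ij : 'I_n * 'I_n) :
  (mx_entries A)`_(enum_rank ij) = A ij.1 ij.2.
Proof.
rewrite /mx_entries codomE (nth_map ij) ?nth_enum_rank//.
by rewrite -cardE ltn_ord.
Qed.

(** Schoolbook multiplication makes 3 an admissible exponent, so that [omega] is not the infimum of
    an empty set. *)
Lemma mulmx_cubic n : exists2 prog : seq (slp_instr R),
  computes_mulmx n prog & size prog = (n * n * (1 + 2 * n))%N.
Proof.
pose F (ij : 'I_n * 'I_n) := [seq (val (enum_rank (ij.1, l)), (n * n + enum_rank (l, ij.2))%N)
                             | l <- enum 'I_n].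
have rk (ij : 'I_n * 'I_n) : (enum_rank ij < n * n)%N.
  by rewrite -[X in (X * X)%N]card_ord -card_prod ltn_ord.
have [||prog [out [sp H]]] := @slp_dot_products _ (n * n + n * n) n (enum {: 'I_n * 'I_n}) F.
- move=> t u /mapP[l _ ->] /=.
  by split; [exact: ltn_addr|rewrite ltn_add2l].
- by move=> t; rewrite size_map size_enum_ord.
exists prog; last by rewrite sp -cardE card_prod card_ord.
exists (fun i j => out (i, j)) => A B i j.
have [|_ ->] := H (i, j); first by rewrite mem_enum.
  rewrite big_map big_enum/= mxE; apply: eq_bigr => l _.
  rewrite !nth_cat !size_mx_entries rk ifF ?addKn; last by rewrite ltnNge leq_addr.
  by rewrite !nth_mx_entries.
by rewrite size_cat !size_mx_entries.
Qed.

(* The outputs are pairwise distinct and none of them is an input. *)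
Lemma computes_mulmx_size n (prog : seq (slp_instr R)) : (0 < n)%N ->
  computes_mulmx n prog -> (n * n <= size prog)%N.
Proof.
move=> n0 [out H].
have size_in (A B : 'M[R]_n) : size (mx_entries A ++ mx_entries B) = (n * n + n * n)%N.
  by rewrite size_cat !size_mx_entries.
have cst a i : (i < n * n)%N -> (mx_entries (const_mx a : 'M[R]_n))`_i = a.
  rewrite -[X in (X * X)%N]card_ord -card_prod => ilt.
  by rewrite -[i]/(val (Ordinal ilt)) -[Ordinal ilt]enum_valK nth_mx_entries mxE.
have out_ge i j : (n * n + n * n <= out i j)%N.
  rewrite leqNgt; apply/negP => lt; have [lt1|le1] := ltnP (out i j) (n * n).
    have := H (const_mx 1) 0 i j; rewrite nth_run ?size_in// nth_cat size_mx_entries lt1.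
    by rewrite mulmx0 mxE cst// => /eqP; rewrite oner_eq0.
  have := H 0 (const_mx 1) i j; rewrite nth_run ?size_in// nth_cat size_mx_entries.
  rewrite ltnNge le1/= mul0mx mxE cst; last by lia.
  by move/eqP; rewrite oner_eq0.
(* A position past the end reads the default 0, while the product of two all-ones matrices has the
   entry n > 0. *)
have out_lt i j : (out i j < n * n + n * n + size prog)%N.
  rewrite ltnNge; apply/negP => le.
  have := H (const_mx 1) (const_mx 1) i j.
  rewrite nth_default ?size_run ?size_in// mxE (eq_bigr (fun=> 1)); last first.
    by move=> l _; rewrite !mxE mulr1.
  by rewrite sumr_const card_ord => /esym/eqP; rewrite pnatr_eq0; lia.
(* For an elementary matrix times the identity, the product is nonzero at (i, j) only. *)
have out_inj : injective (fun ij : 'I_n * 'I_n => out ij.1 ij.2).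
  move=> [i j] [i' j'] /= oE.
  have := H (delta_mx i j) 1%:M i j; rewrite oE H mulmx1 !mxE !eqxx/=.
  by case: (i' =P i) => [->|_]; case: (j' =P j) => [->|_] //= /eqP; rewrite eq_sym oner_eq0.
pose o (ij : 'I_n * 'I_n) := (out ij.1 ij.2 - (n * n + n * n))%N.
have o_inj : injective o.
  move=> u w uw; apply: out_inj; move: uw; rewrite /o.
  by have := out_ge u.1 u.2; have := out_ge w.1 w.2; lia.
rewrite -[X in (X * X)%N](card_ord n) -card_prod cardE -(size_map o) -(size_iota 0 (size prog)).
apply: uniq_leq_size; first by rewrite map_inj_uniq ?enum_uniq.
move=> _ /mapP[u _ ->]; rewrite mem_iota /o/=.
by rewrite add0n -(ltn_add2l (n * n + n * n)) subnKC ?out_ge ?out_lt.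
Qed.

(** An exponent t < 2 would bound n^(2-t) by a constant for all n, since a program has at least n^2
    instructions. *)
Lemma omega_ge2 : 2 <= omega R.
Proof.
apply: lb_le_inf.
  exists 3, 3 => n n0; have [prog cp sp] := mulmx_cubic n; exists prog => //.
  rewrite sp powR_mulrn ?ler0n// -natrX -natrM ler_nat.
  rewrite !expnS expn0; nia.
move=> t [C HC]; rewrite leNgt; apply/negP => t2.
have HC' n : (0 < n)%N -> n%:R `^ (2 - t) <= C.
  move=> n0; have [prog cp sp] := HC n n0; have := computes_mulmx_size n0 cp.
  have nR0 : 0 < n%:R :> R by rewrite ltr0n.
  rewrite -(ler_nat R) => /le_trans /(_ sp) H.
  rewrite powRB ?(gt_eqF nR0) ?implybT// ler_pdivrMr ?powR_gt0//.
  by rewrite powR_mulrn ?ler0n// expr2 -natrM.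
have d0 : 0 < 2 - t by rewrite subr_gt0.
have C1 : 1 <= C by have := HC' 1%N isT; rewrite powR1.
have := HC' (Num.truncn (C `^ (2 - t)^-1)).+1 isT; apply/negP; rewrite -ltNge.
rewrite -[ltLHS](@powRVK _ (2 - t)) ?gt_eqF//; last by lra.
rewrite gt0_ltr_powR ?nnegrE ?powR_ge0//.
exact: truncnS_gt.
Qed.

End MatrixMultiplication.

(** As [omega] >= 2, the term (m+1)^2 m <= 4 m^3 is dominated by m^(1 + omega). *)
Theorem time_le (R : realType) (C4 : R) : 0 < C4 -> exists2 C5 : R, 0 < C5 &
  forall T : nat -> nat -> nat, sampling_time T ->
    (forall m n : nat, (0 < m)%N -> (0 < n)%N ->
       (T m n)%:R <= C4 * (n%:R `^ (1 + omega R) + n%:R ^+ 2 * m%:R)) ->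
  forall m : nat, (0 < m)%N ->
    log2sq R m * (T m m.+1)%:R <= C5 * (m%:R `^ (1 + omega R) * log2sq R m).
Proof.
move=> C40; have w2 := omega_ge2 R; set w := 1 + omega R.
exists (C4 * (2 `^ w + 4)); first by rewrite mulr_gt0// addr_gt0 ?powR_gt0.
move=> T _ HT m m0; rewrite [leLHS]mulrC mulrA ler_wpM2r ?sqr_ge0//.
apply: le_trans (HT m m.+1 m0 isT) _; rewrite -mulrA ler_pM2l// -/w mulrDl.
have mR1 : 1 <= m%:R :> R by rewrite ler1n.
have m2 : m.+1%:R <= 2 * m%:R :> R by rewrite -natr1; lra.
apply: lerD.
  by rewrite -powRM ?ler0n// ler_powR2r//; rewrite /w; lra.
apply: (@le_trans _ _ ((2 * m%:R) ^+ 2 * m%:R)).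
  by rewrite ler_wpM2r// lerXn2r ?nnegrE ?mulr_ge0.
rewrite exprMn -mulrA -exprSr (_ : 2 ^+ 2 = 4 :> R); last by ring.
rewrite ler_pM2l// -powR_mulrn ?ler0n// ler_powR// /w; lra.
Qed.

(** * One Lovett-Meka sample *)

Section IntegralLowerBound.
Context d (T : measurableType d) (R : realType).

(** The integral of any nonnegative function is a supremum over the simple functions below it, which
    is monotone in the integrand. *)
Lemma le_integral_pointwise (mu : measure T R) (f g : T -> \bar R) :
  (forall x, 0 <= f x)%E -> (forall x, f x <= g x)%E ->
  (\int[mu]_x f x <= \int[mu]_x g x)%E.
Proof.
move=> f0 fg; have g0 x : (0 <= g x)%E := le_trans (f0 x) (fg x).
rewrite !ge0_integralTE//; apply: ereal_sup_le => _ [h /= hf <-].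
by exists h => // x; exact: le_trans (hf x) (fg x).
Qed.

Lemma integral_ge_sub (P : probability T R) (f : T -> \bar R) (g : T -> R) (u c : R) :
    (forall x, 0 <= f x)%E -> measurable_fun setT g -> (forall x, 0 <= g x) ->
    (\int[P]_x (g x)%:E <= c%:E)%E ->
    {ae P, forall x, ((u - g x)%:E <= f x)%E} ->
  ((u - c)%:E <= \int[P]_x f x)%E.
Proof.
move=> f0 mg g0 gc [N [mN PN subN]].
have [u0|u0] := ltP u 0.
  apply: le_trans (integral_ge0 _ _) => //; rewrite lee_fin.
  have : 0 <= c.
    rewrite -lee_fin; apply: le_trans gc; apply: integral_ge0 => x _.
    by rewrite lee_fin.
  lra.
pose G x := Num.max 0 (u - g x).
have G0 x : 0 <= G x by rewrite le_max lexx.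
have mG : measurable_fun setT G.
  by apply: measurable_maxr => //; apply: measurable_funB.
have mGE : measurable_fun setT (EFin \o G) by exact/measurable_EFinP.
have mgE : measurable_fun setT (EFin \o g) by exact/measurable_EFinP.
have intG : (\int[P]_x (G x)%:E <= \int[P]_x f x)%E.
  rewrite (@ge0_negligible_integral _ _ _ P setT N)//; last by move=> x _; rewrite lee_fin.
  rewrite setTD integral_mkcond; apply: le_integral_pointwise => x; rewrite /patch.
    by case: ifP => // _; rewrite lee_fin.
  case: ifPn => // /set_mem /= xN.
  have : ((u - g x)%:E <= f x)%E by apply: contrapT => h; apply/xN/subN.
  rewrite /G; case: (leP 0 (u - g x)) => // _ _; exact: f0.
apply: le_trans intG.
have : (u%:E <= \int[P]_x ((G x)%:E + (g x)%:E))%E.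
  have -> : u%:E = (\int[P]_x (cst u%:E x))%E by rewrite integral_cst// [X in (_ * X)%E](probability_setT P) mule1.
  apply: le_integral_pointwise => x /=; first by rewrite lee_fin.
  rewrite -EFinD lee_fin.
  have : u - g x <= G x by rewrite le_max lexx orbT.
  lra.
rewrite ge0_integralD//; last 2 first.
- by move=> x _; rewrite lee_fin.
- by move=> x _; rewrite lee_fin.
move=> uG; rewrite EFinB leeBlDr//; apply: le_trans uG _.
by rewrite leeD2l.
Qed.

End IntegralLowerBound.

Section LovettMekaStep.
Variables (R : realType) (C1 C2 C3 : R).
Hypotheses (C1_gt0 : 0 < C1) (C2_gt0 : 0 < C2) (C3_gt0 : 0 < C3).

Lemma powRV (x s : R) : 0 <= x -> x^-1 `^ s = (x `^ s)^-1.
Proof. by move=> x0; rewrite -powR_inv1// -powRrM mulN1r powRN. Qed.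

Lemma expRN_le_powR (a u : R) : 0 < a -> 0 < u -> expR (- u) <= (a / u) `^ a.
Proof.
move=> a0 u0; rewrite powRM ?invr_ge0 ?(ltW a0) ?(ltW u0)//.
rewrite powRV ?(ltW u0)// ler_pdivlMr ?powR_gt0//.
rewrite expRN mulrC ler_pdivrMr ?expR_gt0//.
by have := powR_le_expR a0 (ltW u0).
Qed.

(** [powR_le_expR] with exponent r/2 is applied to (Y/s)^2 and integrated. *)
Lemma psi2norm_moment d (T : measurableType d) (P : probability T R) (Y : T -> R) (b r : R) :
    measurable_fun setT Y -> 0 < b -> 0 < r ->
    (psi2norm P Y <= (C3 * b)%:E)%E ->
  (\int[P]_x (`|Y x| `^ r)%:E <= (2 * (2 * C3 * b * Num.sqrt r) `^ r)%:E)%E.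
Proof.
move=> mY b0 r0 Yb.
have Cb0 : 0 < C3 * b by exact: mulr_gt0.
(* The infimum defining the norm may not be attained; doubling the bound yields an admissible s. *)
have /ereal_inf_lt[_ [s [s0 Es] <-]] : (psi2norm P Y < (2 * (C3 * b))%:E)%E.
  by apply: le_lt_trans Yb _; rewrite lte_fin; lra.
rewrite lte_fin => sb; rewrite unlock in Es.
pose c := (s * Num.sqrt r) `^ r.
have c0 : 0 <= c := powR_ge0 _ _.
apply: (@le_trans _ _ (\int[P]_x (c%:E * (expR ((Y x / s) ^+ 2)%R)%:E))%E).
  apply: le_integral_pointwise => x; first by rewrite lee_fin powR_ge0.
  rewrite -EFinM lee_fin.
  have r20 : 0 < r / 2 by rewrite divr_gt0.
  have := powR_le_expR r20 (sqr_ge0 (Y x / s)).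
  have -> : ((Y x / s) ^+ 2) `^ (r / 2) = (`|Y x| / s) `^ r.
    rewrite -real_normK ?num_real// normrM normfV (gtr0_norm s0) -powR_mulrn ?divr_ge0 ?(ltW s0)//.
    by rewrite -powRrM; congr powR; field.
  move=> H.
  have -> : `|Y x| `^ r = s `^ r * (`|Y x| / s) `^ r.
    by rewrite -powRM ?divr_ge0 ?(ltW s0)// mulrC divfK// gt_eqF.
  apply: le_trans (ler_wpM2l (powR_ge0 s r) H) _.
  have -> : c = s `^ r * Num.sqrt r `^ r by rewrite /c powRM ?sqrtr_ge0 ?(ltW s0).
  rewrite mulrA ler_wpM2r ?expR_ge0//.
  rewrite ler_wpM2l ?powR_ge0//.
  apply: (@le_trans _ _ (r `^ (r / 2))); first by apply: ler_powR2r; lra.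
  rewrite -[X in X `^ _]sqr_sqrtr ?(ltW r0)// -powR_mulrn ?sqrtr_ge0// -powRrM.
  by rewrite le_eqVlt; apply/orP; left; apply/eqP; congr powR; field.
have mE : measurable_fun setT (EFin \o (fun x => expR ((Y x / s) ^+ 2))).
  apply/measurable_EFinP; apply: (measurableT_comp (@measurable_expR R)).
  apply: (@measurable_funX _ _ _ _ (fun x => Y x / s)).
  by apply: measurable_funM => //; exact: measurable_cst.
rewrite (ge0_integralZl_EFin P measurableT _ mE c0); last first.
  by move=> x _; rewrite lee_fin expR_ge0.
apply: le_trans (lee_wpmul2l _ Es) _; first by rewrite lee_fin.
rewrite -EFinM lee_fin mulrC ler_pM2l//.
apply: ler_powR2r; rewrite ?mulr_ge0 ?sqrtr_ge0 ?(ltW r0) ?(ltW s0)//.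
by rewrite ler_wpM2r ?sqrtr_ge0//; lra.
Qed.

(** With b the squared norm of a row, e^(-u) <= (a/u)^a at a = r/2 and u = C1 W^2 / b turns the
    budget into the sum of [sum_row_moments_threshold] for the parameter C1^(-1/2), up to a factor
    (1/2)^(r/2) <= 1. *)
Lemma row_budget_threshold m p h (A : 'M[R]_(m, h)) (c : R) : (0 < m)%N ->
    (2%:E <= p)%E -> 0 < c -> (0 < h)%N -> (forall j, lpnorm p (col j A) <= 2) ->
    2 * expR 1 * (Num.sqrt (C1 ^-1)) <= c ->
    (2 * expR 1 * Num.sqrt (C1 ^-1) / c) ^+ 2 <= C2 ->
  row_budget C1 C2 A (colouring_threshold m p c h).
Proof.
move=> m0 p2 c0 h0 A2 c1 c2; rewrite /row_budget.
have s0 : 0 < Num.sqrt C1^-1 by rewrite sqrtr_gt0 invr_gt0.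
have := sum_row_moments_threshold m0 p2 c0 h0 A2 s0 c1.
set W := colouring_threshold m p c h; have W0 : 0 < W by exact: colouring_threshold_gt0.
clearbody W; set r := moment_order m p h%:R => H.
have r2 : 2 <= r := moment_order_ge2 m _ p2.
have r0 : 0 < r by lra.
apply: (@le_trans _ _ (C2 * h%:R)); last by [].
apply: le_trans (le_trans H _); last by rewrite ler_wpM2r.
rewrite big_mkcond/=; apply: ler_sum => i _.
have colE : \sum_j col j A i ord0 ^+ 2 = \sum_j A i j ^+ 2.
  by apply: eq_bigr => j _; rewrite mxE.
rewrite colE; case: ifPn => [Ai|_]; last by rewrite !mulr_ge0 ?invr_ge0 ?powR_ge0.
set b := \sum_j _.
have b0 : 0 < b.
  rewrite lt0r sumr_ge0 ?andbT; last by move=> j _; exact: sqr_ge0.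
  apply: contra Ai => /eqP b0; apply/eqP/rowP => j; rewrite !mxE.
  have /(_ j isT)/eqP := psumr_eq0P (fun j _ => sqr_ge0 (A i j)) b0.
  by rewrite sqrf_eq0 => /eqP.
have u0 : 0 < C1 * W ^+ 2 / b by apply: divr_gt0 => //; apply: mulr_gt0 => //; exact: exprn_gt0.
have r20 : 0 < r / 2 by rewrite divr_gt0.
apply: le_trans (expRN_le_powR r20 u0) _.
have pow2 x : 0 <= x -> x `^ r = (x ^+ 2) `^ (r / 2).
  by move=> x0; rewrite -powR_mulrn// -powRrM; congr powR; field.
rewrite (pow2 W (ltW W0)) pow2; last by rewrite mulr_ge0 ?sqrtr_ge0.
rewrite -powRV ?sqr_ge0// -powRM ?sqr_ge0 ?(ltW b0)//.
rewrite -powRM ?invr_ge0 ?sqr_ge0 ?mulr_ge0 ?sqr_ge0 ?(ltW b0)//.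
 apply: ler_powR2r; [exact: ltW|by rewrite mulr_ge0 ?(ltW r20) ?invr_ge0 ?(ltW u0)|].
have -> : (Num.sqrt C1^-1 * Num.sqrt r) ^+ 2 = C1^-1 * r.
  by rewrite exprMn !sqr_sqrtr ?invr_ge0 ?ltW.
have -> : r / 2 / (C1 * W ^+ 2 / b) = C1^-1 * r * b / W ^+ 2 / 2.
  by field; rewrite !gt_eqF.
have : 0 <= C1^-1 * r * b / W ^+ 2.
  by rewrite !mulr_ge0 ?invr_ge0 ?sqr_ge0 ?(ltW C1_gt0) ?(ltW r0) ?(ltW b0).
lra.
Qed.

Section Step.
Variables (D : sampler R) (m h : nat) (p q : \bar R) (A : 'M[R]_(m, h)) (x0 : h.-tuple R).
Hypothesis lmD : lovett_meka C1 C2 C3 D.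
Hypotheses (m_gt0 : (0 < m)%N) (h_gt0 : (0 < h)%N).
Hypotheses (p_ge2 : (2%:E <= p)%E) (le_pq : (p <= q)%E).
Hypothesis A2 : forall j, lpnorm p (col j A) <= 2.
Hypothesis x0_cube : in_cube x0.
Let P := D A x0.
Let r := moment_order m p h%:R.
Let Y i (x : h.-tuple R) := \sum_j A i j * (tnth x j - tnth x0 j).

Lemma measurable_row_deviation i : measurable_fun setT (Y i).
Proof.
apply: measurable_sum => j; apply: measurable_funM; first exact: measurable_cst.
by apply: measurable_funB; [exact: measurable_tnth|exact: measurable_cst].
Qed.

Lemma row_deviation_moment i :
  (\int[P]_x (`|Y i x| `^ r)%:E
   <= (2 * ((2 * C3 * Num.sqrt r) `^ r * (\sum_j A i j ^+ 2) `^ (r / 2)))%:E)%E.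
Proof.
have r2 : 2 <= r := moment_order_ge2 m _ p_ge2.
have r0 : 0 < r by lra.
have [_ _ _ _ /(_ (fun j => A i j))] := lmD A m_gt0 h_gt0 x0_cube.
set b := \sum_j _; have : 0 <= b by rewrite sumr_ge0// => j _; exact: sqr_ge0.
rewrite le_eqVlt => /predU1P[b0 _|b0].
  have Y0 x : Y i x = 0.
    rewrite /Y big1// => j _.
    have /(_ j isT)/eqP := psumr_eq0P (fun j _ => sqr_ge0 (A i j)) (esym b0).
    by rewrite sqrf_eq0 => /eqP ->; rewrite mul0r.
  rewrite (eq_integral (cst 0%:E)); last by move=> x _; rewrite Y0 normr0 powR0 ?gt_eqF.
  by rewrite integral_cst// mul0e lee_fin !mulr_ge0 ?powR_ge0.
have sb0 : 0 < Num.sqrt b by rewrite sqrtr_gt0.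
move=> /(psi2norm_moment (measurable_row_deviation i) sb0 r0) /le_trans; apply.
rewrite lee_fin ler_pM2l// [_ * Num.sqrt b * _]mulrAC [leLHS]powRM ?sqrtr_ge0//; last first.
  by rewrite !mulr_ge0 ?sqrtr_ge0 ?(ltW C3_gt0).
rewrite -[X in X `^ (r / 2)](sqr_sqrtr (ltW b0)) -powR_mulrn ?sqrtr_ge0// -powRrM.
by have -> : 2 * (r / 2) = r by field.
Qed.

Variable c : R.
Hypotheses (c_budget : 2 * expR 1 * Num.sqrt (C1^-1) <= c)
  (c_budget2 : (2 * expR 1 * Num.sqrt (C1^-1) / c) ^+ 2 <= C2)
  (c_moment : 4 * expR 1 * (2 * C3) <= c).
Let W := colouring_threshold m p c h.

Let a2_gt0 : 0 < 2 * C3. Proof. exact: mulr_gt0. Qed.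
Let c_gt0 : 0 < c.
Proof. by apply: lt_le_trans c_moment; rewrite !mulr_gt0 ?expR_gt0. Qed.
Let W_gt0 : 0 < W. Proof. exact: colouring_threshold_gt0. Qed.

Lemma sum_row_deviation_moment :
  \sum_i 2 * ((2 * C3 * Num.sqrt r) `^ r * (\sum_j A i j ^+ 2) `^ (r / 2)) / W `^ r
  <= h%:R.
Proof.
have c1 : 2 * expR 1 * (2 * C3) <= c.
  by have := mulr_gt0 (expR_gt0 1) a2_gt0; have := c_moment; lra.
have := sum_row_moments_threshold m_gt0 p_ge2 c_gt0 h_gt0 A2 a2_gt0 c1.
rewrite -/r -/W /=.
under eq_bigr do under eq_bigr do rewrite mxE.
move=> H; under eq_bigr do rewrite -mulrA.
rewrite -mulr_sumr; apply: le_trans (ler_wpM2l _ H) _ => //.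
rewrite [2 * (_ * h%:R)]mulrA -[leRHS]mul1r ler_wpM2r//.
have : 2 * expR 1 * (2 * C3) / c <= 2^-1.
  rewrite ler_pdivrMr//; have := c_moment; lra.
have : 0 <= 2 * expR 1 * (2 * C3) / c.
  by rewrite !mulr_ge0 ?invr_ge0 ?expR_ge0 ?(ltW c_gt0) ?(ltW C3_gt0).
set t := _ / c; nra.
Qed.

(** The right-hand side of [lpnorm_interp]. It is measurable in x, and dominates the l_q norm
    wherever all deviations are at most W, hence almost surely. *)
Definition deviation_bound (x : h.-tuple R) : R :=
  W * h%:R `^ (fine q^-1%E) * (1 + h%:R^-1 * \sum_i (`|Y i x| / W) `^ r).

Lemma deviation_bound_ge0 x : 0 <= deviation_bound x.
Proof.
apply: mulr_ge0; first by rewrite mulr_ge0 ?powR_ge0 ?(ltW W_gt0).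
by rewrite addr_ge0// mulr_ge0 ?invr_ge0// sumr_ge0// => i _; exact: powR_ge0.
Qed.

Lemma measurable_deviation_power i :
  measurable_fun setT (fun x => (`|Y i x| / W) `^ r).
Proof.
apply: (measurableT_comp (@measurable_powR R r)).
apply: measurable_funM; last exact: measurable_cst.
exact: (measurableT_comp (@normr_measurable R setT) (measurable_row_deviation i)).
Qed.

Lemma measurable_deviation_bound : measurable_fun setT deviation_bound.
Proof.
apply: measurable_funM; first exact: measurable_cst.
apply: measurable_funD; first exact: measurable_cst.
apply: measurable_funM; first exact: measurable_cst.
by apply: measurable_sum => i; exact: measurable_deviation_power.
Qed.

Lemma integral_deviation_bound :
  (\int[P]_x (deviation_bound x)%:E
   <= (2 * c * (Num.sqrt r * h%:R `^ rate_exponent p q))%:E)%E.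
Proof.
have hR0 : 0 < h%:R :> R by rewrite ltr0n.
set B := W * h%:R `^ (fine q^-1%E).
have BE : 2 * c * (Num.sqrt r * h%:R `^ rate_exponent p q) = B + B.
  by rewrite /B /W threshold_rate// -/r; ring.
have B0 : 0 <= B by rewrite mulr_ge0 ?powR_ge0 ?(ltW W_gt0).
have mp i : measurable_fun setT (EFin \o (fun x => (`|Y i x| / W) `^ r)).
  by apply/measurable_EFinP; exact: measurable_deviation_power.
have mS : measurable_fun setT (fun x => \sum_i ((`|Y i x| / W) `^ r)%:E)%E.
  exact: (@emeasurable_sum _ _ _ setT _ _ (fun i x => ((`|Y i x| / W) `^ r)%:E) mp).
have p0 i x : (0 <= ((`|Y i x| / W) `^ r)%:E)%E by rewrite lee_fin powR_ge0.
have Bh0 : 0 <= B * h%:R^-1 by rewrite mulr_ge0 ?invr_ge0.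
rewrite (eq_integral (fun x => B%:E + (B * h%:R^-1)%:E *
    \sum_i ((`|Y i x| / W) `^ r)%:E)%E); last first.
  move=> x _; rewrite /deviation_bound -/B sumEFin -EFinM -EFinD.
  by congr (_%:E); rewrite mulrDr mulr1 mulrA.
rewrite ge0_integralD//; first last.
- apply: emeasurable_funM; first exact: measurable_cst.
  exact: mS.
- by move=> x _; rewrite mule_ge0 ?lee_fin// sume_ge0.
rewrite integral_cst// [X in (_ * X)%E](probability_setT P) mule1.
rewrite (ge0_integralZl_EFin P measurableT _ mS Bh0); last by move=> x _; exact: sume_ge0.
rewrite (ge0_integral_sum P measurableT mp (fun i x _ => p0 i x)) BE EFinD leeD2l//.
have H i : (\int[P]_x ((`|Y i x| / W) `^ r)%:E <=
    (2 * ((2 * C3 * Num.sqrt r) `^ r * (\sum_j A i j ^+ 2) `^ (r / 2)) / W `^ r)%:E)%E.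
  have WE x : (`|Y i x| / W) `^ r = (W `^ r)^-1 * `|Y i x| `^ r.
    by rewrite powRM ?invr_ge0 ?(ltW W_gt0)// powRV ?(ltW W_gt0)// mulrC.
  under eq_integral do rewrite WE EFinM.
  have mY : measurable_fun setT (EFin \o (fun x => `|Y i x| `^ r)).
    apply/measurable_EFinP; apply: (measurableT_comp (@measurable_powR R r)).
    exact: (measurableT_comp (@normr_measurable R setT) (measurable_row_deviation i)).
  have Wi0 : 0 <= (W `^ r)^-1 by rewrite invr_ge0 powR_ge0.
  rewrite (ge0_integralZl_EFin P measurableT _ mY Wi0); last first.
    by move=> x _; rewrite lee_fin powR_ge0.
  apply: le_trans (lee_wpmul2l _ (row_deviation_moment i)) _.
    by rewrite lee_fin invr_ge0 powR_ge0.
  by rewrite -EFinM mulrC.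
apply: le_trans (lee_wpmul2l _ (lee_sum _ (fun i _ => H i))) _; first by rewrite lee_fin.
rewrite sumEFin -EFinM lee_fin -[leLHS]mulrA ler_piMr//.
by rewrite mulrC ler_pdivrMr// mul1r sum_row_deviation_moment.
Qed.

Lemma ae_deviation_bound : {ae P, forall x, [/\ in_cube x,
  (h <= 2 * #|[pred j | (`|tnth x j| == 1)%R]|)%N &
  lpnorm q (\sum_j (tnth x j - tnth x0 j) *: col j A) <= deviation_bound x]}.
Proof.
have [cubeP halfP /(_ W (ltW W_gt0)) H _ _] := lmD A m_gt0 h_gt0 x0_cube.
have {}H := H (row_budget_threshold m_gt0 p_ge2 c_gt0 h_gt0 A2 c_budget c_budget2).
apply: filterS (filterI cubeP (filterI halfP H)) => x [? [? YW]]; split=> //.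
have r2 : 2 <= r := moment_order_ge2 m _ p_ge2.
have r1 : 1 <= r by lra.
have rq : (r%:E <= q)%E by apply: le_trans le_pq; exact: moment_order_le.
set y := \sum_j _; have yE i : y i ord0 = Y i x.
  by rewrite /y summxE; apply: eq_bigr => j _; rewrite !mxE mulrC.
have yW i : `|y i ord0| <= W by rewrite yE; exact: YW.
apply: le_trans (lpnorm_interp r1 rq h_gt0 W_gt0 yW) _.
by rewrite /deviation_bound; under eq_bigr do rewrite yE.
Qed.

End Step.

Lemma lovett_meka_step : exists2 K : R, 0 < K &
  forall (D : sampler R), lovett_meka C1 C2 C3 D ->
  forall m h (p q : \bar R) (A : 'M[R]_(m, h)) (x0 : h.-tuple R),
    (0 < m)%N -> (0 < h)%N -> (2%:E <= p)%E -> (p <= q)%E ->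
    (forall j, lpnorm p (col j A) <= 2) -> in_cube x0 ->
  exists g : h.-tuple R -> R, [/\ measurable_fun setT g, forall x, 0 <= g x,
    (\int[D m h A x0]_x (g x)%:E
       <= (K * (Num.sqrt (moment_order m p h%:R) * h%:R `^ rate_exponent p q))%:E)%E &
    {ae D m h A x0, forall x, [/\ in_cube x,
      (h <= 2 * #|[pred j | (`|tnth x j| == 1)%R]|)%N &
      lpnorm q (\sum_j (tnth x j - tnth x0 j) *: col j A) <= g x]}].
Proof.
(* [c] has one summand per requirement: [a] and a / sqrt C2 for the budget of property B, the last
   one for the moments. *)
pose a := 2 * expR 1 * Num.sqrt C1^-1; pose c := a + a / Num.sqrt C2 + 4 * expR 1 * (2 * C3).
have a0 : 0 < a by rewrite !mulr_gt0 ?expR_gt0 ?sqrtr_gt0 ?invr_gt0.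
have s0 : 0 < Num.sqrt C2 by rewrite sqrtr_gt0.
have aC0 : 0 < a / Num.sqrt C2 by exact: divr_gt0.
have m0 : 0 < 4 * expR 1 * (2 * C3) by rewrite !mulr_gt0 ?expR_gt0.
have c0 : 0 < c by rewrite /c; lra.
have c1 : a <= c by rewrite /c; lra.
have c2 : (a / c) ^+ 2 <= C2.
  rewrite -[leRHS]sqr_sqrtr ?(ltW C2_gt0)// lerXn2r ?nnegrE ?divr_ge0 ?(ltW a0) ?(ltW c0) ?(ltW s0)//.
  by rewrite ler_pdivrMr// mulrC -ler_pdivrMr// /c; lra.
have c3 : 4 * expR 1 * (2 * C3) <= c by rewrite /c; lra.
exists (2 * c); first by rewrite mulr_gt0.
move=> D lmD m h p q A x0 m_gt0 h0 p2 pq A2 x0c.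
exists (deviation_bound p q A x0 c); split.
- exact: measurable_deviation_bound.
- by move=> x; exact: deviation_bound_ge0.
- exact: integral_deviation_bound.
- exact: ae_deviation_bound.
Qed.

End LovettMekaStep.

(** * Executions of programs *)

Section ProgramLogic.
Variables (R : realType) (D : sampler R) (T : nat -> nat -> nat).
Implicit Types (s : state R) (K : seq cmd) (post : state R -> Prop).

Lemma success_ge0 fuel b K s post : (0 <= success D T fuel b K s post)%E.
Proof.
elim: fuel b K s => [|f IH] b [|c K] s //=; rewrite ?lee_fin ?ler0n//.
case: ifP => // _; case: c => //= *; case: ifP => // _.
by apply: integral_ge0 => y _; exact: IH.
Qed.

(* Without sampling, [K] leads from [s] to [s'] in [t] steps. *)
Definition runs K s t s' := forall fuel b K' post,
  success D T (t + fuel) (t + b) (K ++ K') s post = success D T fuel b K' s' post.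

Definition terminates K c s (Q : state R -> Prop) :=
  exists t s', [/\ (t <= c)%N, runs K s t s' & Q s'].

Lemma terminates_nil s (Q : state R -> Prop) : Q s -> terminates [::] 0 s Q.
Proof. by exists 0%N, s. Qed.

Lemma terminates_weaken K c c' s (Q Q' : state R -> Prop) : (c <= c')%N ->
  (forall s, Q s -> Q' s) -> terminates K c s Q -> terminates K c' s Q'.
Proof.
move=> cc QQ [t [s' [tc r q]]]; exists t, s'; split=> //; last exact: QQ.
exact: leq_trans cc.
Qed.

Lemma terminates_le c c' K s (Q : state R -> Prop) : (c <= c')%N ->
  terminates K c s Q -> terminates K c' s Q.
Proof. by move=> cc; apply: terminates_weaken. Qed.

Lemma terminates_cat K1 K2 c1 c2 s (Q : state R -> Prop) :
  terminates K1 c1 s (fun s' => terminates K2 c2 s' Q) ->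
  terminates (K1 ++ K2) (c1 + c2) s Q.
Proof.
move=> [t1 [s1 [tc1 r1 [t2 [s2 [tc2 r2 q]]]]]]; exists (t1 + t2)%N, s2.
split=> //; first exact: leq_add.
by move=> fuel b K' post; rewrite -catA -!addnA r1 r2.
Qed.

Lemma terminates_nstore a i e K c s (Q : state R -> Prop) :
  terminates K c (State (update (nmem s) a (neval s i) (neval s e)) (rmem s)) Q ->
  terminates (NStore a i e :: K) c.+1 s Q.
Proof.
move=> [t [s' [tc r q]]]; by exists t.+1, s'; split.
Qed.

Lemma terminates_rstore a i e K c s (Q : state R -> Prop) :
  terminates K c (State (nmem s) (update (rmem s) a (neval s i) (reval s e))) Q ->
  terminates (RStore a i e :: K) c.+1 s Q.
Proof.
move=> [t [s' [tc r q]]]; by exists t.+1, s'; split.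
Qed.

Lemma terminates_if t K1 K2 K c s (Q : state R -> Prop) :
  terminates ((if beval s t then K1 else K2) ++ K) c s Q ->
  terminates (If t K1 K2 :: K) c.+1 s Q.
Proof.
move=> [n [s' [tc r q]]]; exists n.+1, s'; split=> // fuel b K' post.
by rewrite -r -catA.
Qed.

Lemma terminates_while_false t K1 K c s (Q : state R -> Prop) :
  beval s t = false -> terminates K c s Q -> terminates (While t K1 :: K) c.+1 s Q.
Proof.
move=> tE [n [s' [tc r q]]]; exists n.+1, s'; split=> // fuel b K' post.
by rewrite -r /= tE.
Qed.

Lemma terminates_while_true t K1 K c s (Q : state R -> Prop) :
  beval s t -> terminates (K1 ++ While t K1 :: K) c s Q ->
  terminates (While t K1 :: K) c.+1 s Q.
Proof.
move=> tE [n [s' [tc r q]]]; exists n.+1, s'; split=> // fuel b K' post.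
by rewrite -r /= tE -catA.
Qed.

Lemma terminates_while N (I : nat -> state R -> Prop) t K1 c i s :
    (forall i s, I i s -> (i <= N)%N -> beval s t = (i < N)%N) ->
    (forall i s, (i < N)%N -> I i s -> terminates K1 c s (I i.+1)) ->
    (i <= N)%N -> I i s ->
  terminates [:: While t K1] ((N - i) * c.+1 + 1) s (I N).
Proof.
move=> It step; move E : (N - i)%N => n; elim: n i s E => [|n IH] i s E iN Is.
  have iE : i = N by apply/eqP; rewrite eqn_leq iN -subn_eq0 E eqxx.
  apply: terminates_while_false; first by rewrite (It i)// iE ltnn.
  by apply: terminates_nil; rewrite -iE.
have ltiN : (i < N)%N by rewrite -subn_gt0 E.
rewrite mulSn -addnA addSn; apply: terminates_while_true; first by rewrite (It i).
apply: terminates_cat; apply: terminates_weaken (step i s ltiN Is) => // s' Is'.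
by apply: IH Is' => //; rewrite subnS E.
Qed.

(** Quantifying over all larger budgets and fuels allows composition with code whose running time is
    only bounded, without monotonicity of [success]. *)
Definition lower_bound (B : nat) K s post (u : R) := forall fuel b,
  (B <= b)%N -> (b <= fuel)%N -> (u%:E <= success D T fuel b K s post)%E.

Lemma lower_bound_weaken B B' K s post u u' : (B <= B')%N -> u' <= u ->
  lower_bound B K s post u -> lower_bound B' K s post u'.
Proof.
move=> BB uu H fuel b Bb bf; apply: (@le_trans _ _ u%:E); first by rewrite lee_fin.
by apply: H => //; exact: leq_trans Bb.
Qed.

Lemma lower_bound_nil s post u : (0 < u -> post s) -> u <= 1 ->
  lower_bound 0 [::] s post u.
Proof.
move=> up u1 fuel b _ _.
have -> : success D T fuel b [::] s post = (`[< post s >]%:R)%:E by case: fuel.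
rewrite lee_fin; have [u0|u0] := ltP 0 u; first by rewrite (asboolT (up u0)).
exact: le_trans u0 (ler0n _ _).
Qed.

Lemma lower_bound_terminates K c s K' B post u :
  terminates K c s (fun s' => lower_bound B K' s' post u) ->
  lower_bound (c + B) (K ++ K') s post u.
Proof.
move=> [t [s' [tc r H]]] fuel b Bb bf.
have tb : (t <= b)%N by apply: leq_trans tc _; apply: leq_trans Bb; exact: leq_addr.
have tf : (t <= fuel)%N by exact: leq_trans bf.
rewrite -(subnKC tb) -(subnKC tf) r; apply: H; last exact: leq_sub2r.
rewrite -(leq_add2l t) subnKC//; apply: leq_trans Bb; by rewrite leq_add2r.
Qed.

Lemma lower_bound_while_true t K1 K s B post u : beval s t ->
  lower_bound B (K1 ++ While t K1 :: K) s post u ->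
  lower_bound B.+1 (While t K1 :: K) s post u.
Proof.
move=> tE H [|fuel] [|b]// Bb bf /=.
by rewrite tE; apply: H.
Qed.

Lemma lower_bound_while_false t K1 K s B post u : beval s t = false ->
  lower_bound B K s post u -> lower_bound B.+1 (While t K1 :: K) s post u.
Proof.
move=> tE H [|fuel] [|b]// Bb bf /=.
by rewrite tE; apply: H.
Qed.

(** A sample lowers the guaranteed probability by the mean of its loss [g]. The fuel drops by 1 and
    the budget by T m n, so T m n > 0 keeps the budget below the fuel. *)
Lemma lower_bound_sample m n d a x em en K s B post (g : n.-tuple R -> R) (u c : R) :
    neval s em = m -> neval s en = n ->
    let x0 := load_tuple s x n in let P := @D m n (load_mx s a m n) x0 in
    (0 < m)%N -> (0 < n)%N -> (0 < T m n)%N -> in_cube x0 ->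
    measurable_fun setT g -> (forall y, 0 <= g y) ->
    (\int[P]_y (g y)%:E <= c%:E)%E ->
    {ae P, forall y, lower_bound B K (store_tuple s d y) post (u - g y)} ->
  lower_bound (T m n + B) (Sample d a x em en :: K) s post (u - c).
Proof.
move=> mE nE; subst m n.
move=> x0 P m0 n0 T0 cube mg g0 gc ae [|fuel] b Bb bf.
  by move: bf Bb T0; rewrite leqn0 => /eqP->; rewrite leqn0 addn_eq0 => /andP[/eqP->].
have Tb : (T (neval s em) (neval s en) <= b)%N by apply: leq_trans Bb; exact: leq_addr.
have b0 : (0 < b)%N by exact: leq_trans Tb.
rewrite /= b0 -/x0 m0 n0 Tb cube /=.
apply: (integral_ge_sub (g := g)) => //.
  by move=> y; exact: success_ge0.
apply: filterS ae => y H; apply: H.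
  by rewrite -(leq_add2l (T (neval s em) (neval s en))) subnKC.
by rewrite leq_subLR (leq_trans bf)// -(addn1 fuel) addnC leq_add2r.
Qed.

End ProgramLogic.

(** * The program *)

Definition var a := NLoad a (NConst 0).
Definition assign a e := NStore a (NConst 0) e.
Definition lt_exp e1 e2 := BNot (BNLe e2 e1).
Definition for_upto a e body :=
  [:: assign a (NConst 0);
      While (lt_exp (var a) e) (body ++ [:: assign a (NAdd (var a) (NConst 1))])].
Definition half_exp e := NTrunc (RDiv (RNat e) (RNat (NConst 2))).
Definition odd_exp e := BNLe (NConst 1) (NSub e (NMul (NConst 2) (half_exp e))).

Definition in_rows := NLoad 0 (NConst 0).
Definition in_cols := NLoad 0 (NConst 1).
Definition in_target := NLoad 0 (NConst 2).

(* Natural arrays: 0 input, 1 multiplicities, 2 and 3 the two ends of the active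
   pairs, 4 remaining levels, 5 number of active pairs, 6 and 7 loop counters,
   8 write position, 9 flag of an unmatched odd entry, 10 power of two.
   Real arrays: 0 vectors, 1 coefficients, 3 matrix, 4 fractional colouring,
   5 cumulative sum. *)
Definition prog_scale :=
  [:: assign 10 (NConst 1); assign 4 (NConst 0);
      While (lt_exp (var 10) in_cols)
        [:: assign 10 (NMul (NConst 2) (var 10)); assign 4 (NAdd (var 4) (NConst 1))]].

Definition next_sum := RAdd (RLoad 5 (NConst 0))
  (RMul (RNat (NMul (var 10) in_target)) (RLoad 1 (var 6))).

Definition prog_round :=
  RStore 5 (NConst 0) (RNat (NConst 0)) ::
  for_upto 6 in_cols
    [:: NStore 1 (var 6) (NSub (NTrunc next_sum) (NTrunc (RLoad 5 (NConst 0))));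
        RStore 5 (NConst 0) next_sum].

(** The first end of a pair is written to slot [var 5] before the pair is counted; the counter moves
    when the second end arrives and the flag is cleared. *)
Definition prog_pair :=
  [:: assign 5 (NConst 0); assign 9 (NConst 0)] ++
  for_upto 6 in_cols
    [:: If (odd_exp (NLoad 1 (var 6)))
          [:: If (BNLe (var 9) (NConst 0))
                [:: NStore 2 (var 5) (var 6); RStore 4 (var 5) (RNat (NConst 0));
                    assign 9 (NConst 1)]
                [:: NStore 3 (var 5) (var 6); assign 5 (NAdd (var 5) (NConst 1));
                    assign 9 (NConst 0)]]
          [::]].

Definition vec_exp b := RLoad 0 (NAdd (NMul (var 7) in_cols) (NLoad b (var 6))).

Definition prog_matrix :=
  for_upto 7 in_rows
    (for_upto 6 (var 5)
       [:: RStore 3 (NAdd (NMul (var 7) (var 5)) (var 6)) (RSub (vec_exp 2) (vec_exp 3))]).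

Definition incr_mult b := NStore 1 (NLoad b (var 6)) (NAdd (NLoad 1 (NLoad b (var 6))) (NConst 1)).
Definition decr_mult b := NStore 1 (NLoad b (var 6)) (NSub (NLoad 1 (NLoad b (var 6))) (NConst 1)).

(** Colours lie in [-1, 1], so the two tests detect 1 and -1, the latter without a negative
    constant. Colour 1 moves a unit from the second end to the first, -1 the other way; undecided
    pairs are packed in place. *)
Definition prog_compact :=
  assign 8 (NConst 0) ::
  for_upto 6 (var 5)
    [:: If (BRLe (RNat (NConst 1)) (RLoad 4 (var 6)))
          [:: incr_mult 2; decr_mult 3]
          [:: If (BRLe (RAdd (RLoad 4 (var 6)) (RNat (NConst 1))) (RNat (NConst 0)))
                [:: incr_mult 3; decr_mult 2]
                [:: NStore 2 (var 8) (NLoad 2 (var 6)); NStore 3 (var 8) (NLoad 3 (var 6));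
                    RStore 4 (var 8) (RLoad 4 (var 6));
                    assign 8 (NAdd (var 8) (NConst 1))]]] ++
  [:: assign 5 (var 8)].

Definition prog_colour :=
  While (lt_exp (NConst 0) (var 5))
    (prog_matrix ++ Sample 4 3 4 in_rows (var 5) :: prog_compact).

Definition prog_halve :=
  for_upto 6 in_cols [:: NStore 1 (var 6) (half_exp (NLoad 1 (var 6)))] ++
  [:: assign 4 (NSub (var 4) (NConst 1))].

Definition prog_levels :=
  While (lt_exp (NConst 0) (var 4)) (prog_pair ++ prog_colour :: prog_halve).

Definition caratheodory_prog := prog_scale ++ prog_round ++ [:: prog_levels].

Section Segments.
Variables (R : realType) (D : sampler R) (T : nat -> nat -> nat).
Variables (m n k : nat) (V : nat -> R).
Implicit Types (s : state R).
Local Notation terminates := (terminates D T).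

(** An iteration pays 2 beyond its body, for the test and the increment; the final 2 is for the
    initial assignment and the failing test. *)
Lemma terminates_for a e N (I : nat -> state R -> Prop) body c s :
    (forall i s, I i s -> nmem s a 0%N = i /\ neval s e = N) ->
    (forall i s, (i < N)%N -> I i s -> terminates body c s (fun s' =>
       I i.+1 (State (update (nmem s') a 0%N (nmem s' a 0 + 1)%N) (rmem s')))) ->
    I 0%N (State (update (nmem s) a 0%N 0%N) (rmem s)) ->
  terminates (for_upto a e body) (N * c.+2 + 2) s (I N).
Proof.
move=> Ie step I0; rewrite addn2; apply: terminates_nstore.
rewrite -[(N * c.+2).+1]addn1 -[X in (X * c.+2)%N]subn0.
apply: (@terminates_while _ _ _ N I) => //.
  by move=> i s' Is iN /=; have [-> ->] := Ie i s' Is; rewrite -ltnNge.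
move=> i s' iN Is; rewrite -[c.+1]addn1; apply: terminates_cat.
apply: terminates_weaken (step i s' iN Is) => // s'' Is''.
by apply: terminates_nstore; apply: terminates_nil.
Qed.

Lemma truncn_half a : Num.truncn (a%:R / 2 : R) = a./2.
Proof.
apply: truncn_def; rewrite ler_pdivlMr// ltr_pdivrMr// -!natrM ler_nat ltr_nat.
by have := odd_double_half a; lia.
Qed.

Lemma neval_half s e : neval s (half_exp e) = (neval s e)./2.
Proof. by rewrite /half_exp /= truncn_half. Qed.

Lemma beval_odd s e : beval s (odd_exp e) = odd (neval s e).
Proof.
rewrite /odd_exp; cbn [beval neval]; rewrite neval_half.
by rewrite -[in RHS](odd_double_half (neval s e)); have := odd_double_half (neval s e); case: odd => /=; lia.
Qed.

Definition has_input s := nmem s 0%N = nth 0%N [:: m; n; k] /\ rmem s 0%N = V.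

Lemma terminates_scale s : has_input s -> (0 < n)%N ->
  terminates prog_scale (2 + (up_log 2 n * 3 + 1)) s (fun s' =>
    [/\ has_input s', rmem s' = rmem s, nmem s' 10 0%N = (2 ^ up_log 2 n)%N &
        nmem s' 4 0%N = up_log 2 n]).
Proof.
move=> [s_in sV] n0; apply: terminates_nstore; apply: terminates_nstore.
pose I i s' := [/\ has_input s', rmem s' = rmem s, nmem s' 10 0%N = (2 ^ i)%N &
        nmem s' 4 0%N = i].
rewrite -[X in (X * 3)%N]subn0; apply: (@terminates_while _ _ _ _ I) => //.
- move=> i s' [[i1 _] _ i3 _] iL /=; rewrite i1 i3 /=.
  rewrite -ltnNge; apply/idP/idP => h.
    by rewrite ltnNge; apply/negP => /(leq_pexp2l (isT : 0 < 2)%N); have := up_logP n (isT : 1 < 2)%N; lia.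
  by rewrite ltnNge; apply/negP => /(up_log_min (isT : 1 < 2)%N); lia.
- move=> i s' _ [[i1 i2] i3 i4 i5].
  apply: terminates_nstore; apply: terminates_nstore; apply: terminates_nil.
  by split=> //=; rewrite ?i4 ?i5 /update/= ?expnS ?addn1 ?i5.
Qed.

End Segments.

(** * Multiplicities with a matching of the odd entries *)

Section ActivePairs.
Variables (R : realType) (m n : nat) (v : 'I_n -> 'cV[R]_m).
Local Notation entry := (nat * nat * R)%type.
Implicit Types (S : seq entry) (e : entry) (a : nat -> nat).

Definition vec_at p : 'cV[R]_m := \sum_(j < n) (j == p :> nat)%:R *: v j.

Definition occurrences S j : nat := \sum_(e <- S) ((e.1.1 == j) + (e.1.2 == j))%N.

(* The entries of the matching are exactly the indices with odd multiplicity. *)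
Definition balanced N a S := [/\
  all (fun e => (e.1.1 < n) && (e.1.2 < n))%N S,
  forall j, (j < n)%N -> (odd (a j) : nat) = occurrences S j &
  (\sum_(j < n) a j = N)%N].

(** The quantity followed through the colouring: a colour y on the pair (p, q) counts as y units
    already shifted from q to p. *)
Definition weighted_sum a S : 'cV[R]_m :=
  \sum_(j < n) (a j)%:R *: v j + \sum_(e <- S) e.2 *: (vec_at e.1.1 - vec_at e.1.2).

Lemma vec_at_ord (j : 'I_n) : vec_at j = v j.
Proof.
rewrite /vec_at (bigD1 j)//= eqxx scale1r big1 ?addr0// => i ij.
by rewrite (negbTE (ij : val i != val j)) scale0r.
Qed.

Lemma occurrences_cat S1 S2 j :
  occurrences (S1 ++ S2) j = (occurrences S1 j + occurrences S2 j)%N.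
Proof. by rewrite /occurrences big_cat. Qed.

Lemma occurrences_cons e S j :
  occurrences (e :: S) j = ((e.1.1 == j) + (e.1.2 == j) + occurrences S j)%N.
Proof. by rewrite /occurrences big_cons. Qed.

Lemma sum_indicator i : (i < n)%N -> (\sum_(j < n) (i == j :> nat) = 1)%N.
Proof.
move=> ilt; rewrite (bigD1 (Ordinal ilt))//= eqxx big1 ?addn0// => j.
by rewrite -val_eqE /= eq_sym => /negbTE ->.
Qed.

Definition move_unit a p q j := if j == q then (a j - 1)%N else if j == p then (a j + 1)%N else a j.

(** An index in the matching has odd multiplicity and occurs there exactly once. So the two ends
    differ, the one that loses a unit has one to lose, and both become even and leave the matching.
    The two forms of the hypothesis stand for the colours 1 and -1. *)
Lemma move_unit_balanced N a S1 S2 p q y :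
    balanced N a (S1 ++ (p, q, y) :: S2) \/ balanced N a (S1 ++ (q, p, y) :: S2) ->
  [/\ p != q, (p < n)%N, (q < n)%N, balanced N (move_unit a p q) (S1 ++ S2) &
    forall S, weighted_sum (move_unit a p q) S = weighted_sum a S + (vec_at p - vec_at q)].
Proof.
move=> H; have {H} [bound occ aN] : [/\
    [&& all (fun e => (e.1.1 < n) && (e.1.2 < n))%N (S1 ++ S2), p < n & q < n]%N,
    forall j, (j < n)%N -> (odd (a j) : nat) = ((p == j) + (q == j) + occurrences (S1 ++ S2) j)%N &
    (\sum_(j < n) a j = N)%N].
  case: H => -[bd occ aN]; split=> //; try (move: bd; rewrite !all_cat/= => /and3P[-> /andP[-> ->] ->]//).
    by move=> j jn; rewrite occ// !occurrences_cat occurrences_cons/=; lia.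
  by move=> j jn; rewrite occ// !occurrences_cat occurrences_cons/=; lia.
have /and3P[bd pn qn] := bound.
have pq : p != q.
  by apply/eqP => pq; have := occ p pn; rewrite -pq eqxx; case: (odd _) => /=; lia.
have ap : odd (a p) /\ occurrences (S1 ++ S2) p = 0%N.
  by have := occ p pn; rewrite eqxx; case: (odd (a p)) => /=; lia.
have aq : odd (a q) /\ occurrences (S1 ++ S2) q = 0%N.
  by have := occ q qn; rewrite eqxx; case: (odd (a q)) => /=; lia.
have aq0 : (0 < a q)%N by case: (a q) aq => [[]|].
have muE j : (move_unit a p q j + (j == q) = a j + (j == p))%N.
  rewrite /move_unit; case: (eqVneq j q) => [->|_]; last by case: eqP; rewrite ?addn0.
  by rewrite eq_sym (negbTE pq) addn0 subnK.
have muR j : (move_unit a p q j)%:R = (a j)%:R + (j == p)%:R - (j == q)%:R :> R.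
  by apply/eqP; rewrite -subr_eq opprK -!natrD muE.
split=> //; last first.
  move=> S; rewrite /weighted_sum addrAC; congr (_ + _).
  under eq_bigr do rewrite muR scalerBl scalerDl.
  by rewrite sumrB big_split/= addrA.
split=> //; last first.
  apply/eqP; rewrite -(eqn_add2r 1) -{1}(sum_indicator qn) -(sum_indicator pn) -aN -!big_split/=.
  by apply/eqP/eq_bigr => j _; rewrite ![_ == val j]eq_sym muE.
move=> j jn; rewrite /move_unit.
case: (eqVneq j q) => [->|jq].
  by rewrite oddB// aq.1 aq.2.
case: (eqVneq j p) => [->|jp].
  by rewrite oddD ap.1 ap.2.
by rewrite occ// eq_sym (negbTE jp) eq_sym (negbTE jq).
Qed.

Lemma weighted_sum_cat a S1 e S2 : weighted_sum a (S1 ++ e :: S2) =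
  weighted_sum a (S1 ++ S2) + e.2 *: (vec_at e.1.1 - vec_at e.1.2).
Proof. by rewrite /weighted_sum !big_cat big_cons/= -!addrA; congr (_ + (_ + _)); rewrite addrC. Qed.

Lemma sum_occurrences S : all (fun e => (e.1.1 < n) && (e.1.2 < n))%N S ->
  (\sum_(j < n) occurrences S j = 2 * size S)%N.
Proof.
rewrite /occurrences exchange_big/=; elim: S => [|e S IH] /=; first by rewrite big_nil.
move=> /andP[/andP[e1 e2] bS]; rewrite big_cons IH// big_split/= !sum_indicator//; lia.
Qed.

Lemma sum_odd_occurrences N a S : balanced N a S -> (\sum_(j < n) odd (a j) = 2 * size S)%N.
Proof.
move=> [bd occ _]; rewrite -sum_occurrences//.
by apply: eq_bigr => j _; rewrite occ.
Qed.

(** Twice the number of pairs is the number of odd multiplicities. The bound by N serves the error,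
    the bound by n the running time. *)
Lemma balanced_size N a S : balanced N a S -> (2 * size S <= N)%N /\ (2 * size S <= n)%N.
Proof.
move=> H; rewrite -(sum_odd_occurrences H); have [_ _ <-] := H; split.
  by apply: leq_sum => j _; case: (a j) => // i; case: odd.
rewrite -[X in (_ <= X)%N]card_ord -sum1_card; apply: leq_sum => j _; by case: odd.
Qed.

End ActivePairs.

(** * Correctness of rounding, pairing and halving *)

Section Blocks.
Variables (R : realType) (D : sampler R) (T : nat -> nat -> nat).
Variables (m n k : nat) (V : nat -> R) (v : 'I_n -> 'cV[R]_m).
Implicit Types (s : state R).
Local Notation terminates := (terminates D T).
Local Notation has_input := (has_input m n k V).

Definition pair_at s t := (nmem s 2%N t, nmem s 3%N t, rmem s 4%N t).
Definition active s h := [seq pair_at s t | t <- iota 0 h].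

Lemma eq_active s s' h : (forall t, (t < h)%N -> pair_at s' t = pair_at s t) ->
  active s' h = active s h.
Proof. by move=> ss; apply/eq_in_map => t; rewrite mem_iota => /ss. Qed.

Lemma activeS s h : active s h.+1 = rcons (active s h) (pair_at s h).
Proof. by rewrite /active -addn1 iotaD map_cat cats1. Qed.

Lemma size_active s h : size (active s h) = h.
Proof. by rewrite size_map size_iota. Qed.

Lemma terminates_round s (x : 'I_n -> R) : has_input s ->
    (forall j : 'I_n, x j = (nmem s 10 0 * k)%N%:R * rmem s 1%N j) ->
  terminates prog_round (1 + (n * 4 + 2)) s (fun s' => [/\ has_input s',
    nmem s' 4 0%N = nmem s 4 0%N &
    forall j : 'I_n, nmem s' 1 j = cumulative_round x j]).
Proof.
move=> [s_in sV] xE; apply: terminates_rstore.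
pose I i s' := [/\ has_input s', nmem s' 4 0%N = nmem s 4 0%N,
  [/\ nmem s' 10 0%N = nmem s 10 0%N, rmem s' 1%N = rmem s 1%N & nmem s' 6 0%N = i],
  rmem s' 5 0%N = partial_sum x i &
  forall j : 'I_n, (j < i)%N -> nmem s' 1 j = cumulative_round x j].
apply: (@terminates_weaken _ _ _ _ (n * 4 + 2) _ _ (I n)) => //.
  by move=> s' [? ? _ _ H]; split=> // j; apply: H.
apply: terminates_for.
- by move=> i s' [[i1 _] _ [_ _ i2] _ _]; rewrite i2 /= i1.
- move=> i s' ilt [[i1 i2] i3 [i4 i5 i6] i7 i8].
  have nextE : reval s' next_sum = partial_sum x i.+1.
    rewrite /= i1 i4 i5 i6 i7 /=.
    by rewrite -[i]/(val (Ordinal ilt)) partial_sumS -xE.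
  apply: terminates_nstore; apply: terminates_rstore; apply: terminates_nil.
  split=> //=; first by split=> //=; rewrite /update/= i6 addn1.
  move=> j; rewrite ltnS leq_eqVlt /update/= => /predU1P[ji|ji]; last first.
    by rewrite i6 ltn_eqF// i8.
  rewrite i6 ji eqxx /cumulative_round ji -nextE /=.
  by rewrite i6 i7.
- split=> //=; first by rewrite /update/= partial_sum0.
Qed.

Lemma terminates_pair s N : has_input s -> ~~ odd N -> (\sum_(j < n) nmem s 1 j = N)%N ->
  terminates prog_pair (2 + (n * 7 + 2)) s (fun s' => [/\ has_input s',
    nmem s' 4 0%N = nmem s 4 0%N,
    balanced n N (nmem s' 1%N) (active s' (nmem s' 5 0)),
    all (fun e => `|e.2| <= 1) (active s' (nmem s' 5 0)) &
    weighted_sum v (nmem s' 1%N) (active s' (nmem s' 5 0)) =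
      \sum_(j < n) (nmem s 1%N j)%:R *: v j]).
Proof.
move=> s_in N_even sN; apply: terminates_nstore; apply: terminates_nstore.
pose I i s' := [/\ [/\ has_input s', nmem s' 4 0%N = nmem s 4 0%N, nmem s' 1%N = nmem s 1%N,
    nmem s' 6 0%N = i & (nmem s' 9 0 <= 1)%N],
  all (fun e => [&& e.1.1 < i, e.1.2 < i & e.2 == 0%R])%N (active s' (nmem s' 5 0)),
  nmem s' 9 0%N = 1%N -> (nmem s' 2 (nmem s' 5 0) < i)%N /\ rmem s' 4 (nmem s' 5 0) = 0 &
  forall j, (j < i)%N -> (odd (nmem s 1 j) : nat) = (occurrences (active s' (nmem s' 5 0)) j
    + nmem s' 9 0 * (nmem s' 2 (nmem s' 5 0) == j))%N].
apply: (@terminates_weaken _ _ _ _ (n * 7 + 2) _ _ (I n)) => //.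
  move=> s' [[s'_in s'4 s'1 _ s'9] bd pend occ].
  have bd' : all (fun e => (e.1.1 < n) && (e.1.2 < n))%N (active s' (nmem s' 5 0)).
    by apply: sub_all bd => e /and3P[-> ->].
  (* A pending entry would make the number of odd multiplicities odd, but it has the parity of their
     sum N. *)
  have p0 : nmem s' 9 0%N = 0%N.
    case: (posnP (nmem s' 9 0)) => // p1; have {}p1 : nmem s' 9 0%N = 1%N by lia.
    have [Pn _] := pend p1.
    have : (\sum_(j < n) odd (nmem s 1 j) = 2 * size (active s' (nmem s' 5 0)) + 1)%N.
      rewrite -(sum_occurrences bd') -[X in (_ + X)%N](sum_indicator Pn) -big_split/=.
      by apply: eq_bigr => j _; rewrite occ// p1 mul1n.
    move=> /(congr1 odd); rewrite oddD oddM/= => oddS.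
    have : odd (\sum_(j < n) odd (nmem s 1 j)) = odd N.
      rewrite -sN; elim/big_rec2: _ => // j x y _ xy; rewrite !oddD xy; by case: (odd (nmem _ _ _)).
    by rewrite oddS (negbTE N_even).
  split=> //.
  - split=> //; last by rewrite s'1.
    by move=> j jn; rewrite s'1 occ// p0 mul0n addn0.
  - by apply: sub_all bd => e /and3P[_ _ /eqP->]; rewrite normr0.
  - rewrite /weighted_sum s'1 [X in _ + X]big1_seq ?addr0// => e /andP[_ es].
    by move: (allP bd e es) => /and3P[_ _ /eqP->]; rewrite scale0r.
apply: terminates_for.
- by move=> i s' [[[i1 _] _ _ i2 _] _ _ _]; rewrite i2 /= i1.
- move=> i s' ilt [[s'_in s'4 s'1 s'6 s'9] bd pend occ].
  have occ_i : occurrences (active s' (nmem s' 5 0)) i = 0%N.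
    rewrite /occurrences big1_seq// => e /andP[_ es].
    by have /and3P[e1 e2 _] := allP bd e es; rewrite !ltn_eqF.
  have bdS : all (fun e => [&& e.1.1 < i.+1, e.1.2 < i.+1 & e.2 == 0%R])%N (active s' (nmem s' 5 0)).
    by apply: sub_all bd => e /and3P[e1 e2 ->]; rewrite !ltnS (ltnW e1) (ltnW e2).
  apply: terminates_if; rewrite beval_odd /= s'6 s'1.
  case: ifP => oi /=; last first.
    apply: (@terminates_le _ _ _ 0) => //; apply: terminates_nil.
    split=> //=; [by split=> //=; rewrite /update/= s'6 addn1| |].
      by move=> /pend[Pi ->]; split=> //; exact: ltnW.
    move=> j; rewrite ltnS leq_eqVlt => /predU1P[->|/occ//].
    rewrite oi /update/= occ_i; case: (posnP (nmem s' 9 0)) => [-> //|p1].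
    have {}p1 : nmem s' 9 0%N = 1%N by lia.
    by have [Pi _] := pend p1; rewrite p1 ltn_eqF.
  apply: terminates_if => /=; case: ifP => p9 /=.
    have {}p9 : nmem s' 9 0%N = 0%N by lia.
    apply: (@terminates_le _ _ _ 3) => //.
    apply: terminates_nstore; apply: terminates_rstore; apply: terminates_nstore; apply: terminates_nil.
    set h := nmem s' 5 0 in bd pend occ bdS occ_i *.
    rewrite /I; set s1 := State (update (nmem (State _ _)) 6 0%N _) _.
    have act : active s1 h = active s' h.
      apply: eq_active => t th; rewrite /pair_at /s1/= /update/=.
      by rewrite !ltn_eqF.
    have -> : nmem s1 5 0%N = h by [].
    rewrite act; split=> //=.
    + by split=> //=; rewrite /update/= s'6 addn1.
    + by rewrite /s1/= /update/= !eqxx s'6; split.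
    + move=> j; rewrite ltnS leq_eqVlt /s1/= /update/= eqxx s'6 mul1n.
      case: (eqVneq j i) => [-> _|ji /= jlt]; first by rewrite oi occ_i.
      by rewrite occ// p9.
  have {}p9 : nmem s' 9 0%N = 1%N by lia.
  have [Pi y0] := pend p9.
  apply: (@terminates_le _ _ _ 3) => //.
  apply: terminates_nstore; apply: terminates_nstore; apply: terminates_nstore; apply: terminates_nil.
  set h := nmem s' 5 0 in bd pend occ bdS occ_i Pi y0 *.
  rewrite /I; set s1 := State (update (nmem (State _ _)) 6 0%N _) _.
  have act : active s1 h.+1 = rcons (active s' h) (nmem s' 2 h, i, 0).
    rewrite activeS; congr rcons; last first.
      by rewrite /pair_at /s1/= /update/= eqxx s'6 y0.
    apply: eq_active => t th; rewrite /pair_at /s1/= /update/=.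
    by rewrite !ltn_eqF.
  have -> : nmem s1 5 0%N = h.+1 by rewrite /s1/= /update/= addn1.
  rewrite act; split=> //=.
  + by split=> //=; rewrite /update/= s'6 addn1.
  + by rewrite all_rcons/= bdS eqxx ltnS ltnW// ltnSn.
  + move=> j; rewrite ltnS leq_eqVlt -cats1 occurrences_cat occurrences_cons/=.
    rewrite {2}/occurrences big_nil /s1/= /update/= mul0n !addn0.
    case: (eqVneq j i) => [-> _|ji /= jlt].
      by rewrite oi occ_i ltn_eqF.
    by rewrite occ// p9 mul1n addn0.
- split=> //=.
Qed.

Lemma terminates_halve s N : has_input s ->
    (forall j, (j < n)%N -> ~~ odd (nmem s 1 j)) ->
    (\sum_(j < n) nmem s 1 j = 2 * N)%N ->
  terminates prog_halve (n * 3 + 2 + 1) s (fun s' => [/\ has_input s',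
    nmem s' 4 0%N = (nmem s 4 0 - 1)%N, (\sum_(j < n) nmem s' 1 j = N)%N &
    \sum_(j < n) (nmem s 1%N j)%:R *: v j = 2 *: \sum_(j < n) (nmem s' 1%N j)%:R *: v j]).
Proof.
move=> s_in ev sN; apply: terminates_cat.
pose I i s' := [/\ has_input s', nmem s' 4 0%N = nmem s 4 0%N, nmem s' 6 0%N = i,
  forall j, (j < i)%N -> nmem s' 1 j = (nmem s 1 j)./2 &
  forall j, (i <= j)%N -> nmem s' 1 j = nmem s 1 j].
apply: (@terminates_weaken _ _ _ _ (n * 3 + 2) _ _ (I n)) => //.
  move=> s' [s'_in s'4 _ s'1 _]; apply: terminates_nstore; apply: terminates_nil.
  have aE (j : 'I_n) : nmem s 1 j = (2 * nmem s' 1 j)%N.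
    by rewrite s'1// mul2n even_halfK// ev.
  split=> //=; first by rewrite /update/= s'4.
    apply/eqP; rewrite /update/= -(eqn_pmul2l (isT : 0 < 2)%N) -sN big_distrr/=.
    by apply/eqP/eq_bigr => j _; rewrite aE.
  rewrite scaler_sumr; apply: eq_bigr => j _.
  by rewrite aE natrM scalerA.
apply: terminates_for.
- by move=> i s' [[i1 _] _ i2 _ _]; rewrite i2 /= i1.
- move=> i s' ilt [s'_in s'4 s'6 lo hi].
  apply: terminates_nstore; rewrite neval_half; apply: terminates_nil; split=> //=.
  + by rewrite /update/= s'6 addn1.
  + move=> j; rewrite ltnS leq_eqVlt /update/= s'6 => /predU1P[->|ji].
      by rewrite eqxx hi.
    by rewrite ltn_eqF// lo.
  + by move=> j ij; rewrite /update/= s'6 gtn_eqF// hi// ltnW.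
- by split.
Qed.

End Blocks.

(** * Correctness of the steps around a sample *)

Section ColouringBlocks.
Variables (R : realType) (D : sampler R) (T : nat -> nat -> nat).
Variables (m n k : nat) (V : nat -> R) (v : 'I_n -> 'cV[R]_m).
Hypothesis V_vec : forall (r : 'I_m) p, (p < n)%N -> V (r * n + p)%N = vec_at v p r ord0.
Implicit Types (s : state R).
Local Notation terminates := (terminates D T).
Local Notation has_input := (has_input m n k V).

Lemma terminates_matrix s h : has_input s -> nmem s 5 0%N = h ->
    (forall t, (t < h)%N -> (nmem s 2 t < n)%N && (nmem s 3 t < n)%N) ->
  terminates prog_matrix (m * (h * 3 + 2).+2 + 2) s (fun s' => [/\ has_input s',
    forall a, a \in [:: 1; 2; 3; 4; 5]%N -> nmem s' a = nmem s a,
    rmem s' 4%N = rmem s 4%N &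
    forall (r : 'I_m) (i : 'I_h), rmem s' 3 (r * h + i)%N =
      (vec_at v (nmem s 2 i) - vec_at v (nmem s 3 i)) r ord0]).
Proof.
move=> s_in s5 PQ.
(* [M] is the intended matrix as a function of the flat index; both loop invariants say that a
   prefix of the flat array is correct. *)
pose M idx := V ((idx %/ h) * n + nmem s 2 (idx %% h))%N
            - V ((idx %/ h) * n + nmem s 3 (idx %% h))%N.
pose F s' := [/\ has_input s', forall a, a \in [:: 1; 2; 3; 4; 5]%N -> nmem s' a = nmem s a &
   rmem s' 4%N = rmem s 4%N].
pose I r s' := [/\ F s', nmem s' 7 0%N = r &
  forall idx, (idx < r * h)%N -> rmem s' 3 idx = M idx].
pose J r i s' := [/\ F s', nmem s' 7 0%N = r, nmem s' 6 0%N = i &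
  forall idx, (idx < r * h + i)%N -> rmem s' 3 idx = M idx].
apply: (@terminates_weaken _ _ _ _ (m * (h * 3 + 2).+2 + 2) _ _ (I m)) => //.
  move=> s' [[s'_in s'a s'4] _ sM]; split=> // r i.
  have h0 : (0 < h)%N := leq_ltn_trans (leq0n _) (ltn_ord i).
  rewrite sM /M; last first.
    rewrite (@leq_trans (r * h + h))// ?ltn_add2l// -mulSnr leq_mul2r.
    by rewrite ltn_ord orbT.
  rewrite divnMDl// divn_small// addn0 modnMDl modn_small//.
  have /andP[P1 Q1] := PQ i (ltn_ord i).
  by rewrite !V_vec// !mxE.
apply: terminates_for.
- by move=> r s' [[[s'_in _] _ _] s'7 _]; rewrite s'7 /= s'_in.
- move=> r s' rm [[s'_in s'a s'4] s'7 sM].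
  apply: (@terminates_weaken _ _ _ _ (h * 3 + 2) _ _ (J r h)) => //.
    move=> s'' [[[s''_in s''V] s''a s''4] s''7 _ s''M]; split=> //=.
    + split=> //= a; rewrite !inE => /or4P[/eqP->|/eqP->|/eqP->|/orP[]/eqP->];
        by rewrite -s''a.
    + by rewrite /update/= s''7 addn1.
    + by move=> idx; rewrite mulSnr => /s''M.
  apply: terminates_for.
  + by move=> i s'' [[_ s''a _] _ s''6 _]; rewrite s''6 /= s''a.
  + move=> i s'' ih [[[s''_in s''V] s''a s''4] s''7 s''6 s''M].
    apply: terminates_rstore; apply: terminates_nil.
    split=> //=.
    * split=> //= a; rewrite !inE => /or4P[/eqP->|/eqP->|/eqP->|/orP[]/eqP->];
        by rewrite -s''a.
    * by rewrite /update/= s''6 addn1.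
    * move=> idx; rewrite addnS ltnS leq_eqVlt /update/= s''7 s''6 s''a// s5.
      case: eqP => [-> _|/= _ /s''M //].
      rewrite s''_in s''V /= !s''a// /M divnMDl ?(leq_ltn_trans _ ih)//.
      by rewrite divn_small// addn0 modnMDl modn_small.
  + split=> //=.
    * split=> //= a; rewrite !inE => /or4P[/eqP->|/eqP->|/eqP->|/orP[]/eqP->];
        by rewrite -s'a.
    * by move=> idx; rewrite addn0 => /sM.
- split=> //=; split=> //= a.
  by rewrite !inE => /or4P[/eqP->|/eqP->|/eqP->|/orP[]/eqP->].
Qed.

(** The pairs alive in the middle of a compaction: the w survivors already packed, and those from i
    on, not yet read. *)
Definition virtual s w i h := [seq pair_at s t | t <- iota 0 w ++ iota i (h - i)].

Lemma virtual_cons s w i h : (i < h)%N ->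
  virtual s w i h = active s w ++ pair_at s i :: [seq pair_at s t | t <- iota i.+1 (h - i.+1)].
Proof. by move=> ih; rewrite /virtual -(subnSK ih) map_cat. Qed.

Lemma virtual_split s w i h :
  virtual s w i h = active s w ++ [seq pair_at s t | t <- iota i (h - i)].
Proof. by rewrite /virtual map_cat. Qed.

Definition rounded s t := (1 <= rmem s 4 t) || (rmem s 4 t + 1 <= 0).

Lemma terminates_compact s h N : has_input s -> nmem s 5 0%N = h ->
    balanced n N (nmem s 1%N) (active s h) -> all (fun e => `|e.2| <= 1) (active s h) ->
  terminates prog_compact (1 + (h * 8 + 2 + 1)) s (fun s' => [/\ has_input s',
    nmem s' 4 0%N = nmem s 4 0%N,
    balanced n N (nmem s' 1%N) (active s' (nmem s' 5 0)) /\
      all (fun e => `|e.2| <= 1) (active s' (nmem s' 5 0)),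
    weighted_sum v (nmem s' 1%N) (active s' (nmem s' 5 0))
      = weighted_sum v (nmem s 1%N) (active s h) &
    (nmem s' 5 0 + count (rounded s) (iota 0 h) = h)%N]).
Proof.
move=> s_in s5 bal cube; apply: terminates_nstore.
set U := weighted_sum _ _ _.
pose I i s' := [/\ [/\ has_input s', nmem s' 4 0%N = nmem s 4 0%N, nmem s' 5 0%N = h &
    nmem s' 6 0%N = i],
  (nmem s' 8 0 + count (rounded s) (iota 0 i) = i)%N,
  forall t, (i <= t)%N -> pair_at s' t = pair_at s t,
  balanced n N (nmem s' 1%N) (virtual s' (nmem s' 8 0) i h) /\
    all (fun e => `|e.2| <= 1) (virtual s' (nmem s' 8 0) i h) &
  weighted_sum v (nmem s' 1%N) (virtual s' (nmem s' 8 0) i h) = U].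
apply: terminates_cat.
apply: (@terminates_weaken _ _ _ _ (h * 8 + 2) _ _ (I h)) => //.
  move=> s' [[s'_in s'4 s'5 s'6] s'8 _ [s'b s'c] s'U].
  have vE : virtual s' (nmem s' 8 0) h h = active s' (nmem s' 8 0).
    by rewrite virtual_split subnn cats0.
  rewrite vE in s'b s'c s'U.
  by apply: terminates_nstore; apply: terminates_nil; split=> //=; rewrite /update/=.
apply: terminates_for.
- by move=> i s' [[s'_in s'4 s'5 s'6] _ _ _ _]; rewrite s'6 /= s'5.
- move=> i s' ih [[s'_in s'4 s'5 s'6] s'8 s'hi [s'b s'c] s'U].
  (* The write position never overtakes the read position, so packing destroys no unread pair. *)
  have wi : (nmem s' 8 0 <= i)%N by rewrite -s'8 leq_addr.
  have cntS : count (rounded s) (iota 0 i.+1) = (count (rounded s) (iota 0 i) + rounded s i)%N.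
    by rewrite -[in LHS]addn1 iotaD count_cat/= addn0.
  have yE : rmem s' 4 i = rmem s 4 i by have [] := s'hi i (leqnn i).
  rewrite virtual_cons// in s'b s'c s'U.
  set S1 := active _ _ in s'b s'c s'U; set S2 := [seq _ | _ <- _] in s'b s'c s'U.
  have c12 : all (fun e => `|e.2| <= 1) (S1 ++ S2).
    by move: s'c; rewrite !all_cat/= => /and3P[-> _ ->].
  have yi : `|rmem s' 4 i| <= 1 by move: s'c; rewrite all_cat/= => /and3P[].
  rewrite weighted_sum_cat/= in s'U.
  apply: terminates_if => /=; rewrite s'6; case: ifP => y1 /=.
    have yE1 : rmem s' 4 i = 1 by move: yi; rewrite ler_norml; lra.
    have [pq pn qn b12 ws12] := move_unit_balanced v (or_introl s'b).
    have ri : rounded s i by rewrite /rounded -yE y1.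
    apply: (@terminates_le _ _ _ 2) => //.
    apply: terminates_nstore; apply: terminates_nstore; apply: terminates_nil.
    rewrite /I; set s1 := State (update (nmem (State _ _)) 6 0%N _) _.
    have a1 : nmem s1 1%N = move_unit (nmem s' 1%N) (nmem s' 2 i) (nmem s' 3 i).
      apply/funext => j; rewrite /s1/= /update/= s'6 /move_unit.
      case: eqVneq => [->|_]; first by rewrite eq_sym (negbTE pq).
      by case: eqVneq => [->|].
    have w1 : nmem s1 8 0%N = nmem s' 8 0%N by [].
    have v1 : virtual s1 (nmem s1 8 0) i.+1 h = S1 ++ S2 by rewrite virtual_split.
    rewrite v1 a1; split.
    + by split=> //=; rewrite /update/= s'6 addn1.
    + by rewrite w1 cntS ri addnA s'8 addn1.
    + by move=> t /ltnW; exact: s'hi.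
    + by split.
    + by rewrite ws12 -s'U yE1 scale1r.
  apply: terminates_if => /=; rewrite s'6; case: ifP => y2 /=.
    have yE1 : rmem s' 4 i = - 1 by move: yi; rewrite ler_norml; lra.
    have [pq pn qn b12 ws12] := move_unit_balanced v (or_intror s'b).
    have ri : rounded s i by rewrite /rounded -yE y2 orbT.
    apply: (@terminates_le _ _ _ 2) => //.
    apply: terminates_nstore; apply: terminates_nstore; apply: terminates_nil.
    rewrite /I; set s1 := State (update (nmem (State _ _)) 6 0%N _) _.
    have a1 : nmem s1 1%N = move_unit (nmem s' 1%N) (nmem s' 3 i) (nmem s' 2 i).
      apply/funext => j; rewrite /s1/= /update/= s'6 /move_unit.
      case: eqVneq => [->|_]; first by rewrite eq_sym (negbTE pq).
      by case: eqVneq => [->|].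
    have w1 : nmem s1 8 0%N = nmem s' 8 0%N by [].
    have v1 : virtual s1 (nmem s1 8 0) i.+1 h = S1 ++ S2 by rewrite virtual_split.
    rewrite v1 a1; split.
    + by split=> //=; rewrite /update/= s'6 addn1.
    + by rewrite w1 cntS ri addnA s'8 addn1.
    + by move=> t /ltnW; exact: s'hi.
    + by split.
    + by rewrite ws12 -s'U yE1 scaleN1r opprB.
  have ri : rounded s i = false by rewrite /rounded -yE y1 y2.
  apply: (@terminates_le _ _ _ 4) => //.
  apply: terminates_nstore; apply: terminates_nstore; apply: terminates_rstore.
  apply: terminates_nstore; apply: terminates_nil.
  rewrite /I; set s1 := State (update (nmem (State _ _)) 6 0%N _) _.
  have w1 : nmem s1 8 0%N = (nmem s' 8 0).+1 by rewrite /s1/= /update/= addn1.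
  have p1 t : pair_at s1 t = if t == nmem s' 8 0 then pair_at s' i else pair_at s' t.
    by rewrite /pair_at /s1/= /update/= s'6; case: eqP.
  have v1 : virtual s1 (nmem s1 8 0) i.+1 h = S1 ++ pair_at s' i :: S2.
    rewrite virtual_split w1 activeS p1 eqxx -cats1 -catA/=.
    congr (_ ++ _ :: _).
      by apply: eq_active => t tw; rewrite p1 ltn_eqF.
    apply/eq_in_map => t; rewrite mem_iota => /andP[it _].
    by rewrite p1 gtn_eqF// (leq_ltn_trans wi).
  rewrite v1; split.
  + by split=> //=; rewrite /update/= s'6 addn1.
  + by rewrite w1 cntS ri addn0 addSn s'8.
  + by move=> t it; rewrite p1 gtn_eqF ?(leq_ltn_trans wi)// s'hi// ltnW.
  + by split.
  + by rewrite -s'U weighted_sum_cat.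
- have v0 s1 : pair_at s1 = pair_at s -> virtual s1 0 0 h = active s h.
    by move=> ps; rewrite /virtual subn0 /= ps.
  by split=> //=; rewrite v0.
Qed.

End ColouringBlocks.

(** * Success probability and running time *)

Lemma round_cost_le (m h t M : nat) : (0 < m -> h <= m.+1 -> t <= M -> m * m.+1 <= M ->
  (m * (h * 3 + 2).+2 + 2) + (t + (1 + (h * 8 + 2 + 1))) <= 20 * M)%N.
Proof.
move=> m0 hm tM mM; have m1 : (m <= m * m.+1)%N by rewrite leq_pmulr.
have m2 : (m.+1 <= m * m.+1)%N by rewrite leq_pmull.
have H : (m * (h * 3 + 2).+2 <= m * (3 * m.+1 + 4))%N by rewrite leq_pmul2l//; lia.
lia.
Qed.

Lemma remaining_half (h h' c : nat) : (h <= 2 * c -> h' + c = h -> 2 * h' <= h)%N.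
Proof. lia. Qed.

Section SuccessProbability.
Variables (R : realType) (D : sampler R) (T : nat -> nat -> nat).
Variables (m n k : nat) (V : nat -> R) (v : 'I_n -> 'cV[R]_m) (z : 'cV[R]_m).
Variables (p q : \bar R) (post : state R -> Prop).
Hypotheses (m_gt0 : (0 < m)%N) (k_gt0 : (0 < k)%N) (n_gt0 : (0 < n)%N) (n_le : (n <= m.+1)%N).
Hypothesis T_mono : (forall m1 m2 n1 n2, m1 <= m2 -> n1 <= n2 -> T m1 n1 <= T m2 n2)%N.
Hypothesis T_ge : (forall m n, m * n <= T m n)%N.
Hypothesis V_vec : forall (r : 'I_m) p, (p < n)%N -> V (r * n + p)%N = vec_at v p r ord0.
Hypotheses (p_ge1 : (1 <= p)%E) (q_ge1 : (1 <= q)%E).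
Hypothesis v_le1 : forall j, lpnorm p (v j) <= 1.
Implicit Types (s : state R).
Local Notation has_input := (has_input m n k V).
Local Notation lower_bound := (lower_bound D T).
Local Notation M := (T m m.+1).

(** [step] bounds the mean error of one sample and [F] that of colouring h pairs, both before
    division by the total N; [G] bounds the mean error of l levels, and [E] is the error tolerated
    at the end. *)
Variables (step F G : nat -> R) (E : R).
Hypothesis E_gt0 : 0 < E.
Hypothesis sampler_step : forall h (A : 'M[R]_(m, h)) (x0 : h.-tuple R), (0 < h)%N ->
    (forall j, lpnorm p (col j A) <= 2) -> in_cube x0 ->
  exists g : h.-tuple R -> R, [/\ measurable_fun setT g, forall x, 0 <= g x,
    (\int[@D m h A x0]_x (g x)%:E <= (step h)%:E)%E &
    {ae @D m h A x0, forall x, [/\ in_cube x,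
      (h <= 2 * #|[pred j | (`|tnth x j| == 1)%R]|)%N &
      lpnorm q (\sum_j (tnth x j - tnth x0 j) *: col j A) <= g x]}].
Hypothesis F0_ge0 : 0 <= F 0%N.
Hypothesis F_step : forall h h', (0 < h)%N -> (2 * h' <= h)%N -> step h + F h' <= F h.
Hypothesis G0_ge0 : 0 <= G 0%N.
Hypothesis G_step : forall l h, (2 * h <= 2 ^ l.+1 * k)%N ->
  F h / (2 ^ l.+1 * k)%N%:R + G l <= G l.+1.
Hypothesis post_final : forall s, (\sum_(j < n) nmem s 1 j = k)%N ->
  lpnorm q (z - k%:R^-1 *: \sum_(j < n) (nmem s 1%N j)%:R *: v j) < E -> post s.

Definition colouring_state l N s h := [/\ has_input s, nmem s 4 0%N = l,
  nmem s 5 0%N = h, balanced n N (nmem s 1%N) (active s h) &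
  all (fun e => `|e.2| <= 1) (active s h)].

Definition deviation N s h :=
  lpnorm q (z - N%:R^-1 *: weighted_sum v (nmem s 1%N) (active s h)).

Lemma lpnorm_vec_diff i j : (i < n)%N -> (j < n)%N ->
  lpnorm p (vec_at v i - vec_at v j) <= 2.
Proof.
move=> ilt jlt; have p0 : (0 < p)%E by apply: lt_le_trans p_ge1.
rewrite -[i]/(val (Ordinal ilt)) -[j]/(val (Ordinal jlt)) !vec_at_ord.
apply: le_trans (ler_lpnormD _ _ p_ge1) _; rewrite lpnormN//.
by have := v_le1 (Ordinal ilt); have := v_le1 (Ordinal jlt); lra.
Qed.

Lemma weighted_sum_active a s s' h :
    (forall t, (t < h)%N -> nmem s' 2 t = nmem s 2 t /\ nmem s' 3 t = nmem s 3 t) ->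
  weighted_sum v a (active s' h) = weighted_sum v a (active s h) +
   \sum_(t < h) (rmem s' 4%N t - rmem s 4%N t) *:
     (vec_at v (nmem s 2 t) - vec_at v (nmem s 3 t)).
Proof.
move=> ss; rewrite /weighted_sum -addrA; congr (_ + _).
rewrite -(big_mkord xpredT (fun t => (rmem s' 4%N t - rmem s 4%N t) *:
  (vec_at v (nmem s 2 t) - vec_at v (nmem s 3 t)))).
rewrite /active !big_map /index_iota subn0 -big_split/=.
apply: eq_big_seq => t; rewrite mem_iota /= add0n => /ss[-> ->].
by rewrite scalerBl addrCA subrr addr0.
Qed.

Lemma balanced_ext N a (S S' : seq (nat * nat * R)) : [seq e.1 | e <- S] = [seq e.1 | e <- S'] ->
  balanced n N a S -> balanced n N a S'.
Proof.
move=> SS [bd occ aN]; split=> //.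
  have : all (fun u : nat * nat => (u.1 < n) && (u.2 < n))%N [seq e.1 | e <- S].
    by rewrite all_map.
  by rewrite SS all_map.
move=> j jn; rewrite occ// /occurrences.
have H (S0 : seq (nat * nat * R)) : (\sum_(e <- S0) ((e.1.1 == j) + (e.1.2 == j))
   = \sum_(u <- [seq e.1 | e <- S0]) ((u.1 == j) + (u.2 == j)))%N by rewrite big_map.
by rewrite !H SS.
Qed.

Lemma count_rounded s h (y : h.-tuple R) : in_cube y ->
    (forall t : 'I_h, rmem s 4%N t = tnth y t) ->
  count (rounded s) (iota 0 h) = #|[pred j | (`|tnth y j| == 1)%R]|.
Proof.
move=> /forallP yc sy.
rewrite -val_enum_ord count_map -sum1_count -sum1_card big_enum_cond/=.
apply: eq_bigl => t; rewrite /rounded/= sy inE.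
have := yc t; rewrite ler_norml => /andP[y1 y2].
apply/idP/eqP => [/orP[]h1|].
- have -> : tnth y t = 1 by lra.
  by rewrite normr1.
- have -> : tnth y t = - 1 by lra.
  by rewrite normrN1.
- have [y0|y0] := leP 0 (tnth y t).
    by rewrite ger0_norm// => ->; rewrite lexx.
  by rewrite ltr0_norm// => /(canRL (@opprK _)) ->; rewrite addNr lexx orbT.
Qed.

Let M_bounds : [/\ m <= M, m.+1 <= M & 2 <= M]%N.
Proof.
have H := T_ge m m.+1; split; apply: leq_trans H.
- by rewrite leq_pmulr.
- by rewrite leq_pmull.
- by case: m m_gt0 => // m' _; rewrite mulSn; lia.
Qed.

Definition round_cost := (20 * M)%N.

(** A sample moves the fractional combination by its colour changes applied to the columns, over N.
    The deviation grows by at most g/N, of mean at most step h / N, which the drop of [F] pays for;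
    property A halves the number of pairs. *)
Lemma lower_bound_round l N B K s h g0 : (0 < N)%N -> (0 < h)%N ->
    colouring_state l N s h ->
    (forall s' h', colouring_state l N s' h' -> (2 * h' <= h)%N ->
       lower_bound B K s' post (1 - (deviation N s' h' + F h' / N%:R + g0) / E)) ->
  lower_bound (round_cost + B)
    (prog_matrix ++ Sample 4 3 4 in_rows (var 5) :: prog_compact ++ K) s post
    (1 - (deviation N s h + F h / N%:R + g0) / E).
Proof.
move=> N0 h0 [s_in s4 s5 bal cube] next.
have NR0 : 0 < N%:R :> R by rewrite ltr0n.
have q0 : (0 < q)%E by apply: lt_le_trans q_ge1.
have [_ hn] := balanced_size bal; rewrite size_active in hn.
have hm : (h <= m.+1)%N by rewrite (leq_trans _ n_le)// (leq_trans _ hn)// leq_pmull.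
have [m1 m2 M2] := M_bounds.
have TM : (T m h <= M)%N by apply: T_mono.
have T0 : (0 < T m h)%N by apply: leq_trans (T_ge m h); rewrite muln_gt0 m_gt0.
pose cc := (1 + (h * 8 + 2 + 1))%N; pose cm := (m * (h * 3 + 2).+2 + 2)%N.
apply: (@lower_bound_weaken _ _ _ (cm + (T m h + (cc + B))) _ _ _ _ _ _ _ (lexx _)).
  by have := round_cost_le m_gt0 hm TM (T_ge m m.+1); rewrite -(leq_add2r B) !addnA.
have [bd _ _] := bal.
have PQ t : (t < h)%N -> (nmem s 2 t < n)%N && (nmem s 3 t < n)%N.
  move=> th; have := allP bd (pair_at s t); apply.
  by apply/map_f; rewrite mem_iota.
apply: lower_bound_terminates.
apply: terminates_weaken (terminates_matrix D T V_vec s_in s5 PQ) => //.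
move=> s1 [s1_in s1a s1y s1M].
have s11 : nmem s1 1%N = nmem s 1%N by exact: s1a.
have s12 : nmem s1 2%N = nmem s 2%N by exact: s1a.
have s13 : nmem s1 3%N = nmem s 3%N by exact: s1a.
have s14 : nmem s1 4%N = nmem s 4%N by exact: s1a.
have s15 : nmem s1 5%N = nmem s 5%N by exact: s1a.
pose A : 'M[R]_(m, h) := load_mx s1 3 m h; pose x0 := load_tuple s1 4 h.
have colA (j : 'I_h) : col j A = vec_at v (nmem s 2 j) - vec_at v (nmem s 3 j).
  by apply/colP => r; rewrite [LHS]mxE [LHS]mxE s1M.
have A2 j : lpnorm p (col j A) <= 2.
  by rewrite colA; have /andP[] := PQ j (ltn_ord j); exact: lpnorm_vec_diff.
have x0E (j : 'I_h) : tnth x0 j = rmem s 4%N j by rewrite tnth_mktuple s1y.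
have x0c : in_cube x0.
  apply/forallP => j; rewrite x0E.
  by have := allP cube (pair_at s j); apply; apply/map_f; rewrite mem_iota ltn_ord.
have [g [mg g_ge0 gint gae]] := sampler_step h0 A2 x0c.
have NE0 : 0 <= N%:R^-1 / E by rewrite divr_ge0 ?invr_ge0 ?(ltW E_gt0).
(* In [u] the mean error of the sample is taken out of the potential; the sampling rule subtracts it
   again. *)
pose u := 1 - (deviation N s h + (F h - step h) / N%:R + g0) / E.
have -> : 1 - (deviation N s h + F h / N%:R + g0) / E = u - N%:R^-1 / E * step h.
  by rewrite /u; field; rewrite !gt_eqF.
have n1 : neval s1 in_rows = m by case: s1_in => /= ->.
have n2 : neval s1 (var 5) = h by rewrite /= s15.
apply: (lower_bound_sample (g := fun y => N%:R^-1 / E * g y) n1 n2) => //.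
- by apply: measurable_funM => //; exact: measurable_cst.
- by move=> y; rewrite mulr_ge0.
- have mgE : measurable_fun setT (EFin \o g) by exact/measurable_EFinP.
  under eq_integral do rewrite EFinM.
  rewrite (ge0_integralZl_EFin _ measurableT _ mgE NE0); last first.
    by move=> y _; rewrite lee_fin.
  by rewrite [leRHS]EFinM; apply: lee_wpmul2l; rewrite ?lee_fin.
apply: filterS gae => y [yc yhalf yg].
pose s2 := store_tuple s1 4 y.
have s2y (t : 'I_h) : rmem s2 4%N t = tnth y t.
  by rewrite /s2/= ltn_ord (tnth_nth 0).
have s2_in : has_input s2 by case: s1_in.
have act1 : [seq e.1 | e <- active s h] = [seq e.1 | e <- active s2 h].
  by rewrite /active -!map_comp; apply: eq_map => t; rewrite /pair_at /= s12 s13.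
have bal2 : balanced n N (nmem s2 1%N) (active s2 h).
  by rewrite [nmem s2 1%N]s11; exact: balanced_ext act1 bal.
have cube2 : all (fun e => `|e.2| <= 1) (active s2 h).
  apply/allP => e /mapP[t]; rewrite mem_iota add0n => /andP[_ th] ->.
  by have := forallP yc (Ordinal th); rewrite -s2y.
apply: (lower_bound_terminates (K := prog_compact)).
have s25 : nmem s2 5%N 0%N = h by rewrite /s2/= s15.
apply: terminates_weaken (terminates_compact D T v s2_in s25 bal2 cube2) => //.
move=> s3 [s3_in s34 [bal3 cube3] s3w s3c].
set h3 := nmem s3 5 0 in bal3 cube3 s3w s3c.
have h32 : (2 * h3 <= h)%N by rewrite (count_rounded yc s2y) in s3c; exact: remaining_half yhalf s3c.
have inv3 : colouring_state l N s3 h3.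
  by split=> //; rewrite s34 /s2/= s14.
apply: lower_bound_weaken (next s3 h3 inv3 h32) => //.
have dev3 : deviation N s3 h3 <= deviation N s h + N%:R^-1 * g y.
  rewrite /deviation s3w [nmem s2 1%N]s11.
  rewrite (@weighted_sum_active _ s s2 h); last first.
    by move=> t _; rewrite /s2/= s12 s13.
  rewrite scalerDr opprD addrA.
  apply: le_trans (ler_lpnormD _ _ q_ge1) _; rewrite lerD2l lpnormN// lpnormZ//.
  rewrite ger0_norm ?invr_ge0// ler_wpM2l ?invr_ge0//.
  apply: le_trans yg; rewrite le_eqVlt; apply/orP; left; apply/eqP; congr lpnorm.
  by apply: eq_bigr => t _; rewrite s2y x0E colA.
have F3 : F h3 / N%:R <= (F h - step h) / N%:R.
  by rewrite ler_pM2r ?invr_gt0//; have := F_step h0 h32; lra.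
have -> : u - N%:R^-1 / E * g y = 1 - (deviation N s h + (F h - step h) / N%:R + g0
     + N%:R^-1 * g y) / E by rewrite /u; field; rewrite !gt_eqF.
rewrite lerD2l lerN2 ler_pM2r ?invr_gt0//; lra.
Qed.

Lemma lower_bound_colour t l N B K s h g0 : (0 < N)%N -> (h < 2 ^ t)%N ->
    colouring_state l N s h ->
    (forall s', colouring_state l N s' 0 ->
       lower_bound B K s' post (1 - (deviation N s' 0 + g0) / E)) ->
  lower_bound (t * round_cost.+1 + (1 + B)) (prog_colour :: K) s post
    (1 - (deviation N s h + F h / N%:R + g0) / E).
Proof.
move=> N0 ht st next; elim: t h s ht st => [|t IH] h s ht st.
  have h0 : h = 0%N by move: ht; case: h {st}.
  rewrite h0 in st *; have [_ _ s5 _ _] := st.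
  apply: lower_bound_while_false; first by rewrite /= s5.
  apply: lower_bound_weaken (next s st) => //.
  rewrite lerD2l lerN2 ler_pM2r ?invr_gt0// lerD2r lerDl.
  by rewrite divr_ge0.
have [h0|h0] := posnP h.
  rewrite h0 in st *; have [_ _ s5 _ _] := st.
  apply: (@lower_bound_weaken _ _ _ (1 + B) _ _ _ _ _ _ _ (lexx _)).
    exact: leq_addl.
  apply: lower_bound_while_false; first by rewrite /= s5.
  apply: lower_bound_weaken (next s st) => //.
  rewrite lerD2l lerN2 ler_pM2r ?invr_gt0// lerD2r lerDl.
  by rewrite divr_ge0.
have [_ _ s5 _ _] := st.
rewrite mulSn -addnA addSn; apply: lower_bound_while_true; first by rewrite /= s5 -ltnNge.
rewrite -catA; apply: (lower_bound_round (K := prog_colour :: K) N0 h0 st).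
move=> s' h' st' h2; apply: IH => //.
by rewrite -(ltn_pmul2l (isT : 0 < 2)%N) -expnS; exact: leq_ltn_trans ht.
Qed.

(** Besides the L rounds: 7n + 4 for pairing, 3n + 3 for halving, and two loop tests. *)
Definition level_cost L := (L * round_cost.+1 + (10 * n + 9))%N.

(** Markov's inequality sits in the base case: a positive bound 1 - (d + G 0)/E forces d < E, hence
    [post]. *)
Lemma lower_bound_levels L l s : (n <= 2 ^ L)%N -> has_input s -> nmem s 4 0%N = l ->
    (\sum_(j < n) nmem s 1 j = 2 ^ l * k)%N ->
  lower_bound (l * level_cost L + 1) [:: prog_levels] s post
    (1 - (lpnorm q (z - (2 ^ l * k)%N%:R^-1 *: \sum_(j < n) (nmem s 1%N j)%:R *: v j) + G l) / E).
Proof.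
move=> nL; elim: l s => [|l IH] s s_in s4 sN.
  rewrite mul1n in sN *; apply: lower_bound_while_false; first by rewrite /= s4.
  set d := lpnorm _ _; have d0 : 0 <= d := lpnorm_ge0 _ _.
  apply: lower_bound_nil => [u0|].
    apply: post_final => //; rewrite -/d; move: u0; rewrite subr_gt0 ltr_pdivrMr// mul1r.
    by apply: le_lt_trans; rewrite lerDl.
  by rewrite gerBl divr_ge0 ?addr_ge0 ?(ltW E_gt0).
have N0 : (0 < 2 ^ l.+1 * k)%N by rewrite muln_gt0 expn_gt0.
have N_even : ~~ odd (2 ^ l.+1 * k) by rewrite expnS -mulnA oddM.
have -> : (l.+1 * level_cost L + 1 = (2 + (n * 7 + 2) +
    (L * round_cost.+1 + (1 + (n * 3 + 2 + 1 + (l * level_cost L + 1))))).+1)%N.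
  by rewrite mulSn {1}/level_cost; move: (l * _)%N (L * _)%N => *; lia.
apply: lower_bound_while_true; first by rewrite /= s4.
rewrite -catA; apply: lower_bound_terminates.
apply: terminates_weaken (terminates_pair D T v s_in N_even sN) => //.
move=> s1 [s1_in s14 s1b s1c s1w]; set h := nmem s1 5 0 in s1b s1c s1w.
have [hN hn] := balanced_size s1b; rewrite size_active in hN hn.
have st1 : colouring_state l.+1 (2 ^ l.+1 * k) s1 h by split=> //; rewrite s14.
have hL : (h < 2 ^ L)%N.
  rewrite -(ltn_pmul2l (isT : 0 < 2)%N) (leq_ltn_trans hn)// (leq_ltn_trans nL)//.
  by rewrite ltn_Pmull// expn_gt0.
have dev1 : deviation (2 ^ l.+1 * k) s1 h =
    lpnorm q (z - (2 ^ l.+1 * k)%N%:R^-1 *: \sum_(j < n) (nmem s 1%N j)%:R *: v j).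
  by rewrite /deviation s1w.
rewrite -dev1.
have Gl : deviation (2 ^ l.+1 * k) s1 h + F h / (2 ^ l.+1 * k)%N%:R + G l
    <= deviation (2 ^ l.+1 * k) s1 h + G l.+1.
  by rewrite -addrA lerD2l; exact: G_step.
suff : lower_bound (L * round_cost.+1 + (1 + (n * 3 + 2 + 1 + (l * level_cost L + 1))))
    (prog_colour :: prog_halve ++ [:: prog_levels]) s1 post
    (1 - (deviation (2 ^ l.+1 * k) s1 h + F h / (2 ^ l.+1 * k)%N%:R + G l) / E).
  by apply: lower_bound_weaken => //; rewrite lerD2l lerN2 ler_pM2r ?invr_gt0.
apply: lower_bound_colour N0 hL st1 _.
move=> s2 [s2_in s24 _ [_ s2o s2N] _].
have s2e j : (j < n)%N -> ~~ odd (nmem s2 1 j).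
  by move=> /s2o; rewrite /occurrences big_nil; case: odd.
have s2N' : (\sum_(j < n) nmem s2 1 j = 2 * (2 ^ l * k))%N by rewrite s2N expnS mulnA.
apply: lower_bound_terminates.
apply: terminates_weaken (terminates_halve D T v s2_in s2e s2N') => //.
move=> s3 [s3_in s34 s3N s3w].
have s34' : nmem s3 4 0%N = l by rewrite s34 s24 subn1.
have tE : (2 ^ l.+1 * k)%N%:R^-1 * 2 = (2 ^ l * k)%N%:R^-1 :> R.
  by rewrite expnS -mulnA natrM invfM mulrAC mulVf ?mul1r ?pnatr_eq0.
have -> : deviation (2 ^ l.+1 * k) s2 0 = lpnorm q (z - (2 ^ l * k)%N%:R^-1 *:
    \sum_(j < n) (nmem s3 1%N j)%:R *: v j).
  by rewrite /deviation /weighted_sum big_nil addr0 s3w scalerA tE.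
exact: IH s3 s3_in s34' s3N.
Qed.

Definition prog_cost := (3 + up_log 2 n * 3 + (3 + n * 4) +
  (up_log 2 n * level_cost (up_log 2 n) + 1))%N.

Lemma lower_bound_prog s (x : 'I_n -> R) : has_input s ->
    (forall j : 'I_n, x j = (2 ^ up_log 2 n * k)%N%:R * rmem s 1%N j) ->
    (\sum_j cumulative_round x j = 2 ^ up_log 2 n * k)%N ->
  lower_bound prog_cost caratheodory_prog s post
    (1 - (lpnorm q (z - (2 ^ up_log 2 n * k)%N%:R^-1 *:
      \sum_j (cumulative_round x j)%:R *: v j) + G (up_log 2 n)) / E).
Proof.
move=> s_in xE xN; set L := up_log 2 n in xE xN *.
have -> : prog_cost = (2 + (L * 3 + 1) + (1 + (n * 4 + 2) + (L * level_cost L + 1)))%N.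
  by rewrite /prog_cost -/L; move: (L * level_cost L)%N => *; lia.
apply: lower_bound_terminates.
apply: terminates_weaken (terminates_scale D T s_in n_gt0) => //.
move=> s1 [s1_in s1r s110 s14].
apply: lower_bound_terminates.
have xE1 (j : 'I_n) : x j = (nmem s1 10 0 * k)%N%:R * rmem s1 1%N j.
  by rewrite s110 s1r xE.
apply: terminates_weaken (terminates_round D T s1_in xE1) => //.
move=> s2 [s2_in s24 s2a].
have s2N : (\sum_(j < n) nmem s2 1 j = 2 ^ L * k)%N.
  by rewrite -xN; apply: eq_bigr => j _; rewrite s2a.
have nL : (n <= 2 ^ L)%N by exact: up_logP.
have := lower_bound_levels nL s2_in _ s2N; rewrite s24 s14 => /(_ erefl).
by under eq_bigr do rewrite s2a.
Qed.

End SuccessProbability.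

Lemma prog_cost_le T m n : (n <= m.+1)%N -> (m.+1 <= T m m.+1)%N ->
  (prog_cost T m n <= 22 * ((up_log 2 n).+1 ^ 2 * T m m.+1))%N.
Proof.
move=> nm mM; have nM := leq_trans nm mM; have M0 := leq_ltn_trans (leq0n m) mM.
rewrite /prog_cost /level_cost /round_cost; move: (T _ _) (up_log 2 n) nM M0 => M L nM M0.
have LM : (L <= L * M)%N by rewrite leq_pmulr.
have LLM : (L * L <= L * L * M)%N by rewrite leq_pmulr.
have LnM : (L * n <= L * M)%N by rewrite leq_mul.
nia.
Qed.

Lemma up_log_le_ln (R : realType) m n : (n <= m.+1)%N ->
  (up_log 2 n).+1%:R <= 8 * ln (maxn m 2)%:R :> R.
Proof.
move=> nm; set a : R := ln _; set L := up_log 2 n.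
have l2 := ln2_ge R.
have la : ln 2 <= a by rewrite /a ler_ln ?posrE ?ltr0n ?leq_max ?orbT// ler_nat leq_maxr.
have LE : (2 ^ L <= 2 ^ 2 * maxn m 2)%N.
  have [n1|n1] := leqP n 1.
    have -> : L = 0%N by apply/eqP; rewrite /L up_log_eq0 n1 orbT.
    by rewrite expn0 muln_gt0 leq_max orbT.
  have : (2 ^ L.-1 < n)%N by exact: up_log_gtn.
  have L0 : (0 < L)%N by rewrite up_log_gt0 n1.
  have -> : (2 ^ L = 2 * 2 ^ L.-1)%N by rewrite -expnS prednK.
  have := leq_maxl m 2; have := leq_maxr m 2.
  move: (2 ^ L.-1)%N (maxn m 2) => i M m2 mM i_n; rewrite -[(2 ^ 2)%N]/4%N. lia.
have : L%:R * ln 2 <= 2 * ln 2 + a.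
  have m0 : 0 < (maxn m 2)%:R :> R by rewrite ltr0n leq_max orbT.
  rewrite !mulr_natl -!lnXn// -lnM ?posrE ?exprn_gt0//.
  by rewrite ler_ln ?posrE ?mulr_gt0 ?exprn_gt0// -!natrX -natrM ler_nat.
rewrite -[L.+1%:R]natr1; have : (0 : R) <= L%:R by [].
move: (L%:R : R) (ln 2 : R) la l2 => x y la l2 x0 xy.
have [x2|x2] := leP x 2; first lra.
have : (x - 2) * (y - 2^-1) >= 0 by rewrite mulr_ge0 ?subr_ge0// ltW.
lra.
Qed.

Section OutputVectors.
Variables (R : realType) (m n : nat) (v : 'I_n -> 'cV[R]_m) (s : state R).

Lemma size_output_vectors : size (output_vectors v s) = (\sum_(j < n) nmem s 1 j)%N.
Proof.
rewrite size_flatten /shape -map_comp sumnE big_map big_enum/=.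
by apply: eq_bigr => j _; rewrite /= size_nseq.
Qed.

Lemma sum_output_vectors :
  \sum_(w <- output_vectors v s) w = \sum_(j < n) (nmem s 1 j)%:R *: v j.
Proof.
rewrite big_flatten/= big_map big_enum/=.
apply: eq_bigr => j _; elim: (nmem _ _ _) => [|c IH]; first by rewrite big_nil scale0r.
by rewrite /= big_cons IH -natr1 scalerDl scale1r addrC.
Qed.

Lemma mem_output_vectors w : w \in output_vectors v s -> exists j, w = v j.
Proof.
by case/flatten_mapP=> j _; rewrite mem_nseq => /andP[_ /eqP ->]; exists j.
Qed.

End OutputVectors.

Section InputState.
Variables (R : realType) (m n k : nat) (p q : \bar R) (v : 'I_n -> 'cV[R]_m) (lam : 'I_n -> R).
Let s := input_state k p q v lam.

Lemma input_state_vectors (r : 'I_m) i : (i < n)%N ->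
  rmem s 0 (r * n + i)%N = vec_at v i r ord0.
Proof.
move=> i_lt; have n0 := leq_ltn_trans (leq0n i) i_lt.
rewrite /s/= divnMDl// modnMDl divn_small// addn0 modn_small// valK.
by rewrite (@insubT _ (fun j => j < n)%N _ i i_lt)/= -vec_at_ord.
Qed.

Lemma input_state_weights (j : 'I_n) : rmem s 1 j = lam j.
Proof. by rewrite /s/= valK. Qed.

End InputState.

Theorem lovett_meka_program (R : realType) (C1 C2 C3 : R) : 0 < C1 -> 0 < C2 -> 0 < C3 ->
  exists (prog : seq cmd) (C : R), 0 < C /\
  forall (D : sampler R) (T : nat -> nat -> nat),
    lovett_meka C1 C2 C3 D -> sampling_time T ->
  forall (m k n : nat) (p q : \bar R) (X : set 'cV[R]_m)
    (z : 'cV[R]_m) (v : 'I_n -> 'cV[R]_m) (lam : 'I_n -> R),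
    (0 < m)%N -> (0 < k)%N -> (2%:E <= p)%E -> (p <= q)%E ->
    X `<=` lpball p -> (n <= m.+1)%N -> (forall j, X (v j)) ->
    convex_comb lam v z ->
  exists2 b : nat,
    b%:R <= C * log2sq R m * (T m m.+1)%:R &
    ((2^-1)%:E <=
     success_within D T b prog (input_state k p q v lam)
       (fun s => let vs := output_vectors v s in
          [/\ size vs = k, forall w, w \in vs -> X w &
              ((lpnorm q (z - k%:R^-1 *: \sum_(w <- vs) w))%:E
               <= C%:E * ac_bound m k p q)%E]))%E.
Proof.
move=> C1_gt0 C2_gt0 C3_gt0.
have [K K0 partial] := lovett_meka_step C1_gt0 C2_gt0 C3_gt0.
pose c := 128 * (6 * K); have c0 : 0 <= c by rewrite !mulr_ge0 ?(ltW K0).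
have [Cerr CerrE] : exists Cerr, Cerr = 2 * (3 * c + 2) by exists (2 * (3 * c + 2)).
have Cerr0 : 0 < Cerr by rewrite CerrE; lra.
have [Ctime CtimeE] : exists Ctime : R, Ctime = 22 * 8 ^+ 2 by exists (22 * 8 ^+ 2).
have Ctime0 : 0 <= Ctime by rewrite CtimeE mulr_ge0 ?exprn_ge0.
exists caratheodory_prog, (Cerr + Ctime); split; first by rewrite ltr_wpDr.
move=> D T LM [T_mono T_ge] m k n p q X z v lam m0 k0 p2 pq XP nm vX zE.
have [lam0 lam1 _] := zE.
have n0 : (0 < n)%N.
  rewrite lt0n; apply/eqP => n0; subst n; move/eqP: lam1.
  by rewrite big_ord0 eq_sym oner_eq0.
have mM : (m.+1 <= T m m.+1)%N by apply: leq_trans (T_ge _ _); rewrite leq_pmull.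
exists (prog_cost T m n).
  have := prog_cost_le nm mM; rewrite -(ler_nat R) => /le_trans; apply; rewrite natrM [X in _ * X]natrM natrX.
  rewrite mulrA ler_wpM2r// /log2sq.
  rewrite (@le_trans _ _ (Ctime * ln (maxn m 2)%:R ^+ 2))//; last first.
    by rewrite ler_wpM2r ?sqr_ge0// lerDr ltW.
  rewrite CtimeE -mulrA -exprMn ler_wpM2l// lerXn2r ?nnegrE//; last exact: up_log_le_ln.
  by rewrite mulr_ge0// ln_ge0// ler1n leq_max orbT.
have v1 j : lpnorm p (v j) <= 1 by exact: XP.
have p1 : (1 <= p)%E by apply: le_trans p2; rewrite lee_fin ler1n.
(* When the exponent is 0 the error target is infinite, but size, membership and running time remain
   to be shown; the choice q' = p has exponent 1/2. *)
have [q' [pq' al0 postE]] : exists q' : \bar R, [/\ (p <= q')%E, 0 < rate_exponent p q' &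
    forall x : 'cV[R]_m,
      lpnorm q' x <= Cerr * (rate_scale m k p q' / k%:R / rate_exponent p q') ->
      ((lpnorm q x)%:E <= (Cerr + Ctime)%:E * ac_bound m k p q)%E].
  have /andP[a0 _] := rate_exponent_itv p2 pq.
  have CC0 : 0 < Cerr + Ctime by rewrite ltr_wpDr.
  move: a0; rewrite le_eqVlt => /predU1P[/esym a0|a0].
    exists p; split=> //; first by rewrite /rate_exponent subrK.
    by move=> x _; rewrite ac_bound_pinfty// gt0_muley ?lte_fin// leey.
  exists q; split=> // x xE; rewrite ac_boundE// -EFinM lee_fin.
  apply: le_trans xE _; rewrite ler_wpM2r ?lerDl//.
  by rewrite !mulr_ge0 ?invr_ge0 ?(ltW a0)// (le_trans _ (rate_scale_ge m k0 p2 pq)).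
pose al := rate_exponent p q'; pose rho := rate_scale m k p q' / k%:R / al.
have rho0 : 0 < rho.
  rewrite !divr_gt0 ?ltr0n// (lt_le_trans _ (rate_scale_ge m k0 p2 pq'))//.
have q'1 := le_trans p1 pq'.
pose N := (2 ^ up_log 2 n * k)%N; have N0 : (0 < N)%N by rewrite muln_gt0 expn_gt0.
pose x (j : 'I_n) := N%:R * lam j.
pose step h := K * (Num.sqrt (moment_order m p h%:R) * h%:R `^ rate_exponent p q').
pose F h := colouring_potential m k p q' (6 * K) h%:R : R.
pose G l := 3 * (c * rho) * (1 - (3 / 4) ^+ l) : R.
(* Twice the bound on the mean error, which is 3 c rho from the levels plus 2 rho from the initial
   rounding; hence the success probability 1/2. *)
pose E := 2 * (3 * c + 2) * rho.
have E0 : 0 < E by rewrite mulr_gt0//; lra.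
have c6 : 0 <= 6 * K by rewrite mulr_ge0// ltW.
have c'0 : 0 <= 3 * (c * rho) by rewrite mulr_ge0 ?ler0n// mulr_ge0 ?(ltW rho0).
have err : 2^-1 <= 1 - (lpnorm q' (z - N%:R^-1 *:
    \sum_j (cumulative_round x j)%:R *: v j) + G (up_log 2 n)) / E.
  have nN : n%:R / N%:R <= k%:R^-1 :> R.
    rewrite ler_pdivrMr ?ltr0n// /N natrM mulrC mulfK ?pnatr_eq0 -?lt0n//.
    by rewrite ler_nat up_logP.
  have := le_trans (cumulative_round_error p2 pq' N0 v1 zE) (le_trans nN (inv_le_rate m k0 p2 pq' al0)).
  rewrite -/al -/rho -/x; move: (lpnorm _ _) => d d_le.
  have Gle : G (up_log 2 n) <= 3 * (c * rho).
    by rewrite /G ler_piMr// gerBl exprn_ge0// divr_ge0.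
  rewrite lerBrDr -lerBrDl ler_pdivrMr// /E; move: Gle d_le; clear; lra.
apply: (@le_trans _ _ (_%:E)); first by rewrite lee_fin; exact: err.
apply: (lower_bound_prog (step := step) (F := F) (V := rmem (input_state k p q v lam) 0)
  m0 k0 n0 nm T_mono T_ge _ p1 q'1 v1 E0 _ _ _ _ _ _ (s := input_state k p q v lam)) => //.
- by move=> r i; exact: input_state_vectors.
- by move=> h A x0 h0 A2 x0c; exact: partial LM m h p q' A x0 m0 h0 p2 pq' A2 x0c.
- by rewrite /F; apply: colouring_potential_ge0 => //; exact: ltW.
- move=> h h' h0 hh; rewrite /F /step; apply: colouring_potential_step => //; first exact: ltW.
  by move: hh (ler0n R h'); rewrite -(ler_nat R) natrM; clear; lra.
- by rewrite /G expr0 subrr mulr0.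
- move=> l h hl; have hN : (h <= 2 ^ l.+1 * k)%N by apply: leq_trans hl; rewrite leq_pmull.
  have Fle : F h <= F (2 ^ l.+1 * k)%N.
    by rewrite /F; apply: colouring_potential_mono => //; rewrite ler_nat.
  rewrite -lerBrDr; apply: (@le_trans _ _ (F (2 ^ l.+1 * k)%N / (2 ^ l.+1 * k)%N%:R)).
    by rewrite ler_wpM2r ?invr_ge0.
  apply: le_trans (colouring_potential_level m k0 p2 pq' l.+1 al0 c6) _.
  rewrite -/c (_ : c / _ * _ = c * rho); last by rewrite /rho mulrAC mulrA.
  rewrite /G; move: (c * rho) => y; rewrite !exprS; clear; lra.
- move=> s sk sE /=; rewrite size_output_vectors sum_output_vectors; split=> //.
    by move=> w /mem_output_vectors[j ->].
  by apply: postE; rewrite CerrE; exact: ltW.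
- by move=> j; rewrite input_state_weights.
- exact: sum_cumulative_round_conv.
Qed.

Theorem theorem4 (R : realType) :
  [/\ exists2 C : R, 0 < C &
        forall (m k : nat) (p q : \bar R),
          (0 < m)%N -> (0 < k)%N -> (2%:E <= p)%E -> (p <= q)%E ->
          (ac k (@lpball R m p) (@lpball R m q) <= C%:E * ac_bound m k p q)%E,
      forall C1 C2 C3 : R, 0 < C1 -> 0 < C2 -> 0 < C3 ->
        exists (prog : seq cmd) (C : R), 0 < C /\
        forall (D : sampler R) (T : nat -> nat -> nat),
          lovett_meka C1 C2 C3 D -> sampling_time T ->
        forall (m k n : nat) (p q : \bar R) (X : set 'cV[R]_m)
          (z : 'cV[R]_m) (v : 'I_n -> 'cV[R]_m) (lam : 'I_n -> R),
          (0 < m)%N -> (0 < k)%N -> (2%:E <= p)%E -> (p <= q)%E ->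
          X `<=` lpball p -> (n <= m.+1)%N -> (forall j, X (v j)) ->
          convex_comb lam v z ->
        exists2 b : nat,
          b%:R <= C * log2sq R m * (T m m.+1)%:R &
          ((2^-1)%:E <=
           success_within D T b prog (input_state k p q v lam)
             (fun s => let vs := output_vectors v s in
                [/\ size vs = k, forall w, w \in vs -> X w &
                    ((lpnorm q (z - k%:R^-1 *: \sum_(w <- vs) w))%:E
                     <= C%:E * ac_bound m k p q)%E]))%E
    & forall C4 : R, 0 < C4 -> exists2 C5 : R, 0 < C5 &
        forall T : nat -> nat -> nat, sampling_time T ->
          (forall m n : nat, (0 < m)%N -> (0 < n)%N ->
             (T m n)%:R <= C4 * (n%:R `^ (1 + omega R) + n%:R ^+ 2 * m%:R)) ->
        forall m : nat, (0 < m)%N ->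
          log2sq R m * (T m m.+1)%:R
          <= C5 * (m%:R `^ (1 + omega R) * log2sq R m) ].
Proof.
split; first exact: ac_le.
  by move=> C1 C2 C3 C1_gt0 C2_gt0 C3_gt0; exact: lovett_meka_program.
by move=> C4 C4_gt0; exact: time_le.
Qed.
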